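(* Let $n_1,n_2,n_3$ be positive integers with $1/n_1+1/n_2+1/n_3>1$, and let $D=\{a_1,a_2,a_3\}\subset\mathbb{P}^1$ be a set of three distinct points of the Riemann sphere. Then any representation $\rho:\pi_1(\mathbb{P}^1\setminus D)\to\mathrm{GL}_n(\mathbb{C})$ sending loops around the $a_i$ to unipotent matrices $\rho_i$ with $(\rho_i-1)^{n_i}=0$ ($i=1,2,3$) arises as the monodromy of a logarithmic connection on a trivial vector bundle on $\mathbb{P}^1$ (that is, of a Fuchsian system), with poles in $D$.
   Context: A logarithmic connection on a holomorphic vector bundle $E$ on $\mathbb{P}^1$ with poles in $D$ is a connection $\nabla:E\to\Omega^1_{\mathbb{P}^1}(\log D)\otimes E$, holomorphic except possibly for logarithmic (simple) poles on $D$. Its monodromy is the representation of $\pi_1(\mathbb{P}^1\setminus D)$ (up to isomorphism) given by analytic continuation of horizontal sections of $\nabla$ on $\mathbb{P}^1\setminus D$. A trivial vector bundle of rank $n$ is one isomorphic to $\mathcal{O}^n$. *)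

(* Defs.v *)
From HB Require Import structures.
From mathcomp Require Import all_boot all_order all_algebra generic_quotient.
From mathcomp Require Import complex.
From mathcomp Require Import all_classical all_reals all_analysis homotopy.
From mathcomp Require Import lra.

Set Implicit Arguments.
Unset Strict Implicit.
Unset Printing Implicit Defensive.
Import Order.TTheory GRing.Theory Num.Theory numFieldNormedType.Exports.

Local Open Scope classical_set_scope.
Local Open Scope ring_scope.
Local Open Scope quotient_scope.

(* The library puts the topology of a numFieldType K on K^o; R[i] needs an
   explicit copy. *)
HB.instance Definition _ (R : realType) := NormedModule.copy R[i] R[i]^o.

Section UnitInterval.
Variable R : realType.

Definition unit_itv : Type := set_type `[0 : R, 1 : R]%classic.

HB.instance Definition _ := Topological.on unit_itv.

Definition itv_val (t : unit_itv) : R := set_val t.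

Fact clamp_subproof (t : R) :
  Num.max 0 (Num.min 1 t) \in `[0 : R, 1 : R]%classic.
Proof.
rewrite inE /= in_itv /= le_max lexx /= ge_max ler01 /=.
by rewrite ge_min lexx.
Qed.

Definition clamp (t : R) : unit_itv :=
  @exist R (fun x => x \in `[0 : R, 1 : R]%classic) _ (clamp_subproof t).

Lemma itv_val_ge0 (t : unit_itv) : 0 <= itv_val t.
Proof. by have := set_valP t; rewrite /= in_itv /= => /andP[]. Qed.

Lemma itv_val_le1 (t : unit_itv) : itv_val t <= 1.
Proof. by have := set_valP t; rewrite /= in_itv /= => /andP[]. Qed.

Lemma itv_val_inj : injective itv_val.
Proof. exact: val_inj. Qed.

Lemma clampK (t : R) : 0 <= t <= 1 -> itv_val (clamp t) = t.
Proof.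
case/andP=> t0 t1; rewrite /itv_val /clamp set_valE /=.
by rewrite min_r // max_r.
Qed.

Lemma itv_valK (t : unit_itv) : clamp (itv_val t) = t.
Proof. by apply: itv_val_inj; rewrite clampK // itv_val_ge0 itv_val_le1. Qed.

Lemma itv_val_continuous : continuous itv_val.
Proof. exact: initial_continuous. Qed.

Lemma clamp_continuous : continuous clamp.
Proof.
apply: continuous_comp_initial => t.
apply: (@continuous_max _ _ (cst 0) (fun u : R => Num.min 1 u)).
  exact: cvg_cst.
by apply: (@continuous_min _ _ (cst 1) idfun); [exact: cvg_cst|exact: cvg_id].
Qed.

Fact zero_one_neq_subproof : clamp 0 != clamp 1.
Proof.
apply/eqP => /(congr1 itv_val); rewrite !clampK ?lexx ?ler01 // => /esym/eqP.
by rewrite oner_eq0.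
Qed.

HB.instance Definition _ := Choice.on unit_itv.
HB.instance Definition _ :=
  isBiPointed.Build unit_itv zero_one_neq_subproof.

Lemma itv_val0 : itv_val zero = 0.
Proof. by rewrite clampK // lexx ler01. Qed.

Lemma itv_val1 : itv_val one = 1.
Proof. by rewrite clampK // lexx ler01. Qed.

End UnitInterval.


Section Continuity.
Variable R : realType.
Implicit Types T U V : topologicalType.

Lemma comp_continuous T U V (f : T -> U) (g : U -> V) :
  continuous f -> continuous g -> continuous (fun z => g (f z)).
Proof. by move=> cf cg z; apply: continuous_comp; [exact: cf|exact: cg]. Qed.

Lemma pair_continuous T U V (f : T -> U) (g : T -> V) :
  continuous f -> continuous g -> continuous (fun z => (f z, g z)).
Proof. by move=> cf cg z; apply: cvg_pair; [exact: cf|exact: cg]. Qed.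

Lemma affine_continuous T (f : T -> R) (c d : R) :
  continuous f -> continuous (fun t => c * f t + d).
Proof.
move=> cf t; apply: cvgD; last exact: cvg_cst.
by apply: cvgM; [exact: cvg_cst|exact: cf].
Qed.

Lemma max_fun_continuous T (f g : T -> R) :
  continuous f -> continuous g -> continuous (fun t => Num.max (f t) (g t)).
Proof. by move=> cf cg t; exact: (@continuous_max _ _ f g t (cf t) (cg t)). Qed.

Lemma min_fun_continuous T (f g : T -> R) :
  continuous f -> continuous g -> continuous (fun t => Num.min (f t) (g t)).
Proof. by move=> cf cg t; exact: (@continuous_min _ _ f g t (cf t) (cg t)). Qed.

Lemma id_continuous T : continuous (fun t : T => t).
Proof. by move=> t; exact: cvg_id. Qed.

Lemma fst_continuous T U : continuous (@fst T U).
Proof. by move=> z; exact: cvg_fst. Qed.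

Lemma snd_continuous T U : continuous (@snd T U).
Proof. by move=> z; exact: cvg_snd. Qed.

Lemma paste_continuous T U (u : T -> R) (c : R) (g h : T -> U) :
  continuous u -> continuous g -> continuous h ->
  (forall z, u z = c -> g z = h z) ->
  continuous (fun z => if u z <= c then g z else h z).
Proof.
move=> cu cg ch gh z W.
have [uz|uz|uz] := ltgtP (u z) c.
- have near_lt : \forall w \near z, u w < c
    by apply: (cu z [set v | v < c]); exact: lt_nbhsl.
  move=> /(cg z) gW; apply: filterS2 near_lt gW => w /= /ltW ->; exact.
- have near_gt : \forall w \near z, c < u w
    by apply: (cu z [set v | c < v]); exact: lt_nbhsr.
  move=> /(ch z) hW; apply: filterS2 near_gt hW => w /=.
  by rewrite ltNge => /negPf ->.
- move=> Wz; have gW := cg z _ Wz.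
  have hW : nbhs z (h @^-1` W) by apply: (ch z W); rewrite /= -(gh z uz).
  by apply: filterS2 hW gW => w /= ? ?; case: ifP.
Qed.

End Continuity.

Section Paths.
Variables (R : realType) (X : topologicalType).
Local Notation I := (unit_itv R).

Section PathR.
Variables (x y : X) (f : R -> X).
Hypotheses (cf : continuous f) (f0 : f 0 = x) (f1 : f 1 = y).

Fact pathR_continuous : continuous (fun t : I => f (itv_val t)).
Proof. exact: comp_continuous (@itv_val_continuous R) cf. Qed.

Fact pathR_zero : f (itv_val (zero : I)) = x. Proof. by rewrite itv_val0. Qed.
Fact pathR_one : f (itv_val (one : I)) = y. Proof. by rewrite itv_val1. Qed.

Definition pathR : {path I from x to y in X} :=
  mk_path pathR_continuous pathR_zero pathR_one.

End PathR.

Lemma ext_continuous (x y : X) (p : {path I from x to y in X}) :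
  continuous (fun t : R => p (clamp t)).
Proof. by apply: comp_continuous (@clamp_continuous R) _; exact: cts_fun. Qed.

Arguments ext_continuous {x y} p.

Lemma clamp0 : clamp 0 = zero :> I. Proof. by []. Qed.
Lemma clamp1 : clamp 1 = one :> I. Proof. by []. Qed.

Definition homotopic (x y : X) (p q : {path I from x to y in X}) : Prop :=
  exists H : I * I -> X,
    [/\ continuous H,
        forall t, H (zero, t) = p t,
        forall t, H (one, t) = q t &
        forall s, H (s, zero) = x /\ H (s, one) = y].

Lemma homotopicI (x y : X) (p q : {path I from x to y in X}) (K : R * R -> X) :
  continuous K ->
  (forall t : I, K (0, itv_val t) = p t) ->
  (forall t : I, K (1, itv_val t) = q t) ->
  (forall s : I, K (itv_val s, 0) = x /\ K (itv_val s, 1) = y) ->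
  homotopic p q.
Proof.
move=> cK K0 K1 Ke.
exists (fun z => K (itv_val z.1, itv_val z.2)); split => /=.
- apply: comp_continuous cK; apply: pair_continuous.
    exact: comp_continuous (@fst_continuous _ _) (@itv_val_continuous R).
  exact: comp_continuous (@snd_continuous _ _) (@itv_val_continuous R).
- by move=> t; rewrite itv_val0.
- by move=> t; rewrite itv_val1.
- by move=> s; rewrite itv_val0 itv_val1.
Qed.

Lemma homotopicE (x y : X) (p q : {path I from x to y in X}) :
  homotopic p q ->
  exists K : R * R -> X,
    [/\ continuous K,
        forall t, K (0, t) = p (clamp t),
        forall t, K (1, t) = q (clamp t) &
        forall s, K (s, 0) = x /\ K (s, 1) = y].
Proof.
move=> [H [cH H0 H1 He]].
exists (fun z => H (clamp z.1, clamp z.2)); split => //=.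
apply: comp_continuous cH; apply: pair_continuous.
  exact: comp_continuous (@fst_continuous _ _) (@clamp_continuous R).
exact: comp_continuous (@snd_continuous _ _) (@clamp_continuous R).
Qed.

Lemma homotopic_refl (x y : X) (p : {path I from x to y in X}) : homotopic p p.
Proof.
apply: (@homotopicI _ _ _ _ (fun z => p (clamp z.2))) => /=.
- exact: comp_continuous (@snd_continuous _ _) (ext_continuous p).
- by move=> t; rewrite itv_valK.
- by move=> t; rewrite itv_valK.
- by move=> s; rewrite clamp0 clamp1 path_zero path_one.
Qed.

Lemma homotopic_sym (x y : X) (p q : {path I from x to y in X}) :
  homotopic p q -> homotopic q p.
Proof.
move=> /homotopicE [K [cK K0 K1 Ke]].
apply: (@homotopicI _ _ _ _ (fun z => K (-1 * z.1 + 1, z.2))) => /=.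
- apply: comp_continuous cK; apply: pair_continuous (@snd_continuous _ _).
  exact: affine_continuous (@fst_continuous _ _).
- by move=> t; rewrite mulr0 add0r K1 itv_valK.
- by move=> t; rewrite mulr1 addNr K0 itv_valK.
- by move=> s; exact: Ke.
Qed.

Lemma homotopic_trans (x y : X) (q p r : {path I from x to y in X}) :
  homotopic p q -> homotopic q r -> homotopic p r.
Proof.
move=> /homotopicE [K [cK K0 K1 Ke]] /homotopicE [L [cL L0 L1 Le]].
apply: (@homotopicI _ _ _ _ (fun z => if z.1 <= 2^-1 then K (2 * z.1 + 0, z.2)
                                   else L (2 * z.1 - 1, z.2))) => /=.
- apply: paste_continuous (@fst_continuous _ _) _ _ _.
  + apply: comp_continuous cK; apply: pair_continuous (@snd_continuous _ _).
    exact: affine_continuous (@fst_continuous _ _).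
  + apply: comp_continuous cL; apply: pair_continuous (@snd_continuous _ _).
    exact: affine_continuous (@fst_continuous _ _).
  + by move=> [s t] /= ->; rewrite divff ?pnatr_eq0 // subrr addr0 K1 L0.
- by move=> t; rewrite invr_ge0 ler0n mulr0 addr0 K0 itv_valK.
- move=> t; rewrite ifF; last by apply/negbTE; rewrite -ltNge; lra.
  by rewrite (_ : 2 * 1 - 1 = 1 :> R) ?L1 ?itv_valK //; lra.
- by move=> s; case: ifP => _; [exact: Ke|exact: Le].
Qed.

(* Two reparametrizations of a path along parameter functions with the same
   endpoints are homotopic; all the group laws are instances of this. *)
Lemma homotopic_reparam (x y x' y' : X) (p : {path I from x to y in X})
    (u v : {path I from x' to y' in X}) (phi psi : R -> R) :
  continuous phi -> continuous psi ->
  phi 0 = psi 0 -> phi 1 = psi 1 ->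
  (forall t, u t = p (clamp (phi (itv_val t)))) ->
  (forall t, v t = p (clamp (psi (itv_val t)))) ->
  homotopic u v.
Proof.
move=> cphi cpsi e0 e1 uE vE.
pose K (z : R * R) := p (clamp ((1 - z.1) * phi z.2 + z.1 * psi z.2)).
apply: (@homotopicI _ _ _ _ K); rewrite /K /=.
- apply: comp_continuous (ext_continuous p) => z.
  apply: cvgD; apply: cvgM.
  + by apply: cvgB; [exact: cvg_cst|exact: cvg_fst].
  + exact: (comp_continuous (@snd_continuous _ _) cphi).
  + exact: cvg_fst.
  + exact: (comp_continuous (@snd_continuous _ _) cpsi).
- by move=> t; rewrite uE subr0 mul1r mul0r addr0.
- by move=> t; rewrite vE subrr mul1r mul0r add0r.
- move=> s; rewrite -e0 -e1 -!mulrDl subrK !mul1r; split.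
    by rewrite -[in RHS](@path_zero _ _ _ _ u) uE itv_val0.
  by rewrite -[in RHS](@path_one _ _ _ _ u) uE itv_val1.
Qed.

Section Concat.
Variables (x y z : X).
Variables (p : {path I from x to y in X}) (q : {path I from y to z in X}).

Definition concat_fun (t : R) : X :=
  if t <= 2^-1 then p (clamp (2 * t + 0)) else q (clamp (2 * t - 1)).

Fact concat_continuous : continuous concat_fun.
Proof.
apply: paste_continuous (@id_continuous _) _ _ _.
- apply: comp_continuous (ext_continuous p).
  exact: affine_continuous (@id_continuous _).
- apply: comp_continuous (ext_continuous q).
  exact: affine_continuous (@id_continuous _).
- move=> t ->; rewrite divff ?pnatr_eq0 // subrr addr0 clamp0 clamp1.
  by rewrite path_zero path_one.
Qed.

Fact concat_zero : concat_fun 0 = x.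
Proof. by rewrite /concat_fun invr_ge0 ler0n mulr0 addr0 clamp0 path_zero. Qed.

Fact concat_one : concat_fun 1 = z.
Proof.
rewrite /concat_fun ifF; last by apply/negbTE; rewrite -ltNge; lra.
by rewrite (_ : 2 * 1 - 1 = 1 :> R) ?clamp1 ?path_one //; lra.
Qed.

(* First p, then q. *)
Definition concat : {path I from x to z in X} :=
  pathR concat_continuous concat_zero concat_one.

Lemma concatE (t : I) : concat t = concat_fun (itv_val t). Proof. by []. Qed.

End Concat.

Section Reverse.
Variables (x y : X) (p : {path I from x to y in X}).

Fact reverse_continuous : continuous (fun t : R => p (clamp (-1 * t + 1))).
Proof.
apply: comp_continuous (ext_continuous p).
exact: affine_continuous (@id_continuous _).
Qed.

Fact reverse_zero : p (clamp (-1 * 0 + 1)) = y.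
Proof. by rewrite mulr0 add0r clamp1 path_one. Qed.

Fact reverse_one : p (clamp (-1 * 1 + 1)) = x.
Proof. by rewrite mulr1 addNr clamp0 path_zero. Qed.

Definition reverse : {path I from y to x in X} :=
  pathR reverse_continuous reverse_zero reverse_one.

Lemma reverseE (t : I) : reverse t = p (clamp (-1 * itv_val t + 1)).
Proof. by []. Qed.

End Reverse.

Definition const_path (x : X) : {path I from x to x in X} := cst x.

Lemma concat_homotopic (x y z : X) (p p' : {path I from x to y in X})
    (q q' : {path I from y to z in X}) :
  homotopic p p' -> homotopic q q' -> homotopic (concat p q) (concat p' q').
Proof.
move=> /homotopicE [K [cK K0 K1 Ke]] /homotopicE [L [cL L0 L1 Le]].
apply: (@homotopicI _ _ _ _ (fun z => if z.2 <= 2^-1 then K (z.1, 2 * z.2 + 0)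
                                   else L (z.1, 2 * z.2 - 1))) => /=.
- apply: paste_continuous (@snd_continuous _ _) _ _ _.
  + apply: comp_continuous cK; apply: pair_continuous (@fst_continuous _ _) _.
    exact: affine_continuous (@snd_continuous _ _).
  + apply: comp_continuous cL; apply: pair_continuous (@fst_continuous _ _) _.
    exact: affine_continuous (@snd_continuous _ _).
  + move=> [s t] /= ->; rewrite divff ?pnatr_eq0 // subrr addr0.
    by rewrite (Ke s).2 (Le s).1.
- by move=> t; rewrite K0 L0.
- by move=> t; rewrite K1 L1.
- move=> s; rewrite invr_ge0 ler0n mulr0 addr0 (Ke _).1.
  split=> //; rewrite ifF; last by apply/negbTE; rewrite -ltNge; lra.
  by rewrite (_ : 2 * 1 - 1 = 1 :> R) ?(Le _).2 //; lra.
Qed.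

Lemma reverse_homotopic (x y : X) (p p' : {path I from x to y in X}) :
  homotopic p p' -> homotopic (reverse p) (reverse p').
Proof.
move=> /homotopicE [K [cK K0 K1 Ke]].
apply: (@homotopicI _ _ _ _ (fun z => K (z.1, -1 * z.2 + 1))) => /=.
- apply: comp_continuous cK; apply: pair_continuous (@fst_continuous _ _) _.
  exact: affine_continuous (@snd_continuous _ _).
- by move=> t; rewrite K0.
- by move=> t; rewrite K1.
- by move=> s; rewrite mulr0 mulr1 add0r addNr; have [] := Ke (itv_val s).
Qed.

Lemma concat_const_r (x y : X) (p : {path I from x to y in X}) :
  homotopic (concat p (const_path y)) p.
Proof.
apply: (@homotopic_reparam _ _ _ _ p _ _ (fun t => Num.min 1 (2 * t + 0)) id).
- apply: min_fun_continuous; first by move=> t; exact: cvg_cst.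
  exact: affine_continuous (@id_continuous _).
- exact: id_continuous.
- by rewrite mulr0 addr0 min_r // ler01.
- by rewrite min_l //; lra.
- move=> t; rewrite concatE /concat_fun; case: ifPn => ht.
    by rewrite min_r //; lra.
  rewrite min_l; last by rewrite -ltNge in ht; lra.
  by rewrite clamp1 path_one.
- by move=> t; rewrite itv_valK.
Qed.

Lemma concat_const_l (x y : X) (p : {path I from x to y in X}) :
  homotopic (concat (const_path x) p) p.
Proof.
apply: (@homotopic_reparam _ _ _ _ p _ _ (fun t => Num.max 0 (2 * t - 1)) id).
- apply: max_fun_continuous; first by move=> t; exact: cvg_cst.
  exact: affine_continuous (@id_continuous _).
- exact: id_continuous.
- by rewrite max_l //; lra.
- by rewrite max_r //; lra.
- move=> t; rewrite concatE /concat_fun; case: ifPn => ht.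
    by rewrite max_l ?clamp0 ?path_zero //; lra.
  by rewrite max_r //; rewrite -ltNge in ht; lra.
- by move=> t; rewrite itv_valK.
Qed.

Lemma concat_reverse_r (x y : X) (p : {path I from x to y in X}) :
  homotopic (concat p (reverse p)) (const_path x).
Proof.
apply: (@homotopic_reparam _ _ _ _ p _ _
  (fun t => Num.min (2 * t + 0) (-2 * t + 2)) (cst 0)).
- by apply: min_fun_continuous; exact: affine_continuous (@id_continuous _).
- by move=> t; exact: cvg_cst.
- by rewrite min_l /=; lra.
- by rewrite min_r /=; lra.
- move=> t; have t1 := itv_val_le1 t.
  rewrite concatE /concat_fun; case: ifPn => ht.
    by rewrite min_l //; lra.
  rewrite -ltNge in ht; rewrite reverseE clampK; last lra.
  by rewrite min_r; [congr (p (clamp _)); lra|lra].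
- by move=> t; rewrite clamp0 path_zero.
Qed.

Lemma concat_reverse_l (x y : X) (p : {path I from x to y in X}) :
  homotopic (concat (reverse p) p) (const_path y).
Proof.
apply: (@homotopic_reparam _ _ _ _ p _ _
  (fun t => Num.max (-2 * t + 1) (2 * t - 1)) (cst 1)).
- by apply: max_fun_continuous; exact: affine_continuous (@id_continuous _).
- by move=> t; exact: cvg_cst.
- by rewrite max_l /=; lra.
- by rewrite max_r /=; lra.
- move=> t; have t0 := itv_val_ge0 t.
  rewrite concatE /concat_fun; case: ifPn => ht.
    rewrite reverseE clampK; last lra.
    by rewrite max_l; [congr (p (clamp _)); lra|lra].
  by rewrite -ltNge in ht; rewrite max_r //; lra.
- by move=> t; rewrite clamp1 path_one.
Qed.

Lemma concat_assoc (w x y z : X) (p : {path I from w to x in X})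
    (q : {path I from x to y in X}) (r : {path I from y to z in X}) :
  homotopic (concat p (concat q r)) (concat (concat p q) r).
Proof.
apply: homotopic_sym.
pose phi (t : R) := Num.min (2 * t + 0) (Num.min (1 * t + 4^-1) (2^-1 * t + 2^-1)).
apply: (@homotopic_reparam _ _ _ _ (concat p (concat q r)) _ _ phi id).
- apply: min_fun_continuous; first exact: affine_continuous (@id_continuous _).
  by apply: min_fun_continuous; exact: affine_continuous (@id_continuous _).
- exact: id_continuous.
- by rewrite /phi min_l ?le_min /=; lra.
- by rewrite /phi [X in Num.min _ X]min_r ?min_r /=; lra.
- move=> t; have t0 := itv_val_ge0 t; have t1 := itv_val_le1 t.
  rewrite /phi !concatE /concat_fun.
  set u := itv_val t in t0 t1 *.
  have [h1|h1] := lerP u 2^-1.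
    rewrite [X in Num.min _ X]min_l; last lra.
    rewrite concatE /concat_fun clampK; last lra.
    have [h2|h2] := lerP (2 * u + 0) 2^-1.
      rewrite min_l; last lra.
      by rewrite clampK ?ifT //; lra.
    rewrite min_r; last lra.
    rewrite clampK; last lra.
    rewrite ifF; last by apply/negbTE; rewrite -ltNge; lra.
    rewrite concatE /concat_fun clampK; last lra.
    by rewrite ifT; [congr (q (clamp _)); lra|lra].
  rewrite [X in Num.min _ X]min_r; last lra.
  rewrite min_r; last lra.
  rewrite clampK; last lra.
  rewrite ifF; last by apply/negbTE; rewrite -ltNge; lra.
  rewrite concatE /concat_fun clampK; last lra.
  rewrite ifF; last by apply/negbTE; rewrite -ltNge; lra.
  by congr (r (clamp _)); lra.
- by move=> t; rewrite itv_valK.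
Qed.

End Paths.

Section FundamentalGroup.
Variables (R : realType) (X : topologicalType) (b : X).

Definition loop : Type := {path (unit_itv R) from b to b in X}.

HB.instance Definition _ := Choice.on loop.

Definition homotopicb : rel loop := fun p q => `[< homotopic p q >].

Fact homotopicb_refl : reflexive homotopicb.
Proof. by move=> p; apply/asboolP; exact: homotopic_refl. Qed.

Fact homotopicb_sym : symmetric homotopicb.
Proof. by move=> p q; apply: asbool_equiv_eq; split; exact: homotopic_sym. Qed.

Fact homotopicb_trans : transitive homotopicb.
Proof.
move=> q p r /asboolP pq /asboolP qr; apply/asboolP.
exact: homotopic_trans pq qr.
Qed.

Canonical homotopic_equiv :=
  EquivRel homotopicb homotopicb_refl homotopicb_sym homotopicb_trans.

Definition pi1 : Type := {eq_quot homotopic_equiv}.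

HB.instance Definition _ := Choice.on pi1.
HB.instance Definition _ := EqQuotient.on pi1.

Definition pi1_class (p : loop) : pi1 := \pi_pi1 p.

Lemma pi1_classP (p q : loop) : pi1_class p = pi1_class q <-> homotopic p q.
Proof.
split=> [/eqmodP /= /asboolP //|pq].
by apply/eqmodP => /=; exact/asboolP.
Qed.

Lemma repr_homotopic (p : loop) : homotopic (repr (pi1_class p)) p.
Proof. by apply/pi1_classP; rewrite /pi1_class reprK. Qed.

Lemma pi1_ind (P : pi1 -> Prop) : (forall p, P (pi1_class p)) -> forall g, P g.
Proof. by move=> Pc g; rewrite -[g]reprK; exact: Pc. Qed.

(* Composition from right to left: g * h is the class of a representative of h
   followed by a representative of g. With this order analytic continuation is
   a homomorphism (with the other one it is an antihomomorphism). *)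
Definition pi1_mul (g h : pi1) : pi1 := pi1_class (concat (repr h) (repr g)).
Definition pi1_one : pi1 := pi1_class (const_path R b).
Definition pi1_inv (g : pi1) : pi1 := pi1_class (reverse (repr g)).

Lemma pi1_mulE (p q : loop) :
  pi1_mul (pi1_class p) (pi1_class q) = pi1_class (concat q p).
Proof. by apply/pi1_classP; apply: concat_homotopic; exact: repr_homotopic. Qed.

Lemma pi1_invE (p : loop) : pi1_inv (pi1_class p) = pi1_class (reverse p).
Proof. by apply/pi1_classP; apply: reverse_homotopic; exact: repr_homotopic. Qed.

Fact pi1_mulA : associative pi1_mul.
Proof.
elim/pi1_ind=> p; elim/pi1_ind=> q; elim/pi1_ind=> r; rewrite !pi1_mulE.
by apply/pi1_classP; apply: homotopic_sym; exact: concat_assoc.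
Qed.

Fact pi1_mul1g : left_id pi1_one pi1_mul.
Proof.
by elim/pi1_ind=> p; rewrite pi1_mulE; apply/pi1_classP; exact: concat_const_r.
Qed.

Fact pi1_mulg1 : right_id pi1_one pi1_mul.
Proof.
by elim/pi1_ind=> p; rewrite pi1_mulE; apply/pi1_classP; exact: concat_const_l.
Qed.

Fact pi1_mulVg : left_inverse pi1_one pi1_inv pi1_mul.
Proof.
elim/pi1_ind=> p; rewrite pi1_invE pi1_mulE; apply/pi1_classP.
exact: concat_reverse_r.
Qed.

Fact pi1_mulgV : right_inverse pi1_one pi1_inv pi1_mul.
Proof.
elim/pi1_ind=> p; rewrite pi1_invE pi1_mulE; apply/pi1_classP.
exact: concat_reverse_l.
Qed.

HB.instance Definition _ :=
  isGroup.Build pi1 pi1_mulA pi1_mul1g pi1_mulg1 pi1_mulVg pi1_mulgV.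

End FundamentalGroup.

Section Representations.
Variables (F : fieldType) (G : groupType) (n : nat).

(* Homomorphisms G -> GL_n(F): the values are invertible because G is a group. *)
Record representation := Representation {
  rep_fun :> G -> 'M[F]_n;
  rep1 : rep_fun 1%g = 1%:M;
  repM : forall g h, rep_fun (g * h)%g = rep_fun g *m rep_fun h
}.

Definition rep_iso (rho sigma : representation) : Prop :=
  exists2 P : 'M[F]_n, P \in unitmx &
    forall g, sigma g = P *m rho g *m invmx P.

Lemma rep_unit (rho : representation) g : rho g \in unitmx.
Proof.
by have /mulmx1_unit[] : rho g *m rho g^-1%g = 1%:M
  by rewrite -repM mulgV rep1.
Qed.

End Representations.

Section Sphere.
Variable R : realType.
Local Notation C := R[i].

Definition sphere : Type := one_point_compactification C.

HB.instance Definition _ := Topological.on sphere.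
HB.instance Definition _ := Choice.on sphere.

(* The two charts, z and w = 1 / z. *)
Definition chart0 (z : C) : sphere := Some z.
Definition chartoo (w : C) : sphere := if w == 0 then None else Some w^-1.

(* A local coordinate centred at p. *)
Definition coord (p : sphere) (w : C) : sphere :=
  if p is Some a then chart0 (a + w) else chartoo w.

Variable D : set sphere.

Definition punctured : Type := set_type (~` D).

HB.instance Definition _ := Topological.on punctured.

Definition circle (r t : R) : C :=
  ((r * cos (2 * pi * t)) +i* (r * sin (2 * pi * t)))%C.

(* gamma is freely homotopic in the complement of D to a small circle around a,
   run through once counterclockwise in a local coordinate; the punctured
   closed disc bounded by this circle does not meet D. *)
Definition loop_around (a : sphere) (b : punctured) (gamma : loop R b) : Prop :=
  exists r : R,
    [/\ 0 < r,
        forall w : C, w != 0 -> `|w| <= r%:C%C -> ~ D (coord a w) &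
        exists H : unit_itv R * unit_itv R -> punctured,
          [/\ continuous H,
              forall t, H (zero, t) = gamma t,
              forall t, set_val (H (one, t)) = coord a (circle r (itv_val t)) &
              forall s, H (s, zero) = H (s, one)]].

Section Connections.
Variable n : nat.

Definition holomorphic_at (A : C -> 'M[C]_n) (z : C) : Prop :=
  \forall x \near z, derivable A x 1.

Definition log_pole_at (A : C -> 'M[C]_n) (z : C) : Prop :=
  exists2 B : C -> 'M[C]_n, holomorphic_at B z &
    \forall x \near z, x != z -> A x = (x - z)^-1 *: B x.

(* A connection d + Omega on the trivial bundle, where Omega is a matrix of
   1-forms on the sphere, holomorphic except possibly for logarithmic poles on
   D. It is given by its coefficients in the two charts:
   Omega = conn0 z dz = connoo w dw. Their values at points of D are
   irrelevant. *)
Record log_connection := LogConnection {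
  conn0 : C -> 'M[C]_n;
  connoo : C -> 'M[C]_n;
  conn_glue : forall w, w != 0 -> ~ D (chartoo w) ->
    connoo w = - w ^- 2 *: conn0 w^-1;
  conn0_holo : forall z, ~ D (chart0 z) -> holomorphic_at conn0 z;
  connoo_holo : forall w, ~ D (chartoo w) -> holomorphic_at connoo w;
  conn0_log : forall z, D (chart0 z) -> log_pole_at conn0 z;
  connoo_log : forall w, D (chartoo w) -> log_pole_at connoo w
}.

Variable nabla : log_connection.

(* s is a holomorphic section over U with d s + Omega s = 0. *)
Definition horizontal (U : set sphere) (s : sphere -> 'cV[C]_n) : Prop :=
  [/\ U `<=` ~` D,
      forall z : C, U (chart0 z) ->
        is_derive z (1 : C) (s \o chart0) (- (conn0 nabla z *m s (chart0 z))) &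
      forall w : C, U (chartoo w) ->
        is_derive w (1 : C) (s \o chartoo) (- (connoo nabla w *m s (chartoo w)))].

(* v is obtained by analytic continuation along gamma: at each time it is the
   value at gamma t of a local horizontal section. *)
Definition continuation (x y : punctured)
    (gamma : {path (unit_itv R) from x to y in punctured})
    (v : unit_itv R -> 'cV[C]_n) : Prop :=
  forall t, exists U s,
    [/\ open U, U (set_val (gamma t)), horizontal U s &
        \forall t' \near t, v t' = s (set_val (gamma t'))].

(* A horizontal section near b is identified with its value at b. *)
Definition is_monodromy (b : punctured)
    (mu : representation C (pi1 R b) n) : Prop :=
  forall (gamma : loop R b) (v0 : 'cV[C]_n),
    exists v, [/\ continuation gamma v, v zero = v0 &
                  v one = mu (pi1_class gamma) *m v0].

End Connections.
End Sphere.

(* Main.v *)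
Require Import Defs.
From mathcomp Require Import all_boot all_order all_algebra complex.
From mathcomp Require Import all_classical all_reals all_analysis homotopy.
From mathcomp Require Import zify ring lra.
From Stdlib Require Setoid Morphisms.

(** Write A_0, A_1, A_2 for the images under rho of loops around the three
    points, chosen so that A_2 A_1 A_0 = 1, and N_i = A_i - 1.

    The proof has an algebraic half, which shows that such a representation is
    unipotent, and an analytic half, which realises unipotent ones.

    Algebra.  From N_i ^ m_i = 0 one gets rank N_i <= n (1 - 1/m_i), so the
    hypothesis on the exponents says that the three ranks add up to less than
    2n.  With D = diag(N_0, N_1, N_2), J = (1 1 1) and E the column of blocks 1,
    A_0, A_1 A_0, the relation A_2 A_1 A_0 = 1 is precisely J D E = 0.
    Frobenius' rank inequality rank(J D) + rank(D E) <= rank D then forbids both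
    J D and D E to have rank n: the N_i have a common left or right null vector
    ([triple_fixed], an argument of Scott's type).  Splitting it off and
    inducting on n makes the three N_i simultaneously strictly triangular
    ([triple_triangular]).

    Analysis.  A Moebius coordinate moves the punctures to -1, 1 and infinity.
    The plane without -1 and 1 is covered by two simply connected sheets, the
    complements of two slits going down, respectively up; they overlap in a
    middle region and in two sides.  For strictly triangular residues B the
    fundamental solution on each sheet of
      Y' = - (B_false / (u + 1) + B_true / (u - 1)) Y,  Y(0) = 1
    is a finite sum of iterated integrals over words in the two letters.  The two
    solutions agree on the middle region and differ on each side by a constant
    right factor, of the form 1 + (nonzero number) B_T + (terms of higher degree
    in the B).  Hence the factors can be prescribed: the residues are found by an
    iteration that gains one degree of triangularity per step
    ([solve_word_sums], [sheet_solutions]).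

    Pulled back to the sphere, this system has logarithmic poles at the three
    points only ([fuchsian_system]).  Its monodromy is read off from a function
    that is visibly a continuation of a horizontal section along a loop: at the
    point x reached by a path p, take Y(x) rho(p followed by a path back inside
    a sheet that contains x).  The choice of the connecting factors makes this
    independent of the sheet ([transport_indep]), so it is locally horizontal,
    and at the end of a loop gamma it has picked up the factor rho(gamma).

    What remains is to know which factors to prescribe, that is, to express small loops around the three points through the two loops that cross
    from one sheet to the other ([loop_finite], [loop_infinite]). *)

Set Implicit Arguments.
Unset Strict Implicit.
Unset Printing Implicit Defensive.
Import Order.TTheory GRing.Theory Num.Theory numFieldNormedType.Exports.
Local Open Scope ring_scope.

(** * Strict triangularity of the three unipotent matrices *)

Section UnipotentTriples.
Variable F : fieldType.

(** By Sylvester's inequality each further factor N lowers the rank of a power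
    of N by at most n - rank N, and m such steps must reach 0. *)
Lemma nilpotent_rank n m (N : 'M[F]_n) :
  N ^+ m = 0 -> (m * \rank N <= m * n - n)%N.
Proof.
move=> Nm; suff H k : (k * \rank N <= \rank (N ^+ k : 'M[F]_n) + (k * n - n))%N.
  by have := H m; rewrite Nm mxrank0.
elim: k => [|k IHk] //; have Nn := rank_leq_row N.
rewrite exprS; have := mxrank_mul_min N (N ^+ k); rewrite mulmxE.
have := rank_leq_row (N ^+ k : 'M[F]_n).
case: k IHk => [|k] IHk; last by rewrite !mulSn in IHk *; lia.
by rewrite expr0 mulr1; lia.
Qed.

Lemma sum_rank_lt n (m : 'I_3 -> nat) (N : 'I_3 -> 'M[F]_n) :
  (0 < n)%N -> (forall i, (0 < m i)%N) ->
  1 < \sum_(i < 3) (m i)%:R^-1 :> rat ->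
  (forall i, N i ^+ m i = 0) -> (\sum_(i < 3) \rank (N i) < n + n)%N.
Proof.
move=> n0 m0 msum Nm.
have rk i : (\rank (N i))%:R <= n%:R - n%:R * (m i)%:R^-1 :> rat.
  have mi0 : 0 < (m i)%:R :> rat by rewrite ltr0n.
  rewrite -(ler_pM2l mi0) mulrBr mulrCA divff ?gt_eqF // mulr1.
  have := nilpotent_rank (Nm i); rewrite -(ler_nat rat) natrM natrB ?natrM //.
  by rewrite leq_pmull.
rewrite -(ltr_nat rat) natr_sum (le_lt_trans (ler_sum _ (fun i _ => rk i))) //.
rewrite sumrB -mulr_sumr sumr_const card_ord natrD.
have n0' : 0 < n%:R :> rat by rewrite ltr0n.
move: msum; set s := \sum_(_ < _) _ => msum.
have : 0 < n%:R * (s - 1) by rewrite mulr_gt0 ?subr_gt0.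
by rewrite -[n%:R *+ 3]mulr_natr mulrBr mulr1; lra.
Qed.

(** The relation between the A_i reads J D E = 0 for the matrices below, because
    N_0 + N_1 A_0 + N_2 A_1 A_0 telescopes to A_2 A_1 A_0 - 1.  A row killed by
    J D is killed by every N_i, and a column killed by D E is killed by N_0, hence
    fixed by A_0, hence killed by N_1, and so on; Frobenius' inequality leaves no
    room for both J D and D E to have rank n. *)
Lemma triple_fixed n (A0 A1 A2 : 'M[F]_n) :
  A2 *m A1 *m A0 = 1%:M ->
  (\rank (A0 - 1%:M)%R + \rank (A1 - 1%:M)%R + \rank (A2 - 1%:M)%R < n + n)%N ->
  (exists2 v : 'rV[F]_n, v != 0 &
     [/\ v *m (A0 - 1%:M) = 0, v *m (A1 - 1%:M) = 0 & v *m (A2 - 1%:M) = 0]) \/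
  (exists2 w : 'cV[F]_n, w != 0 &
     [/\ (A0 - 1%:M) *m w = 0, (A1 - 1%:M) *m w = 0 & (A2 - 1%:M) *m w = 0]).
Proof.
move=> A1E rk.
set N0 := A0 - 1%:M in rk *; set N1 := A1 - 1%:M in rk *.
set N2 := A2 - 1%:M in rk *.
pose D := block_mx N0 0 0 (block_mx N1 0 0 N2).
pose J : 'M[F]_(n, n + (n + n)) := row_mx 1%:M (row_mx 1%:M 1%:M).
pose E : 'M[F]_(n + (n + n), n) := col_mx 1%:M (col_mx A0 (A1 *m A0)).
have JD : J *m D = row_mx N0 (row_mx N1 N2).
  by rewrite /J /D mul_row_block mul_row_block !mul1mx !mulmx0 !(add0r, addr0).
have DE : D *m E = col_mx N0 (col_mx (N1 *m A0) (N2 *m (A1 *m A0))).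
  by rewrite /D /E mul_block_col mul_block_col !mul0mx !mulmx1 !(add0r, addr0).
have JDE : J *m D *m E = 0.
  rewrite -mulmxA DE !mul_row_col !mul1mx /N0 /N1 /N2 !mulmxBl !mul1mx mulmxA A1E.
  by rewrite [A1 *m A0 - A0 + _]addrC !subrKA subrr.
have rkD : \rank D = (\rank N0 + \rank N1 + \rank N2)%N.
  by rewrite !rank_diag_block_mx addnA.
have /leq_ltn_trans : (\rank (J *m D) + \rank (D *m E) <= \rank D)%N.
  by have := mxrank_Frobenius J D E; rewrite JDE mxrank0 addn0.
move=> /(_ (n + n)%N); rewrite rkD => /(_ rk) lt2n.
have [rkJD|rkJD] := ltnP (\rank (J *m D)) n; [left|right].
- have : kermx (J *m D) != 0.
    by rewrite kermx_eq0 /row_free neq_ltn rkJD.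
  move=> /rowV0Pn[v /sub_kermxP]; rewrite JD !mul_mx_row => vJD v0.
  exists v => //; move: vJD; rewrite -[0]row_mx0 => /eq_row_mx[-> ].
  by rewrite -[0]row_mx0 => /eq_row_mx[-> ->].
- have rkDE : (\rank (D *m E)^T < n)%N by rewrite mxrank_tr; lia.
  have : kermx (D *m E)^T != 0.
    by rewrite kermx_eq0 /row_free neq_ltn rkDE.
  move=> /rowV0Pn[v /sub_kermxP vDE v0].
  exists v^T; first by rewrite -[0]trmx0 (inj_eq trmx_inj).
  move: vDE => /(congr1 trmx); rewrite trmx_mul trmxK trmx0 DE !mul_col_mx.
  rewrite -[0]col_mx0 => /eq_col_mx[N0v].
  rewrite -[0]col_mx0 => /eq_col_mx[].
  have A0v : A0 *m v^T = v^T.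
    by apply/eqP; rewrite -subr_eq0 -[X in _ - X]mul1mx -mulmxBl; apply/eqP.
  rewrite -mulmxA A0v => N1v.
  have A1v : A1 *m v^T = v^T.
    by apply/eqP; rewrite -subr_eq0 -[X in _ - X]mul1mx -mulmxBl; apply/eqP.
  by rewrite -!mulmxA A0v A1v.
Qed.

(** Strict triangularity without ordering the basis: with basis vectors of
    weights d, the matrices satisfying [deg_ge d k] raise the weight by at least
    k.  Degrees add up in products, and a matrix of degree above all weights is
    0. *)
Definition deg_ge n (d : 'I_n -> nat) k (M : 'M[F]_n) :=
  forall i j, (d j < d i + k)%N -> M i j = 0.

Definition conjm n (P M : 'M[F]_n) := P *m M *m invmx P.

Lemma conjmM n (P A B : 'M[F]_n) : P \in unitmx ->
  conjm P (A *m B) = conjm P A *m conjm P B.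
Proof. by move=> Pu; rewrite /conjm !mulmxA mulmxKV. Qed.

Lemma conjmD n (P A B : 'M[F]_n) : conjm P (A + B) = conjm P A + conjm P B.
Proof. by rewrite /conjm mulmxDr mulmxDl. Qed.

Lemma conjm1 n (P : 'M[F]_n) : P \in unitmx -> conjm P 1%:M = 1%:M.
Proof. by move=> Pu; rewrite /conjm mulmx1 mulmxV. Qed.

Lemma conjmX n (P A : 'M[F]_n) k : P \in unitmx ->
  conjm P (A ^+ k) = conjm P A ^+ k.
Proof.
move=> Pu; elim: k => [|k IHk]; first by rewrite !expr0; exact: conjm1.
by rewrite !exprS -!mulmxE conjmM // IHk.
Qed.

Lemma conjm_comp n (P Q M : 'M[F]_n) : P \in unitmx -> Q \in unitmx ->
  conjm P (conjm Q M) = conjm (P *m Q) M.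
Proof.
move=> Pu Qu; have Qi : invmx (P *m Q) = invmx Q *m invmx P.
  have PQ : P *m Q *m (invmx Q *m invmx P) = 1%:M by rewrite mulmxA mulmxK ?mulmxV.
  by rewrite -[LHS]mulmx1 -PQ mulKmx // unitmx_mul Pu.
by rewrite /conjm Qi !mulmxA.
Qed.

(** The first row of Q spans the line of v; the constant comes from the Gaussian
    elimination that provides Q. *)
Lemma row_to_basis n (v : 'rV[F]_(1 + n)) : v != 0 ->
  exists2 Q : 'M[F]_(1 + n), Q \in unitmx &
    exists c : F, row_mx 1%:M 0 *m Q = c *: v.
Proof.
move=> v0; exists (row_ebase v); first exact: row_ebase_unit.
have rv : \rank v = 1%N by rewrite rank_rV v0.
have := mulmx_ebase v; rewrite rv => E.
have cu := col_ebase_unit v.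
exists ((invmx (col_ebase v)) 0 0).
rewrite -mul_scalar_mx -(mx11_scalar (invmx (col_ebase v))) -[X in _ = _ *m X]E
  !mulmxA mulVmx // mul1mx.
congr (_ *m _); apply/matrixP => i j; rewrite !mxE !ord1.
by case: splitP => k; rewrite ?ord1 !mxE => ->.
Qed.

Lemma killed_row n (N : 'M[F]_(1 + n)) (v : 'rV[F]_(1 + n)) : v *m N = 0 ->
  forall Q c, Q \in unitmx -> row_mx 1%:M 0 *m Q = c *: v ->
  ulsubmx (conjm Q N) = 0 /\ ursubmx (conjm Q N) = 0.
Proof.
move=> vN Q c Qu Qv.
have : row_mx 1%:M 0 *m conjm Q N = 0.
  by rewrite /conjm !mulmxA Qv -!scalemxAl vN mul0mx scaler0.
rewrite -[conjm Q N]submxK mul_row_block !mul0mx !mul1mx !addr0.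
by rewrite -[0]row_mx0 => /eq_row_mx[]; rewrite submxK.
Qed.

Lemma killed_col n (N : 'M[F]_(1 + n)) (w : 'cV[F]_(1 + n)) : N *m w = 0 ->
  forall Q c, Q \in unitmx -> row_mx 1%:M 0 *m Q = c *: w^T ->
  ulsubmx (conjm (invmx Q^T) N) = 0 /\ dlsubmx (conjm (invmx Q^T) N) = 0.
Proof.
move=> wN Q c Qu Qv.
have : conjm (invmx Q^T) N *m col_mx 1%:M 0 = 0.
  rewrite /conjm invmxK -!mulmxA.
  have -> : Q^T *m col_mx 1%:M 0 = c *: w.
    by apply: trmx_inj; rewrite trmx_mul trmxK tr_col_mx trmx1 trmx0 Qv linearZ.
  by rewrite -!scalemxAr wN !mulmx0 scaler0.
rewrite -[conjm _ N]submxK mul_block_col !mulmx0 !mulmx1 !addr0.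
by rewrite -[0]col_mx0 => /eq_col_mx[]; rewrite submxK.
Qed.

(** With one of the off-diagonal blocks equal to 0, the zero corner persists in
    all powers and the lower right block is multiplicative. *)
Lemma block_exp n (x : 'M[F]_(1, n)) (y : 'M[F]_(n, 1)) (M : 'M[F]_n) k :
  x = 0 \/ y = 0 -> (block_mx 0 x y M : 'M[F]_(1 + n)) ^+ k.+1 = 0 ->
  M ^+ k.+1 = 0.
Proof.
move=> xy; suff [z [t [-> _]]] : exists z t,
    (block_mx 0 x y M : 'M[F]_(1 + n)) ^+ k.+1 = block_mx 0 z t (M ^+ k.+1) /\
    (x = 0 /\ z = 0 \/ y = 0 /\ t = 0).
  by rewrite -[0 in RHS]block_mx0 => /eq_block_mx[].
elim: k => [|k [z [t [E zt]]]].
  by exists x, y; split=> //; case: xy => ->; [left|right].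
rewrite exprS E -mulmxE mulmx_block !mul0mx !add0r [M ^+ k.+2]exprS.
case: zt => -[-> ->]; rewrite !(mul0mx, mulmx0) !(add0r, addr0).
  by exists 0, (M *m t); split=> //; left.
by exists (x *m M ^+ k.+1), 0; split=> //; right.
Qed.

(** Induction on n: [triple_fixed] makes the first row or the first column of
    all three matrices vanish in a common basis, and the complementary blocks
    satisfy the hypotheses again.  The new basis vector gets a weight larger than
    all others when its row vanishes, and smaller when its column does. *)
Lemma triple_triangular n (m : 'I_3 -> nat) (N : 'I_3 -> 'M[F]_n) :
  (forall i, (0 < m i)%N) -> 1 < \sum_(i < 3) (m i)%:R^-1 :> rat ->
  (forall i, N i ^+ m i = 0) ->
  (1%:M + N 2%R) *m (1%:M + N 1%R) *m (1%:M + N 0%R) = 1%:M ->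
  exists2 P : 'M[F]_n, P \in unitmx &
    exists d, forall i, deg_ge d 1 (conjm P (N i)).
Proof.
move=> m0 msum; elim: n N => [|n IHn] N Nm N1.
  by exists 1%:M; [exact: unitmx1|exists (fun=> 0%N) => i []].
suff [Q Qu [xy N0]] : exists2 Q : 'M[F]_(1 + n), Q \in unitmx &
    ((forall i, ursubmx (conjm Q (N i)) = 0) \/
     (forall i, dlsubmx (conjm Q (N i)) = 0)) /\
    (forall i, ulsubmx (conjm Q (N i)) = 0).
  pose x i := ursubmx (conjm Q (N i)); pose y i := dlsubmx (conjm Q (N i)).
  pose M i := drsubmx (conjm Q (N i)).
  have NE i : conjm Q (N i) = block_mx 0 (x i) (y i) (M i).
    by rewrite -[LHS]submxK N0.
  have [i||P Pu [d dM]] := IHn M.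
  - have := conjmX (N i) (m i) Qu; rewrite Nm /conjm mulmx0 mul0mx -/(conjm _ _).
    rewrite NE; case: (m i) (m0 i) => // k _ /esym; apply: block_exp.
    by rewrite /x /y; case: xy => ->; [left|right].
  - have := congr1 (conjm Q) N1.
    rewrite !conjmM // !conjmD // !conjm1 // !NE.
    rewrite [1%:M](@scalar_mx_block _ 1 n) !add_block_mx !addr0 !add0r.
    rewrite !mulmx_block => /eq_block_mx[_ _ _].
    rewrite /x /y; case: xy => xy; rewrite !xy.
      by rewrite !(mul0mx, mulmx0, addr0, add0r).
    by rewrite !(mul0mx, mulmx0, addr0, add0r).
  pose PQ : 'M[F]_(1 + n) := block_mx 1%:M 0 0 P.
  have PQi : PQ *m block_mx 1%:M 0 0 (invmx P) = 1%:M.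
    rewrite mulmx_block !(mul0mx, mulmx0, mulmx1, mul1mx, addr0, add0r).
    by rewrite mulmxV // -scalar_mx_block.
  have [PQu _] := mulmx1_unit PQi.
  have PQV : invmx PQ = block_mx 1%:M 0 0 (invmx P).
    by rewrite -[LHS]mulmx1 -PQi mulKmx.
  exists (PQ *m Q); first by rewrite unitmx_mul PQu.
  have cE i : conjm (PQ *m Q) (N i) =
      block_mx 0 (x i *m invmx P) (P *m y i) (conjm P (M i)).
    rewrite -conjm_comp // NE /conjm PQV !mulmx_block.
    by rewrite !(mul0mx, mulmx0, mulmx1, mul1mx, addr0, add0r).
  case: xy => xy.
  - exists (fun i : 'I_(1 + n) => match fintype.split i with
                     | inl _ => (\max_j d j)%N.+1 | inr j => d j end) => k.
    rewrite cE {1}/x xy mul0mx => i j.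
    case: (@split_ordP 1 n i) => i' ->; case: (@split_ordP 1 n j) => j' ->;
      rewrite ?(unsplitK (inl _)) ?(unsplitK (inr _)) /=.
    + by move=> _; apply: etrans (block_mxEul _ _ _ _ _ _) _; rewrite mxE.
    + by move=> _; apply: etrans (block_mxEur _ _ _ _ _ _) _; rewrite mxE.
    + by rewrite addn1 ltnS ltnNge (leq_bigmax (F := d) i').
    + by move=> ?; apply: etrans (block_mxEdr _ _ _ _ _ _) _; exact: dM.
  - exists (fun i : 'I_(1 + n) => match fintype.split i with
                     | inl _ => 0%N | inr j => (d j).+1 end) => k.
    rewrite cE {1}/y xy mulmx0 => i j.
    case: (@split_ordP 1 n i) => i' ->; case: (@split_ordP 1 n j) => j' ->;
      rewrite ?(unsplitK (inl _)) ?(unsplitK (inr _)) //=.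
    + by move=> _; apply: etrans (block_mxEul _ _ _ _ _ _) _; rewrite mxE.
    + by move=> _; apply: etrans (block_mxEdl _ _ _ _ _ _) _; rewrite mxE.
    + by move=> ?; apply: etrans (block_mxEdr _ _ _ _ _ _) _; apply: dM; lia.
have := sum_rank_lt (ltn0Sn n) m0 msum Nm.
rewrite !big_ord_recl big_ord0 addn0 addnA => rk.
have NA i : 1%:M + N i - 1%:M = N i by rewrite addrC addKr.
have := @triple_fixed _ _ _ _ N1; rewrite !NA => /(_ _)[].
- by move: rk; congr ((\rank (N _) + \rank (N _) + \rank (N _) < _)%N); apply/val_inj.
- move=> [v v0 [v0N v1N v2N]]; have [Q Qu [c Qv]] := row_to_basis v0.
  have vN i : v *m N i = 0.
    by case: i => -[|[|[|]]] // H; [rewrite -[RHS]v0N|rewrite -[RHS]v1N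
      |rewrite -[RHS]v2N]; congr (_ *m N _); apply/val_inj.
  exists Q => //; split; first left; move=> i;
    by have [] := killed_row (vN i) Qu Qv.
- move=> [w w0 [w0N w1N w2N]].
  have w0' : w^T != 0 by rewrite -[0]trmx0 (inj_eq trmx_inj).
  have [Q Qu [c Qv]] := row_to_basis w0'.
  have wN i : N i *m w = 0.
    by case: i => -[|[|[|]]] // H; [rewrite -[RHS]w0N|rewrite -[RHS]w1N
      |rewrite -[RHS]w2N]; congr (N _ *m _); apply/val_inj.
  exists (invmx Q^T); first by rewrite unitmx_inv unitmx_tr.
  split; first right; move=> i; by have [] := killed_col (wN i) Qu Qv.
Qed.

End UnipotentTriples.

(** * Words in strictly triangular matrices *)

Section WordSums.
Variables (F : fieldType) (n : nat) (d : 'I_n -> nat).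
Implicit Types (M N : 'M[F]_n) (B : bool -> 'M[F]_n) (f g : seq bool -> F).

Lemma deg_ge0 k : deg_ge d k (0 : 'M[F]_n).
Proof. by move=> i j _; rewrite mxE. Qed.

Lemma deg_ge1 : deg_ge d 0 (1%:M : 'M[F]_n).
Proof. by move=> i j; rewrite addn0 mxE; case: eqP => // ->; rewrite ltnn. Qed.

Lemma deg_geD k M N : deg_ge d k M -> deg_ge d k N -> deg_ge d k (M + N).
Proof. by move=> dM dN i j ij; rewrite mxE dM // dN // addr0. Qed.

Lemma deg_geZ k c M : deg_ge d k M -> deg_ge d k (c *: M).
Proof. by move=> dM i j ij; rewrite mxE dM // mulr0. Qed.

Lemma deg_geB k M N : deg_ge d k M -> deg_ge d k N -> deg_ge d k (M - N).
Proof. by move=> dM dN; rewrite -scaleN1r; apply/deg_geD/deg_geZ. Qed.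

Lemma deg_ge_sum k (I : Type) (r : seq I) (P : pred I) (G : I -> 'M[F]_n) :
  (forall i, P i -> deg_ge d k (G i)) -> deg_ge d k (\sum_(i <- r | P i) G i).
Proof. by move=> dG; elim/big_ind: _ => //; [exact: deg_ge0|exact: deg_geD]. Qed.

Lemma deg_geM k l M N :
  deg_ge d k M -> deg_ge d l N -> deg_ge d (k + l) (M *m N).
Proof.
move=> dM dN i j ij; rewrite mxE big1 // => h _.
by have [hi|ih] := ltnP (d h) (d i + k); [rewrite dM // mul0r|
  rewrite dN ?mulr0 //; apply: leq_trans ij _; rewrite addnA leq_add2r].
Qed.

Lemma deg_ge_le k l M : (l <= k)%N -> deg_ge d k M -> deg_ge d l M.
Proof. by move=> lk dM i j ij; apply: dM; lia. Qed.

Lemma deg_ge_eq0 k M : (forall i, d i < k)%N -> deg_ge d k M -> M = 0.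
Proof.
move=> dk dM; apply/matrixP => i j; rewrite mxE; apply: dM.
exact: leq_trans (dk j) (leq_addl _ _).
Qed.

(** The sum of f(w) B_w over the words w of length l, where B_w is the product
    of the letters in order. *)
Fixpoint word_level l f B : 'M[F]_n :=
  if l is l'.+1 then
    \sum_(i : bool) B i *m word_level l' (fun w => f (i :: w)) B
  else f [::] *: 1%:M.

Definition word_sum K f B := \sum_(l < K) word_level l f B.

Lemma word_level_deg l f B :
  (forall i, deg_ge d 1 (B i)) -> deg_ge d l (word_level l f B).
Proof.
move=> dB; elim: l f => [|l IHl] f /=; first exact/deg_geZ/deg_ge1.
by apply: deg_ge_sum => i _; rewrite -add1n; exact: deg_geM.
Qed.

Lemma word_levelB l f g B :
  word_level l (fun w => f w - g w) B = word_level l f B - word_level l g B.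
Proof.
elim: l f g => [|l IHl] f g /=; first by rewrite scalerBl.
by rewrite -sumrB; apply: eq_bigr => i _; rewrite IHl mulmxBr.
Qed.

(** Exchanging one letter at a time: each term of the telescoping sum contains
    one factor B - B' and l other letters. *)
Lemma word_level_diff k l f B B' :
  (forall i, deg_ge d 1 (B i)) -> (forall i, deg_ge d 1 (B' i)) ->
  (forall i, deg_ge d k (B i - B' i)) ->
  deg_ge d (k + l) (word_level l.+1 f B - word_level l.+1 f B').
Proof.
move=> dB dB' dBB; elim: l f => [|l IHl] f.
  rewrite /= -sumrB addn0; apply: deg_ge_sum => i _.
  by rewrite -mulmxBl -[k]addn0; apply: deg_geM => //; exact/deg_geZ/deg_ge1.
have S h X : word_level l.+2 h X =
    \sum_(i : bool) X i *m word_level l.+1 (fun w => h (i :: w)) X by [].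
rewrite !S -sumrB; apply: deg_ge_sum => i _.
set u := word_level l.+1 _ B; set v := word_level l.+1 _ B'.
rewrite (_ : _ - _ = (B i - B' i) *m u + B' i *m (u - v)); last first.
  by rewrite mulmxBl mulmxBr subrKA.
apply: deg_geD; first by apply: deg_geM => //; exact: word_level_deg.
by rewrite addnS -add1n; apply: deg_geM => //; exact: IHl.
Qed.

(** Here f T and g T are the values of the iterated integrals at the point
    [2 * pole T] of the side T, computed on the two sheets.  Their coefficients of length
    one differ only for the letter T, by the period c T. *)
Section Solve.
Variables (K : nat) (f g : bool -> seq bool -> F) (N : bool -> 'M[F]_n).
Variable c : bool -> F.
Hypothesis dK : (forall i, d i < K.+2)%N.
Hypothesis dN : forall T, deg_ge d 1 (N T).
Hypothesis f1 : forall T, f T [::] = 1.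
Hypothesis g1 : forall T, g T [::] = 1.
Hypothesis c0 : forall T, c T != 0.
Hypothesis fg : forall T i, f T [:: i] - g T [:: i] = if i == T then c T else 0.

Let err T B := word_sum K.+2 (f T) B - word_sum K.+2 (g T) B *m (1%:M + N T).
(** Newton's iteration, with the derivative of the error replaced by its leading
    part, the diagonal map with entries c T. *)
Let next B T := B T - (c T)^-1 *: err T B.

(** Modulo higher degree, only the words of length one see a change of B. *)
Let word_sum_diff k h B B' :
  (forall i, deg_ge d 1 (B i)) -> (forall i, deg_ge d 1 (B' i)) ->
  (forall i, deg_ge d k (B i - B' i)) ->
  deg_ge d k.+1 (word_sum K.+2 h B - word_sum K.+2 h B'
                 - \sum_(i : bool) h [:: i] *: (B i - B' i)).
Proof.
move=> dB dB' dBB; rewrite /word_sum -sumrB !big_ord_recl.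
set s := \sum_(i : bool) _.
have E1 : \sum_(i : bool) B i *m (h [:: i] *: 1%:M) -
    \sum_(i : bool) B' i *m (h [:: i] *: 1%:M) = s.
  rewrite -sumrB; apply: eq_bigr => i _.
  by rewrite -!scalemxAr !mulmx1 -scalerBr.
rewrite /= subrr add0r E1.
rewrite addrC addKr; apply: deg_ge_sum => i _.
apply: (@deg_ge_le (k + i.+1)); first by rewrite addnS ltnS leq_addr.
exact: (@word_level_diff _ i.+1).
Qed.

Let err_diff k T B B' :
  (forall i, deg_ge d 1 (B i)) -> (forall i, deg_ge d 1 (B' i)) ->
  (forall i, deg_ge d k (B i - B' i)) ->
  deg_ge d k.+1 (next B T - next B' T).
Proof.
move=> dB dB' dBB.
have H h := word_sum_diff h dB dB' dBB.
pose h w := f T w - g T w.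
have hE X : word_sum K.+2 h X = word_sum K.+2 (f T) X - word_sum K.+2 (g T) X.
  by rewrite /word_sum -sumrB; apply: eq_bigr => l _; rewrite word_levelB.
have eE X : err T X = word_sum K.+2 h X - word_sum K.+2 (g T) X *m N T.
  by rewrite hE /err mulmxDr mulmx1 opprD addrA.
have hs : \sum_(i : bool) h [:: i] *: (B i - B' i) = c T *: (B T - B' T).
  rewrite (bigD1 T) //= /h fg eqxx big1 ?addr0 // => i /negPf iT.
  by rewrite fg iT scale0r.
rewrite (_ : _ - _ = (c T)^-1 *: ((word_sum K.+2 (g T) B - word_sum K.+2 (g T) B') *m N T
   - (word_sum K.+2 h B - word_sum K.+2 h B' - c T *: (B T - B' T)))); last first.
  rewrite /next !eE mulmxBl !scalerBr !scalerA mulVf // !scale1r.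
  by apply/matrixP => i j; rewrite !mxE; ring.
apply: deg_geZ; apply: deg_geB; last by rewrite -hs; exact: H.
rewrite -addn1; apply: deg_geM => //.
set s := \sum_(i : bool) g T [:: i] *: (B i - B' i).
rewrite -[X in deg_ge _ _ X](subrK s); apply: deg_geD.
  by apply: deg_ge_le (H _); rewrite leqnSn.
by apply: deg_ge_sum => i _; exact: deg_geZ.
Qed.

(** The iteration contracts the degree filtration: consecutive iterates agree
    up to degree k after k steps, so the sequence is constant once k exceeds all
    weights, and its limit has zero error. *)
Lemma solve_word_sums : exists2 B : bool -> 'M[F]_n,
  (forall i, deg_ge d 1 (B i)) &
  (forall T, word_sum K.+2 (f T) B = word_sum K.+2 (g T) B *m (1%:M + N T)).
Proof.
pose it k := iter k next (fun=> 0).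
have lev0 h : word_sum K.+2 h (fun=> 0) = h [::] *: 1%:M.
  rewrite /word_sum big_ord_recl /= big1 ?addr0 // => l _.
  by rewrite /= big1 // => i _; rewrite mul0mx.
have dn1 i : deg_ge d 1 (next (fun=> 0) i).
  rewrite /next sub0r -scaleN1r /err !lev0 f1 g1 !scale1r mul1mx.
  by do 2 apply: deg_geZ; rewrite addrC opprD addrAC addNr add0r -scaleN1r; exact: deg_geZ.
have dit k : forall i, deg_ge d 1 (it k i).
  elim: k => [|k IHk] i; first exact: deg_ge0.
  rewrite /it iterS -/(it k) -[X in deg_ge _ _ X](subrK (next (fun=> 0) i)).
  apply: deg_geD => //; apply: (@deg_ge_le 2) => //; apply: err_diff => // j.
    exact: deg_ge0.
  by rewrite subr0.
have ditS k : forall i, deg_ge d k.+1 (it k.+1 i - it k i).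
  elim: k => [|k IHk] i; first by rewrite /it /= subr0; exact: dn1.
  have itS j : it j.+1 = next (it j) by [].
  by rewrite [in X in _ - X]itS itS; apply: err_diff => //; exact: dit.
exists (it K.+2) => // T.
have := deg_ge_eq0 (fun i => leqW (dK i)) (ditS K.+2 T).
rewrite /it iterS -/(it _) /next addrC addKr => /eqP.
rewrite oppr_eq0 scaler_eq0 invr_eq0 (negPf (c0 T)) /= => /eqP /subr0_eq.
by [].
Qed.

End Solve.
End WordSums.

Local Open Scope classical_set_scope.
Local Notation Re := complex.Re.
Local Notation Im := complex.Im.

(** * Derivatives of complex functions and of curves *)

Section Modulus.
Variable R : realType.
Local Notation C := R[i].
Implicit Types z w : C.

(** The norm of R[i] takes its values in R[i]; estimates are more convenient in
    the ordered field R. *)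
Definition cabs z : R := Re `|z|.

Lemma cabsE z : `|z| = (cabs z)%:C%C.
Proof. by rewrite /cabs normc_def. Qed.

Lemma cabs_ge0 z : 0 <= cabs z.
Proof. by rewrite /cabs normc_def /= sqrtr_ge0. Qed.

Lemma cabs0 : cabs 0 = 0. Proof. by rewrite /cabs normr0. Qed.

Lemma cabs1 : cabs 1 = 1. Proof. by rewrite /cabs normr1. Qed.

Lemma cabs_eq0 z : (cabs z == 0) = (z == 0).
Proof. by rewrite -[RHS]normr_eq0 cabsE -(inj_eq (@complexI R)). Qed.

Lemma cabs_gt0 z : (0 < cabs z) = (z != 0).
Proof. by rewrite lt_neqAle cabs_ge0 andbT eq_sym cabs_eq0. Qed.

Lemma cabsM z w : cabs (z * w) = cabs z * cabs w.
Proof. by apply: (@complexI R); rewrite rmorphM -!cabsE normrM. Qed.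

Lemma cabsV z : cabs z^-1 = (cabs z)^-1.
Proof. by apply: (@complexI R); rewrite fmorphV -!cabsE normfV. Qed.

Lemma cabsN z : cabs (- z) = cabs z. Proof. by rewrite /cabs normrN. Qed.

Lemma cabsB z w : cabs (z - w) = cabs (w - z).
Proof. by rewrite -cabsN opprB. Qed.

Lemma cabsD z w : cabs (z + w) <= cabs z + cabs w.
Proof. by rewrite -lecR rmorphD -!cabsE ler_normD. Qed.

Lemma cabs_real (x : R) : cabs x%:C%C = `|x|.
Proof. by rewrite /cabs normc_def /= expr0n addr0 sqrtr_sqr. Qed.

Lemma Re_le_cabs z : `|Re z| <= cabs z.
Proof.
rewrite /cabs normc_def /= -sqrtr_sqr ler_wsqrtr //.
by rewrite lerDl sqr_ge0.
Qed.

Lemma Im_le_cabs z : `|Im z| <= cabs z.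
Proof.
rewrite /cabs normc_def /= -sqrtr_sqr ler_wsqrtr //.
by rewrite lerDr sqr_ge0.
Qed.

Lemma cabs_le_ReIm z : cabs z <= `|Re z| + `|Im z|.
Proof.
rewrite /cabs normc_def /= -[leRHS]ger0_norm ?addr_ge0 // -[leRHS]sqrtr_sqr.
rewrite ler_wsqrtr // sqrrD !real_normK ?num_real //.
by rewrite addrAC lerDl mulrn_wge0 // mulr_ge0.
Qed.

Lemma nbhs_cabs z (A : set C) :
  nbhs z A <-> exists2 e : R, 0 < e & forall w, cabs (w - z) < e -> A w.
Proof.
split=> [/nbhs_ballP[e /= e0 eA]|[e e0 eA]].
  exists (Re e) => [|w we]; first by move: e0; rewrite ltcE /= => /andP[].
  apply: eA; rewrite -ball_normE /= distrC cabsE.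
  by move: e0 we; rewrite !ltcE /= => /andP[/eqP -> _] ->; rewrite eqxx.
apply/nbhs_ballP; exists e%:C%C; first by rewrite /= ltcR.
by move=> w; rewrite -ball_normE /= distrC cabsE ltcR => /eA.
Qed.

Lemma cvg_cabsP T (F : set_system T) (FF : Filter F) (f : T -> C) z :
  f @ F --> z <-> forall e : R, 0 < e -> \forall x \near F, cabs (f x - z) < e.
Proof.
split=> [fz e e0|fz A /nbhs_cabs[e e0 eA]].
  by apply: (fz [set w | cabs (w - z) < e]); apply/nbhs_cabs; exists e.
by apply: filterS (fz e e0) => x /eA.
Qed.

Lemma Re_continuous : continuous (@Re R : C -> R).
Proof.
move=> z; apply/(@cvgrPdist_lt _ _ _ (nbhs z)) => e e0; near=> w.
rewrite distrC -raddfB; apply: le_lt_trans (Re_le_cabs _) _.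
by near: w; apply/nbhs_cabs; exists e.
Unshelve. all: by end_near. Qed.

Lemma Im_continuous : continuous (@Im R : C -> R).
Proof.
move=> z; apply/(@cvgrPdist_lt _ _ _ (nbhs z)) => e e0; near=> w.
rewrite distrC -raddfB; apply: le_lt_trans (Im_le_cabs _) _.
by near: w; apply/nbhs_cabs; exists e.
Unshelve. all: by end_near. Qed.

Lemma cvg_complex T (F : set_system T) (FF : Filter F) (f g : T -> R) (x y : R) :
  f @ F --> x -> g @ F --> y -> (fun t => (f t +i* g t)%C) @ F --> (x +i* y)%C.
Proof.
move=> fx gy; apply/cvg_cabsP => e e0.
have e2 : 0 < e / 2 by rewrite divr_gt0.
near=> t; apply: le_lt_trans (cabs_le_ReIm _) _ => /=.
rewrite [e]splitr; apply: ltrD; rewrite distrC; near: t.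
  by move/cvgrPdist_lt: fx; apply.
by move/cvgrPdist_lt: gy; apply.
Unshelve. all: by end_near. Qed.

Lemma cvg_ReIm T (F : set_system T) (FF : Filter F) (f : T -> C) z :
  f @ F --> z <-> (fun t => Re (f t)) @ F --> Re z /\ (fun t => Im (f t)) @ F --> Im z.
Proof.
split=> [fz|[rz iz]].
  by split; [exact: (cvg_comp _ _ fz (@Re_continuous z))|
             exact: (cvg_comp _ _ fz (@Im_continuous z))].
have := cvg_complex FF rz iz; case: z {rz iz} => x y /=; apply: cvg_trans.
by apply: near_eq_cvg; apply: nearW => t; case: (f t).
Qed.

Lemma real_complex_continuous : continuous (fun x : R => x%:C%C).
Proof. by move=> x; apply: cvg_complex; [exact: cvg_id|exact: cvg_cst]. Qed.

End Modulus.

Section Caratheodory.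

(** Caratheodory's form of differentiability turns the product and chain rules
    into identities between continuous functions, valid over any normed
    field. *)
Lemma caratheodory (K : numFieldType) (V : normedModType K) (f : K -> V) (z : K) (d : V) :
  is_derive z (1 : K) f d <->
  exists phi : K -> V, [/\ {for z, continuous phi}, phi z = d &
    forall w, f w - f z = (w - z) *: phi w].
Proof.
split=> [[/cvg_ex[l fl] fd]|[phi [cphi <- fE]]].
  have ld : l = d by rewrite -fd /derive; apply/esym/cvg_lim.
  exists (fun w => if w == z then d else (w - z)^-1 *: (f w - f z)).
  split.
  - rewrite /prop_for /continuous_at /= eqxx -ld => A /nbhs_ballP[e /= e0 eA].
    move/cvg_ballP : fl => /(_ e e0) [r /= r0 rf].
    apply/nbhs_ballP; exists r => //= w; rewrite -ball_normE /= => wz; apply: eA.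
    case: eqP => [_|/eqP wz0]; first exact: ballxx.
    have := rf (w - z); rewrite /ball_ /= sub0r normrN distrC => /(_ wz).
    by rewrite subr_eq0 [_%:A]mulr1 subrK => /(_ wz0).
  - by rewrite eqxx.
  - move=> w; case: eqP => [->|/eqP wz]; first by rewrite !subrr scale0r.
    by rewrite scalerA mulfV ?scale1r // subr_eq0.
have fl : (fun h => h^-1 *: ((f \o shift z) (h *: (1 : K)) - f z)) @ 0^' --> phi z.
  apply: (@cvg_trans _ ((fun h => phi (h + z)) @ 0^')).
    apply: near_eq_cvg; near=> h; rewrite /= [_%:A]mulr1 fE addrK scalerA mulVf ?scale1r //.
    near: h; exact: nbhs_dnbhs_neq.
  apply: (@cvg_trans _ ((fun h => phi (h + z)) @ 0)).
    by move=> A /=; exact: nbhs_dnbhs.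
  have H : (h + z) @[h --> (0 : K)] --> 0 + z.
    apply: (@cvgD K K^o K (nbhs (0 : K)) (nbhs_filter (0 : K)) id (cst z)).
      exact: cvg_id.
    exact: cvg_cst.
  by rewrite add0r in H; exact: (cvg_comp _ _ H cphi).
by apply: DeriveDef; [apply/cvg_ex; exists (phi z)|apply/cvg_lim].
Unshelve. all: by end_near. Qed.

End Caratheodory.

Lemma derive_continuous (K : numFieldType) (V : normedModType K) (g : K -> V) z d :
  is_derive z (1 : K) g d -> {for z, continuous g}.
Proof.
move=> /caratheodory[phi [cphi _ gE]].
have -> : g = (fun w => g z + (w - z) *: phi w).
  by apply/funext => w; rewrite -gE subrKC.
rewrite /prop_for /continuous_at.
apply: (@cvgD K V K (nbhs z) (nbhs_filter z) (cst (g z))); first exact: cvg_cst.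
apply: cvgZ; last exact: cphi.
by apply: cvgB; [exact: cvg_id|exact: cvg_cst].
Qed.

Section DerivativeRules.
Variables (K : numFieldType) (V : normedModType K).
Implicit Types (f : K -> K) (g : K -> V) (z : K).

Lemma is_derive_scale f g z df dg :
  is_derive z (1 : K) f df -> is_derive z (1 : K) g dg ->
  is_derive z (1 : K) (fun w => f w *: g w) (df *: g z + f z *: dg).
Proof.
move=> /caratheodory[phi [cphi <- fE]] hg; have cg := derive_continuous hg.
move/caratheodory: hg => [psi [cpsi <- gE]].
apply/caratheodory; exists (fun w => phi w *: g w + f z *: psi w); split => //.
  rewrite /prop_for /continuous_at.
  apply: (@cvgD K V K (nbhs z) (nbhs_filter z)); first exact: cvgZ.
  by apply: cvgZ; [exact: cvg_cst|exact: cpsi].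
move=> w; rewrite scalerDr !scalerA -[(w - z) * phi w]/((w - z) *: phi w) -fE.
by rewrite mulrC -scalerA -gE scalerBl scalerBr subrKA.
Qed.

Lemma is_derive_chain f g z df dg :
  is_derive z (1 : K) f df -> is_derive (f z) (1 : K) g dg ->
  is_derive z (1 : K) (fun w => g (f w)) (df *: dg).
Proof.
move=> hf /caratheodory[psi [cpsi <- gE]]; have cf := derive_continuous hf.
move/caratheodory: hf => [phi [cphi <- fE]].
apply/caratheodory; exists (fun w => phi w *: psi (f w)); split => //.
  exact: (cvgZ cphi (cvg_comp _ _ cf cpsi)).
by move=> w; rewrite gE fE scalerA.
Qed.

Lemma is_derive_inv f z df : f z != 0 -> is_derive z (1 : K) f df ->
  is_derive z (1 : K) (fun w => (f w)^-1) (- df / f z ^+ 2).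
Proof.
move=> fz [hf fd]; apply: DeriveDef; first exact: derivableV.
by rewrite deriveV // fd -[LHS]/(_ * _) mulNr mulrC mulNr.
Qed.

Lemma is_derive_bigsum (I : Type) (r : seq I) (G : I -> K -> V) (dG : I -> V) z :
  (forall i, is_derive z (1 : K) (G i) (dG i)) ->
  is_derive z (1 : K) (fun w => \sum_(i <- r) G i w) (\sum_(i <- r) dG i).
Proof.
move=> hG; elim: r => [|i r IHr].
  under [X in is_derive _ _ X]eq_fun do rewrite big_nil.
  rewrite big_nil; exact: is_derive_cst.
under [X in is_derive _ _ X]eq_fun do rewrite big_cons.
rewrite big_cons; exact: is_deriveD.
Qed.

End DerivativeRules.

Lemma is_derive_mx (K : numFieldType) p q (M : K -> 'M[K]_(p, q)) (z : K) (dM : 'M[K]_(p, q)) :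
  (forall i j, is_derive z (1 : K) (fun w => M w i j) (dM i j)) ->
  is_derive z (1 : K) M dM.
Proof.
move=> hM; rewrite [dM]matrix_sum_delta.
rewrite (_ : M = fun w => \sum_i \sum_j M w i j *: delta_mx i j); last first.
  by apply/funext => w; rewrite [LHS]matrix_sum_delta.
apply: is_derive_bigsum => i; apply: is_derive_bigsum => j.
have := is_derive_scale (hM i j) (is_derive_cst (delta_mx i j) z (1 : K)).
by rewrite scaler0 addr0.
Qed.

Lemma is_derive_mx_entry (K : numFieldType) p q (M : K -> 'M[K]_(p, q)) (z : K) (dM :
  'M[K]_(p, q)) i j :
  is_derive z (1 : K) M dM ->
  is_derive z (1 : K) (fun w => M w i j) (dM i j).
Proof.
move=> /caratheodory[phi [cphi <- ME]]; apply/caratheodory.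
exists (fun w => phi w i j); split => //.
  have : continuous (fun A : 'M[K]_(p, q) => A i j) by exact: coord_continuous.
  by move=> /(_ (phi z)); apply: cvg_comp.
by move=> w; have := congr1 (fun A : 'M[K]_(p, q) => A i j) (ME w); rewrite !mxE.
Qed.

Section RealCurves.
Variable R : realType.
Local Notation C := R[i].
Implicit Types (g h : R -> C) (t : R) (d df dg dh : C).

(** R[i] carries no structure of normed space over R, so a curve t |-> g t is
    differentiated coordinatewise. *)
Definition curve_derive g t (d : C) :=
  is_derive t (1 : R) (fun s => Re (g s)) (Re d) /\
  is_derive t (1 : R) (fun s => Im (g s)) (Im d).

Lemma curve_caratheodory g t d :
  curve_derive g t d <->
  exists phi : R -> C, [/\ {for t, continuous phi}, phi t = d &
    forall s, g s - g t = (s - t)%:C%C * phi s].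
Proof.
split=> [[/caratheodory[u [cu ut uE]] /caratheodory[v [cv vt vE]]]|].
  exists (fun s => (u s +i* v s)%C); split.
  - by rewrite /prop_for /continuous_at /=; apply: cvg_complex.
  - by rewrite ut vt; case: (d).
  - move=> s; have := uE s; have := vE s; rewrite -!raddfB.
    case: (g s - g t) => x y /= -> ->.
    by rewrite -[_ *: u s]/(_ * _) -[_ *: v s]/(_ * _); apply/eqP; rewrite eq_complex /=;
       rewrite !mul0r subr0 addr0 !eqxx.
move=> [phi [cphi <- gE]].
have [cr ci] := (cvg_ReIm (nbhs_filter t) _ _).1 cphi.
split; apply/caratheodory; [exists (fun s => Re (phi s))|exists (fun s => Im (phi s))];
  split => // s; rewrite -raddfB gE; case: (phi s) => x y /=.
  by rewrite mul0r subr0.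
by rewrite mul0r addr0.
Qed.

Lemma curve_continuous g t d : curve_derive g t d -> {for t, continuous g}.
Proof.
move=> [/derive_continuous cr /derive_continuous ci].
exact/(cvg_ReIm (nbhs_filter t)).
Qed.

Lemma curve_derive_chain (f : C -> C) g t df d :
  is_derive (g t) (1 : C) f df -> curve_derive g t d ->
  curve_derive (fun s => f (g s)) t (df * d).
Proof.
move=> /caratheodory[psi [cpsi <- fE]] hg; have cg := curve_continuous hg.
move/curve_caratheodory: hg => [phi [cphi <- gE]].
apply: (curve_caratheodory _ _ _).2.
exists (fun s : R => psi (g s) * phi s : C).
split.
- exact: (@cvgM _ _ (nbhs t) (nbhs_filter t) (fun s => psi (g s)) phi _ _ (cvg_comp _
  _ cg cpsi) cphi).
- by [].
- by move=> s; rewrite fE gE -[_ *: _]/(_ * _) mulrAC mulrA.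
Qed.

Lemma curve_deriveM g h t dg dh :
  curve_derive g t dg -> curve_derive h t dh ->
  curve_derive (fun s => g s * h s) t (dg * h t + g t * dh).
Proof.
move=> /curve_caratheodory[phi [cphi <- gE]] hh; have ch := curve_continuous hh.
move/curve_caratheodory: hh => [psi [cpsi <- hE]].
apply: (curve_caratheodory _ _ _).2.
exists (fun s : R => phi s * h s + g t * psi s : C).
split.
- apply: (@cvgD _ C _ (nbhs t) (nbhs_filter t) (fun s => phi s * h s) (fun s => g t * psi s)).
    exact: (@cvgM _ _ (nbhs t) (nbhs_filter t) phi h _ _ cphi ch).
  exact: (@cvgM _ _ (nbhs t) (nbhs_filter t) (fun=> g t) psi _ _ (cvg_cst _) cpsi).
- by [].
- by move=> s; rewrite mulrDr mulrA -gE mulrCA -hE; ring.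
Qed.

Lemma curve_deriveB g h t dg dh :
  curve_derive g t dg -> curve_derive h t dh ->
  curve_derive (fun s => g s - h s) t (dg - dh).
Proof.
move=> [g1 g2] [h1 h2]; split.
  by rewrite raddfB; under [X in is_derive _ _ X]eq_fun do rewrite raddfB;
     exact: is_deriveB.
by rewrite raddfB; under [X in is_derive _ _ X]eq_fun do rewrite raddfB;
   exact: is_deriveB.
Qed.

Lemma curve_derive_cst c t : curve_derive (fun=> c) t 0.
Proof. by split; exact: is_derive_cst. Qed.

Lemma curve_derive_real t : curve_derive (fun s => s%:C%C) t 1.
Proof. by split; [exact: is_derive_id|exact: is_derive_cst]. Qed.

End RealCurves.

(** * Primitives on star-shaped domains *)

Section Primitives.
Variable R : realType.
Local Notation C := R[i].
Implicit Types (S : set C) (p z : C) (t s : R).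

Lemma real_mean_value (f df : R -> R) :
  (forall t, 0 <= t <= 1 -> is_derive t (1 : R) f (df t)) ->
  exists2 t, 0 <= t <= 1 & f 1 - f 0 = df t.
Proof.
move=> hf; have [||t] := @MVT R f df 0 1 ltr01.
- move=> x; rewrite in_itv /= => /andP[x0 x1].
  by apply: hf; rewrite !ltW.
- apply: continuous_in_subspaceT => x; rewrite inE /= in_itv /= => x01.
  exact: derive_continuous (hf x x01).
rewrite in_itv /= => /andP[t0 t1] ->; exists t; first by rewrite !ltW.
by rewrite subr0 mulr1.
Qed.

(** The mean value inequality; applying the real theorem to the two coordinates
    separately costs the factor 2, which is harmless below. *)
Lemma curve_bound (g dg : R -> C) (M : R) :
  (forall t, 0 <= t <= 1 -> curve_derive g t (dg t)) ->
  (forall t, 0 <= t <= 1 -> cabs (dg t) <= M) ->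
  cabs (g 1 - g 0) <= 2 * M.
Proof.
move=> hg hM; apply: le_trans (cabs_le_ReIm _) _; rewrite !raddfB.
have [t t01 ->] := @real_mean_value (fun s => Re (g s)) (fun s => Re (dg s))
  (fun t t01 => (hg t t01).1).
have [s s01 ->] := @real_mean_value (fun s => Im (g s)) (fun s => Im (dg s))
  (fun t t01 => (hg t t01).2).
have := le_trans (Re_le_cabs _) (hM t t01).
have := le_trans (Im_le_cabs _) (hM s s01).
lra.
Qed.

(** The integral starts at -1, so that the interval [0, 1] is in the interior of
    the domain and the derivatives at its ends are two-sided. *)
Lemma real_primitive (f : R -> R) : continuous f ->
  exists F : R -> R, forall t, 0 <= t <= 1 -> is_derive t (1 : R) F (f t).
Proof.
move=> cf; pose F (x : R) := (\int[lebesgue_measure]_(t in `[-1, x]) f t)%R.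
exists F => t /andP[t0 t1].
have t2 : t < 2 by lra.
have tm1 : -1 < t by lra.
have [||/= dF FE] := @continuous_FTC1 R f (BLeft (-1)) t 2 t2 _ _ (cf t).
- apply: continuous_compact_integrable; first exact: segment_compact.
  exact: continuous_subspaceT.
- by rewrite /= lte_fin.
by apply: DeriveDef; [exact: dF|rewrite -derive1E FE].
Qed.

Lemma curve_primitive (f : R -> C) : continuous f ->
  exists2 F : R -> C, F 0 = 0 &
    forall t, 0 <= t <= 1 -> curve_derive F t (f t).
Proof.
move=> cf.
have [F1 h1] := real_primitive (fun t => ((cvg_ReIm (nbhs_filter t) _ _).1 (cf t)).1).
have [F2 h2] := real_primitive (fun t => ((cvg_ReIm (nbhs_filter t) _ _).1 (cf t)).2).
exists (fun t => ((F1 t - F1 0) +i* (F2 t - F2 0))%C); first by rewrite !subrr.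
move=> t t01; split => /=.
  by rewrite -[Re _]subr0; apply: is_deriveB (h1 t t01) (is_derive_cst _ _ _).
by rewrite -[Im _]subr0; apply: is_deriveB (h2 t t01) (is_derive_cst _ _ _).
Qed.

Definition star p S := forall z (t : R), S z -> 0 <= t <= 1 ->
  S (p + t%:C%C * (z - p)).

Lemma curve_segment p v t : curve_derive (fun s => p + s%:C%C * v) t v.
Proof.
have := curve_deriveB (curve_deriveM (curve_derive_real t) (curve_derive_cst v t))
  (curve_derive_cst (- p) t).
rewrite mul1r mulr0 addr0 subr0; congr curve_derive.
by apply/funext => s; rewrite opprK addrC.
Qed.

Lemma star_constant p S (F : C -> C) : star p S ->
  (forall z, S z -> is_derive z (1 : C) F 0) -> forall z, S z -> F z = F p.
Proof.
move=> sS hF z Sz; apply/eqP; rewrite -subr_eq0 -cabs_eq0 eq_le cabs_ge0 andbT.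
have := @curve_bound (fun t => F (p + t%:C%C * (z - p))) (fun=> 0) 0.
rewrite rmorph1 rmorph0 mul1r mul0r addr0 subrKC mulr0; apply.
  move=> t t01; rewrite -[0](mul0r (z - p)); apply: curve_derive_chain.
    exact/hF/sS.
  exact: curve_segment.
by move=> t _; rewrite cabs0.
Qed.

(** Differentiability as an estimate of the error by e |h|, which is what the mean
    value inequality delivers. *)
Lemma is_derive_eps (F : C -> C) z d :
  (forall e : R, 0 < e -> exists2 r : R, 0 < r &
     forall h, cabs h < r -> cabs (F (z + h) - F z - h * d) <= e * cabs h) ->
  is_derive z (1 : C) F d.
Proof.
move=> hF; apply/caratheodory.
exists (fun w => if w == z then d else (F w - F z) / (w - z)); split.
- rewrite /prop_for /continuous_at eqxx; apply/(cvg_cabsP (nbhs_filter z)) => e e0.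
  have e2 : 0 < e / 2 by rewrite divr_gt0.
  have [r r0 hr] := hF _ e2; apply/nbhs_cabs; exists r => // w wz.
  case: eqP => [_|/eqP wz0]; first by rewrite subrr cabs0.
  have := hr _ wz; rewrite subrKC => hw.
  have wz1 : w - z != 0 by rewrite subr_eq0.
  have wz2 : 0 < cabs (w - z) by rewrite cabs_gt0.
  rewrite -(ltr_pM2r wz2) -cabsM mulrBl divfK // [d * _]mulrC.
  by apply: le_lt_trans hw _; rewrite ltr_pM2r //; lra.
- by rewrite eqxx.
- move=> w; case: eqP => [->|/eqP wz]; first by rewrite !subrr scale0r.
  by rewrite -[RHS]/(_ * _) mulrC divfK // subr_eq0.
Qed.

(** The primitive is F z = (z - p) Phi z 1, where Phi z t integrates f along the
    initial part of the ray from p to z.  To compare F (z + h) with F z + h f z,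
    consider the same difference E t for the points at time t on the rays: its
    derivative in t is the increment of w |-> (w - p) f(q(t, w)) from z to z + h
    minus h times its derivative G at z, because f is holomorphic.  A second
    application of the mean value inequality, along the segment from z to z + h,
    bounds it by e |h|, once G is uniformly close to its values on the ray; the
    tube lemma provides that. *)
Lemma star_primitive p S (f df : C -> C) : open S -> star p S ->
  (forall z, S z -> is_derive z (1 : C) f (df z)) ->
  (forall z, S z -> {for z, continuous df}) ->
  exists F : C -> C, forall z, S z -> is_derive z (1 : C) F (f z).
Proof.
move=> oS sS hf cdf.
pose q (x : R * C) : C := p + x.1%:C%C * (x.2 - p).
have cq x : q y @[y --> x] --> q x.
  apply: cvgD; first exact: cvg_cst.
  apply: cvgM; last by apply: cvgB; [exact: cvg_snd|exact: cvg_cst].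
  apply: (cvg_comp _ _ cvg_fst); exact: real_complex_continuous.
pose G (x : R * C) : C := f (q x) + x.1%:C%C * (x.2 - p) * df (q x).
have cf z : S z -> {for z, continuous f} by move=> /hf; exact: derive_continuous.
have cG x : S (q x) -> G y @[y --> x] --> G x.
  move=> Sx; apply: cvgD; first exact: (cvg_comp _ _ (cq x) (cf _ Sx)).
  apply: cvgM; last exact: (cvg_comp _ _ (cq x) (cdf _ Sx)).
  apply: cvgM; last by apply: cvgB; [exact: cvg_snd|exact: cvg_cst].
  apply: (cvg_comp _ _ cvg_fst); exact: real_complex_continuous.
(* The parameter is clamped to [0, 1], since f need not be continuous along the
   whole line. *)
have /choice[Phi hPhi] z : exists Phi : R -> C, S z ->
    Phi 0 = 0 /\ forall t, 0 <= t <= 1 -> curve_derive Phi t (f (q (t, z))).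
  have [Sz|nSz] := pselect (S z); last by exists (fun=> 0).
  pose cl (t : R) := Num.max 0 (Num.min 1 t).
  have cl01 t : 0 <= cl t <= 1 by rewrite le_max lexx ge_max ler01 ge_min lexx.
  have clE t : 0 <= t <= 1 -> cl t = t.
    by case/andP=> t0 t1; rewrite /cl min_r // max_r.
  have [|Phi P0 dPhi] := @curve_primitive (fun t => f (q (cl t, z))).
    move=> t; have Sq : S (q (cl t, z)) := sS _ _ Sz (cl01 t).
    have ccl : continuous cl.
      apply: max_fun_continuous; first by move=> ?; exact: cvg_cst.
      apply: min_fun_continuous; first by move=> ?; exact: cvg_cst.
      exact: id_continuous.
    have c : (cl s, z) @[s --> t] --> (cl t, z).
      exact: (@pair_continuous _ _ _ cl (fun=> z) ccl (fun=> cvg_cst _) t).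
    exact: (cvg_comp _ _ (cvg_comp _ _ c (cq (cl t, z))) (cf _ Sq)).
  exists Phi => _; split=> // t t01.
  by rewrite -{2}(clE t t01); exact: dPhi.
exists (fun z => (z - p) * Phi z 1) => z Sz.
apply: is_derive_eps => e e0.
have [r r0 hr] : exists2 r : R, 0 < r & forall w, cabs (w - z) < r ->
    forall t, 0 <= t <= 1 -> S (q (t, w)) /\ cabs (G (t, w) - G (t, z)) < e / 4.
  have cov : \forall w \near z, `[0, 1]%classic `<=` (fun t : R =>
      S (q (t, w)) /\ cabs (G (t, w) - G (t, z)) < e / 4).
    apply: ((compact_near_coveringP _).1 (@segment_compact R 0 1) C (nbhs z)
      (fun w t => S (q (t, w)) /\ cabs (G (t, w) - G (t, z)) < e / 4)
      (nbhs_filter z)) => t.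
    rewrite /= in_itv /= => t01.
    have Sq : S (q (t, z)) by exact: sS.
    have e4 : 0 < e / 8 by rewrite divr_gt0.
    have H1 : \forall x \near ((t, z) : R * C), S (q x).
      exact: (cq (t, z) _ (open_nbhs_nbhs (conj oS Sq))).
    have H2 : \forall x \near ((t, z) : R * C), cabs (G x - G (t, z)) < e / 8.
      by move/(cvg_cabsP (nbhs_filter _)): (cG _ Sq) => /(_ _ e4).
    have H3 : \forall x \near ((t, z) : R * C), cabs (G (x.1, z) - G (t, z)) < e / 8.
      have c1 : (x.1, z) @[x --> ((t, z) : R * C)] --> ((t, z) : R * C).
        exact: (@pair_continuous _ _ _ fst (fun=> z) (@fst_continuous R C) (fun=> cvg_cst _)).
      exact: c1 _ H2.
    apply: filterS3 H1 H2 H3 => -[s w] /= h1 h2 h3; split=> //.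
    rewrite -(subrKA (G (t, z))); apply: le_lt_trans (cabsD _ _) _.
    by rewrite [X in _ + X]cabsB; lra.
  move/nbhs_cabs: cov => [r r0 hr]; by exists r.
exists r => // h hr'.
have S1 w : cabs (w - z) < r -> S w.
  move=> wz; have [] := hr w wz 1; first by rewrite ler01 lexx.
  by rewrite /q /= rmorph1 mul1r subrKC.
have zh : cabs (z + h - z) < r by rewrite addrAC subrr add0r.
have [Pz0 dPz] := hPhi z Sz.
have [Pw0 dPw] := hPhi (z + h) (S1 _ zh).
pose E (t : R) := (z + h - p) * Phi (z + h) t - (z - p) * Phi z t
                  - h * (t%:C%C * f (q (t, z))).
have dE t : 0 <= t <= 1 -> curve_derive E t
    ((z + h - p) * f (q (t, z + h)) - (z - p) * f (q (t, z)) - h * G (t, z)).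
  move=> t01; have Sq : S (q (t, z)) by exact: sS.
  have D1 := curve_deriveM (curve_derive_cst (z + h - p) t) (dPw t t01).
  have D2 := curve_deriveM (curve_derive_cst (z - p) t) (dPz t t01).
  have D3 := curve_derive_chain (hf _ Sq) (curve_segment p (z - p) t).
  have D4 := curve_deriveM (curve_derive_cst h t)
    (curve_deriveM (curve_derive_real t) D3).
  have := curve_deriveB (curve_deriveB D1 D2) D4.
  rewrite !mul0r !add0r mul1r.
  by rewrite /G /= [df _ * _]mulrC mulrA.
have bE t : 0 <= t <= 1 ->
    cabs ((z + h - p) * f (q (t, z + h)) - (z - p) * f (q (t, z)) - h * G (t, z))
    <= e / 2 * cabs h.
  move=> t01.
  have hsum (s : R) : 0 <= s <= 1 -> cabs (z + s%:C%C * h - z) < r.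
    case/andP=> s0 s1; rewrite addrAC subrr add0r cabsM cabs_real ger0_norm //.
    by apply: le_lt_trans hr'; rewrite ler_piMl ?cabs_ge0.
  pose k (s : R) := (z + s%:C%C * h - p) * f (q (t, z + s%:C%C * h))
    - s%:C%C * (h * G (t, z)).
  have dk s : 0 <= s <= 1 -> curve_derive k s
      (h * (G (t, z + s%:C%C * h) - G (t, z))).
    move=> s01; have [Sq _] := hr _ (hsum s s01) t t01.
    have D1 := curve_deriveB (curve_segment z h s) (curve_derive_cst p s).
    have D2 : curve_derive (fun s : R => q (t, z + s%:C%C * h)) s (t%:C%C * h).
      have := curve_deriveM (curve_derive_cst t%:C%C s) D1.
      rewrite mul0r add0r subr0 => D; have := curve_deriveB D (curve_derive_cst (- p) s).
      rewrite subr0; congr curve_derive; apply/funext => s'.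
      by rewrite opprK addrC.
    have := curve_deriveB (curve_deriveM D1 (curve_derive_chain (hf _ Sq) D2))
      (curve_deriveM (curve_derive_real s) (curve_derive_cst (h * G (t, z)) s)).
    congr curve_derive; rewrite /G /=; ring.
  have bk s : 0 <= s <= 1 ->
      cabs (h * (G (t, z + s%:C%C * h) - G (t, z))) <= e / 4 * cabs h.
    move=> s01; have [_ /ltW Gs] := hr _ (hsum s s01) t t01.
    by rewrite cabsM mulrC ler_wpM2r // cabs_ge0.
  have := curve_bound dk bk.
  rewrite /k rmorph1 rmorph0 !mul1r !mul0r !addr0 subr0 => hk.
  have -> : e / 2 * cabs h = 2 * (e / 4 * cabs h) by field.
  by apply: le_trans hk; rewrite addrAC.
have := curve_bound dE bE.
rewrite /E Pz0 Pw0 !rmorph1 !rmorph0 !mulr0 !mul0r mulr0 !subr0 mul1r.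
rewrite /q /= mul1r subrKC.
have -> : 2 * (e / 2 * cabs h) = e * cabs h by field.
by [].
Qed.

End Primitives.

(** * Two sheets covering the twice punctured plane *)

Section Sheets.
Variable R : realType.
Local Notation C := R[i].
Implicit Types (e T : bool) (z u : C) (t s : R).

(** The Booleans true and false stand for the signs + and -; they index both the
    finite punctures 1 and -1 and the upper and lower sheets. *)
Definition sg e : R := if e then 1 else -1.

Definition pole T : C := (sg T)%:C%C.

Definition center e : C := (0 +i* sg e)%C.

(** The removed slits start at 1 and -1 and run diagonally, away from each other
    and from [center e].  They are parts of two lines through [center e], which
    makes the sheet star-shaped. *)
Definition sheet e : set C :=
  [set z | ~ (sg e * Im z <= 0 /\ `|Re z| = 1 - sg e * Im z)].

(** The slits of both sheets together cut the plane into the two wedges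
    [side T], with tips at the punctures, and the region [middle] between
    them. *)
Definition side T : set C := [set z | 1 + `|Im z| < sg T * Re z].

Definition middle : set C := [set z | `|Re z| < 1 + `|Im z|].

(** A star-shaped neighbourhood of 0 that avoids [pole T] but contains the wedge
    opposite to it; 1/(u - pole T) has a single-valued primitive there. *)
Definition cowedge T : set C := [set z | sg T * Re z < 1 + `|Im z|].

Lemma sg2 e : sg e * sg e = 1. Proof. by case: e; rewrite /sg; lra. Qed.

Lemma ReIm_segment z0 z t :
  Re (z0 + t%:C%C * (z - z0)) = Re z0 + t * (Re z - Re z0) /\
  Im (z0 + t%:C%C * (z - z0)) = Im z0 + t * (Im z - Im z0).
Proof. by case: z0 z => [a b] [c d] /=; rewrite !mul0r subr0 addr0. Qed.

Lemma closed_half_sheet e z : 0 <= sg e * Im z -> z != pole true -> z != pole false ->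
  sheet e z.
Proof.
case: z => x y /=; rewrite !eq_complex /= => y0 h1 h2 [/= yle xy].
have y00 : y = 0.
  have : sg e * y = 0 by lra.
  by move=> /eqP; rewrite mulf_eq0 => /orP[|/eqP //]; rewrite /sg; case: (e) => /eqP; lra.
move: xy h1 h2; rewrite y00 mulr0 subr0 eqxx !andbT.
by case: (ger0P x) => _ xx; [|have -> : x = -1 by lra]; rewrite ?xx eqxx.
Qed.

Lemma sheet_pole e T : ~ sheet e (pole T).
Proof. by apply; rewrite /= mulr0 subr0 lexx; split=> //; case: T; rewrite /sg
  ?normr1 ?normrN1. Qed.

Lemma sheet_star e : star (center e) (sheet e).
Proof.
move=> z t Sz /andP[t0 t1]; rewrite /sheet /=.
have [-> ->] := ReIm_segment (center e) z t.
rewrite /= !add0r subr0 normrM (ger0_norm t0) => -[h1 h2]; apply: Sz.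
have e2 := sg2 e; move: h1 h2 e2.
set a := sg e; set y := Im z; set x := `|Re z| => h1 h2 e2.
have h3 : a * (a + t * (y - a)) = 1 + t * (a * y - 1) by rewrite mulrDr mulrCA mulrBr e2.
rewrite h3 in h1 h2; clear h3 e2.
have t0' : 0 < t by rewrite lt_neqAle t0 andbT; apply/eqP => tt; move: h1; rewrite -tt; lra.
have : t * (x - (1 - a * y)) = 0 by lra.
move/eqP; rewrite mulf_eq0 gt_eqF //= => /eqP xe; split; last by lra.
have : t * (a * y) <= 0 by lra.
by rewrite pmulr_rle0.
Qed.

Lemma side_sub e T : side T `<=` sheet e.
Proof.
rewrite /side => z /= zT [h1 h2].
have hR : sg T * Re z <= `|Re z|.
  by case: T {zT} => /=; rewrite /sg ?mul1r ?mulN1r ?ler_norm // -normrN ler_norm.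
have hI : sg e * Im z >= - `|Im z|.
  have := ler_norm (Im z); have := ler_norm (- Im z); rewrite normrN /sg.
  by case: (e); lra.
lra.
Qed.

Lemma middle_sub e : middle `<=` sheet e.
Proof.
rewrite /middle => z /= zM [h1 h2].
have hI : sg e * Im z = - `|Im z|.
  move: h1; rewrite /sg; case: (e) => /=.
    by rewrite mul1r => /ler0_norm ->; rewrite opprK.
  by rewrite mulN1r oppr_le0 => /ger0_norm ->.
lra.
Qed.

(** Points outside the wedges and the middle region have |Re z| = 1 + |Im z| and
    lie on a slit of one of the sheets. *)
Lemma sheetI z : sheet true z -> sheet false z ->
  middle z \/ exists T, side T z.
Proof.
rewrite /sheet /middle /side /= mul1r mulN1r => h1 h2.
have [h|h|h] := ltgtP `|Re z| (1 + `|Im z|); first by left.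
- right; have [x0|x0] := lerP 0 (Re z).
    by exists true; rewrite /= mul1r -[ltRHS]ger0_norm.
  by exists false; rewrite /= mulN1r -[ltRHS]ger0_norm ?oppr_ge0 ?ltW // normrN.
- exfalso; have [y0|y0] := lerP 0 (Im z).
    by apply: h2; split; [lra|rewrite h ger0_norm // opprK].
  by apply: h1; split; [lra|rewrite h ltr0_norm].
Qed.

Lemma side_convex T z0 : side T z0 -> star z0 (side T).
Proof.
move=> h0 z t h /andP[t0 t1]; rewrite /side /=; have [-> ->] := ReIm_segment z0 z t.
have -> : Im z0 + t * (Im z - Im z0) = (1 - t) * Im z0 + t * Im z by ring.
have : `|(1 - t) * Im z0 + t * Im z| <= (1 - t) * `|Im z0| + t * `|Im z|.
  apply: le_trans (ler_normD _ _) _.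
  by rewrite !normrM (ger0_norm t0) ger0_norm // subr_ge0.
move: h0 h; rewrite /side /= => h0 h nz; rewrite -subr_gt0 in h0.
rewrite -subr_gt0 in h; rewrite -subr_gt0.
have p1 : 0 <= (1 - t) * (sg T * Re z0 - (1 + `|Im z0|)).
  by rewrite mulr_ge0 ?(ltW h0) // subr_ge0.
have [tz|tz] := eqVneq t 0; first by move: nz; rewrite tz; lra.
have t0' : 0 < t by rewrite lt_neqAle eq_sym tz.
have p2 : 0 < t * (sg T * Re z - (1 + `|Im z|)) by rewrite mulr_gt0.
lra.
Qed.

Lemma middle_star : star 0 middle.
Proof.
move=> z t h /andP[t0 t1]; rewrite /middle /=; have [-> ->] := ReIm_segment 0 z t.
rewrite /= !subr0 !add0r !normrM (ger0_norm t0); move: h; rewrite /middle /= => h.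
have p : 0 <= t * (1 + `|Im z| - `|Re z|) by rewrite mulr_ge0 // subr_ge0 ltW.
have [->|t1'] := eqVneq t 1; first by rewrite !mul1r.
have : t < 1 by rewrite lt_neqAle t1'.
lra.
Qed.

Lemma cowedge_star T : star 0 (cowedge T).
Proof.
move=> z t h /andP[t0 t1]; rewrite /cowedge /=; have [-> ->] := ReIm_segment 0 z t.
rewrite /= !subr0 !add0r !normrM (ger0_norm t0); move: h; rewrite /cowedge /= => h.
have p : 0 <= t * (1 + `|Im z| - sg T * Re z) by rewrite mulr_ge0 // subr_ge0 ltW.
have [->|t1'] := eqVneq t 1; first by rewrite !mul1r.
have : t < 1 by rewrite lt_neqAle t1'.
lra.
Qed.

Lemma sheet_cowedge_star e T : star (center e) (sheet e `&` cowedge T).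
Proof.
move=> z t [h1 h] t01; split; first exact: sheet_star.
case/andP: t01 => t0 t1; rewrite /cowedge /=; have [-> ->] := ReIm_segment (center e) z t.
move: h; rewrite /cowedge /= add0r subr0.
have ya : sg e * Im z = `|Im z| \/ sg e * Im z = - `|Im z|.
  by rewrite /sg; case: (e) (ger0P (Im z)) => -[_|_]; [left|right|right|left]; lra.
set w := sg e + _; have w1 := ler_norm (sg e * w); have w2 := ler_norm (- (sg e * w)).
have nw : `|sg e * w| = `|w| by rewrite normrM; case: (e); rewrite /sg ?normrN ?normr1 mul1r.
rewrite normrN nw in w2; rewrite nw in w1.
have we : sg e * w = 1 + t * (sg e * Im z - 1) by rewrite /w mulrDr mulrCA mulrBr sg2.
rewrite we in w1 w2 => h.
have [tz|tz] := eqVneq t 0; first by move: w1 w2; rewrite tz; lra.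
have t0' : 0 < t by rewrite lt_neqAle eq_sym tz.
have p : 0 < t * (1 + `|Im z| - sg T * Re z) by rewrite mulr_gt0 // subr_gt0.
by case: ya => yE; rewrite yE in w1 w2; lra.
Qed.

Lemma open_norm_lt (f g : C -> R) : continuous f -> continuous g ->
  open [set z | f z < g z].
Proof.
move=> cf cg; rewrite (_ : [set z | _] = (fun z => g z - f z) @^-1` [set x | 0 < x]).
  apply: open_comp; last exact: open_gt.
  move=> z _; apply: (@cvgB R R C (nbhs z) (nbhs_filter z) g f).
    exact: cg.
  exact: cf.
by apply/seteqP; split=> z /=; rewrite subr_gt0.
Qed.

Lemma sheet_open e : open (sheet e).
Proof.
have cI : continuous (fun z : C => sg e * Im z).
  move=> z; have H := (@cvgM R C (nbhs z) (nbhs_filter z) (fun=> sg e) (@Im R) _ _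
    (@cst_continuous C R _ z) (@Im_continuous R z)).
  exact: H.
have cR : continuous (fun z : C => `|Re z|).
  by move=> z; apply: (cvg_comp _ _ (@Re_continuous R z)); exact: norm_continuous.
have cJ : continuous (fun z : C => 1 - sg e * Im z).
  move=> z; have H := (@cvgB R R C (nbhs z) (nbhs_filter z) (fun=> 1) (fun z => sg e
    * Im z) _ _ (@cst_continuous C R _ z) (cI z)).
  exact: H.
rewrite (_ : sheet e = [set z | 0 < sg e * Im z] `|`
   ([set z | `|Re z| < 1 - sg e * Im z] `|` [set z | 1 - sg e * Im z < `|Re z|])).
  apply: openU; last apply: openU; apply: open_norm_lt => //.
  exact: cst_continuous.
apply/seteqP; split=> z.
  move=> Sz /=; have [h|h] := lerP (sg e * Im z) 0; last by left.
  by right; have [h'|h'|h'] := ltgtP `|Re z| (1 - sg e * Im z); [left|right|case: Sz].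
by move=> /= [h|[h|h]] [h1 h2]; lra.
Qed.

Lemma cowedge_open T : open (cowedge T).
Proof.
apply: open_norm_lt => z.
  have H := (@cvgM R C (nbhs z) (nbhs_filter z) (fun=> sg T) (@Re R) _ _
    (@cst_continuous C R _ z) (@Re_continuous R z)).
  exact: H.
apply: (@cvgD R R C (nbhs z) (nbhs_filter z) (fun=> 1) (fun z => `|Im z|) _ _
  (@cst_continuous C R _ z)).
by apply: (cvg_comp _ _ (@Im_continuous R z)); exact: norm_continuous.
Qed.

End Sheets.

(** * Iterated integrals on the sheets *)

Section WordIntegrals.
Variable R : realType.
Local Notation C := R[i].
Implicit Types (e T i : bool) (z u : C) (t s : R).
Local Notation pole := (@pole R).
Local Notation sheet := (@sheet R).
Local Notation center := (@center R).

(** The primitive on [sheet e] that vanishes at 0, as a total function of f: a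
    junk value is used when f has none. *)
Definition primitive e (f : C -> C) : C -> C :=
  match pselect (exists F : C -> C,
    (forall u, sheet e u -> is_derive u (1 : C) F (f u)) /\ F 0 = 0) with
  | left H => sval (cid H)
  | right _ => fun=> 0
  end.

Lemma primitiveP e (f df : C -> C) :
  (forall u, sheet e u -> is_derive u (1 : C) f (df u)) ->
  (forall u, sheet e u -> {for u, continuous df}) ->
  (forall u, sheet e u -> is_derive u (1 : C) (primitive e f) (f u)) /\ primitive e f 0 = 0.
Proof.
move=> hf cdf; rewrite /primitive; case: pselect => [H|[]]; first by case: (cid H).
have [F hF] := star_primitive (@sheet_open R e) (@sheet_star R e) hf cdf.
exists (fun u => F u - F 0); split; last by rewrite subrr.
move=> u Su; rewrite -[f u]subr0.
exact: is_deriveB (hF u Su) (is_derive_cst _ _ _).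
Qed.

(** Hyperlogarithms: the first letter of a word is the outermost integration. *)
Fixpoint word_integral e (w : seq bool) : C -> C :=
  if w is i :: w' then primitive e (fun u => - (u - pole i)^-1 * word_integral e w' u)
  else fun=> 1.

Lemma sheet_neq e i u : sheet e u -> u - pole i != 0.
Proof.
by move=> Su; rewrite subr_eq0; apply/eqP => E; apply: (@sheet_pole R e i); rewrite -E.
Qed.

Lemma dlog_derive i u : u - pole i != 0 ->
  is_derive u (1 : C) (fun v => - (v - pole i)^-1) ((u - pole i) ^- 2).
Proof.
move=> h; have D : is_derive u (1 : C) (fun v : C => v - pole i) 1.
  have H := is_deriveB (is_derive_id u (1 : C)) (is_derive_cst (pole i) u (1 : C)).
  by rewrite subr0 in H; exact: H.
have H := is_deriveN (@is_derive_inv C (fun v => v - pole i) u 1 h D).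
by rewrite mulN1r opprK in H; exact: H.
Qed.

Lemma dlog_continuous i u : u - pole i != 0 ->
  {for u, continuous (fun v => - (v - pole i)^-1)}.
Proof. by move=> h; exact: derive_continuous (dlog_derive h). Qed.

Lemma dlog2_continuous i u : u - pole i != 0 ->
  {for u, continuous (fun v => (v - pole i) ^- 2)}.
Proof.
move=> h; have c := dlog_continuous h.
have -> : (fun v => (v - pole i) ^- 2) = (fun v => - (v - pole i)^-1 * - (v - pole i)^-1).
  by apply/funext => v; rewrite mulrNN -invfM -expr2.
have H := @cvgM C C (nbhs u) (nbhs_filter u) _ _ _ _ c c.
exact: H.
Qed.

(** Continuity of the derivative is carried along, because [star_primitive]
    asks for it at the next integration. *)
Lemma word_integral_derive e w : exists dI : C -> C,
  forall u, sheet e u -> is_derive u (1 : C) (word_integral e w) (dI u) /\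
    {for u, continuous dI}.
Proof.
elim: w => [|i w [dI hI]] /=.
  by exists (fun=> 0) => u _; split; [exact: is_derive_cst|exact: cst_continuous].
pose f u := - (u - pole i)^-1 * word_integral e w u.
pose df u := (u - pole i) ^- 2 * word_integral e w u + - (u - pole i)^-1 * dI u.
have hf u : sheet e u -> is_derive u (1 : C) f (df u).
  move=> Su; have h := sheet_neq i Su.
  exact: is_derive_scale (dlog_derive h) (hI u Su).1.
have cdf u : sheet e u -> {for u, continuous df}.
  move=> Su; have h := sheet_neq i Su.
  have c1 := derive_continuous (hI u Su).1.
  have H1 := @cvgM C C (nbhs u) (nbhs_filter u) _ _ _ _ (dlog2_continuous h) c1.
  have H2 := @cvgM C C (nbhs u) (nbhs_filter u) _ _ _ _ (dlog_continuous h) (hI u Su).2.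
  have H := @cvgD C C C (nbhs u) (nbhs_filter u) _ _ _ _ H1 H2.
  exact: H.
exists f => u Su; split; first exact: (primitiveP hf cdf).1.
exact: derive_continuous (hf u Su).
Qed.

Lemma word_integral_cons e i w :
  (forall u, sheet e u -> is_derive u (1 : C) (word_integral e (i :: w))
    (- (u - pole i)^-1 * word_integral e w u)) /\ word_integral e (i :: w) 0 = 0.
Proof.
have [dI hI] := word_integral_derive e w.
pose df u := (u - pole i) ^- 2 * word_integral e w u + - (u - pole i)^-1 * dI u.
have hf u : sheet e u -> is_derive u (1 : C) (fun v => - (v - pole i)^-1 *
  word_integral e w v) (df u).
  move=> Su; have h := sheet_neq i Su.
  exact: is_derive_scale (dlog_derive h) (hI u Su).1.
apply: (primitiveP hf) => u Su; have h := sheet_neq i Su.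
have c1 := derive_continuous (hI u Su).1.
have H1 := @cvgM C C (nbhs u) (nbhs_filter u) _ _ _ _ (dlog2_continuous h) c1.
have H2 := @cvgM C C (nbhs u) (nbhs_filter u) _ _ _ _ (dlog_continuous h) (hI u Su).2.
have H := @cvgD C C C (nbhs u) (nbhs_filter u) _ _ _ _ H1 H2.
exact: H.
Qed.

Lemma middle0 : middle (0 : C).
Proof. by rewrite /middle /= !normr0 addr0. Qed.

Lemma sheet0 e : sheet e 0.
Proof. exact/middle_sub/middle0. Qed.

Lemma pole2 T : 2 * pole T = (2 * sg R T)%:C%C.
Proof. by rewrite /pole rmorphM rmorph_nat. Qed.

Lemma side_pole2 T : side T (2 * pole T).
Proof. by rewrite pole2 /side /= normr0 mulrCA sg2; lra. Qed.

(** Both integrals are restrictions of a single-valued primitive on [cowedge i],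
    a region that contains 0 and [2 * pole T], and that meets each sheet in a
    star-shaped set. *)
Lemma word_integral_off_diagonal i T : i != T ->
  word_integral true [:: i] (2 * pole T) = word_integral false [:: i] (2 * pole T).
Proof.
move=> iT.
have cT : cowedge i (2 * pole T).
  by rewrite pole2 /cowedge; case: i T iT => -[] // _; rewrite /= /sg normr0; lra.
have sT e : sheet e (2 * pole T) by exact: (side_sub (@side_pole2 T)).
have neq u : cowedge i u -> u - pole i != 0.
  move=> h; rewrite subr_eq0; apply/eqP => E; move: h.
  by rewrite E /cowedge /= sg2 normr0 addr0 ltxx.
have [P hP] := star_primitive (@cowedge_open R i) (@cowedge_star R i)
  (fun u h => dlog_derive (neq u h)) (fun u h => dlog2_continuous (neq u h)).
suff H e u : sheet e u -> cowedge i u -> word_integral e [:: i] u = P u - P 0.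
  by rewrite !H.
move=> Su cu.
have D v : (sheet e `&` cowedge i) v ->
    is_derive v (1 : C) (fun w => word_integral e [:: i] w - P w) 0.
  move=> [Sv cv].
  have := is_deriveB ((word_integral_cons e i [::]).1 v Sv) (hP v cv).
  by rewrite mulr1 subrr.
have K := star_constant (@sheet_cowedge_star R e i) D.
have := K u (conj Su cu); rewrite -(K 0); last first.
  by split; [exact: sheet0|rewrite /cowedge /= mulr0 normr0 addr0].
rewrite (word_integral_cons e i [::]).2 sub0r => /eqP.
by rewrite subr_eq addrC => /eqP.
Qed.

(** Integration along the half circle g around [pole T] from 0 to [2 * pole T],
    which runs in [sheet e]; du/(u - pole T) is a constant multiple of dt along it.  The two
    sheets use opposite half circles, so the values differ by a full
    period. *)
Lemma word_integral_diagonal e T :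
  word_integral e [:: T] (2 * pole T) = (0 +i* (sg R e * sg R T * pi))%C.
Proof.
set p := sg R T; set a := sg R e.
pose th t := pi * t.
pose g t : C := ((p - p * cos (th t)) +i* (a * sin (th t)))%C.
pose g' t : C := ((p * (pi * sin (th t))) +i* (a * (pi * cos (th t))))%C.
have p2 : p * p = 1 := sg2 R T.
have a2 : a * a = 1 := sg2 R e.
have dth t : is_derive t (1 : R) th pi.
  have H := is_deriveZ (pi : R) (is_derive_id t (1 : R)).
  by rewrite [_ *: _]mulr1 in H; exact: H.
have dsin t : is_derive t (1 : R) (fun s => sin (th s)) (pi * cos (th t)).
  have H := @is_derive_chain R R^o th sin t pi (cos (th t)) (dth t) (is_derive_sin _).
  exact: H.
have dcos t : is_derive t (1 : R) (fun s => cos (th s)) (- (pi * sin (th t))).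
  have H := @is_derive_chain R R^o th cos t pi _ (dth t) (is_derive_cos _).
  by rewrite -[_ *: _]/(_ * _) mulrN in H; exact: H.
have dg t : curve_derive g t (g' t).
  split => /=.
    have H := is_deriveB (is_derive_cst p t (1 : R)) (is_deriveZ p (dcos t)).
    by rewrite -[_ *: _]/(_ * _) mulrN sub0r opprK in H; exact: H.
  have H := is_deriveZ a (dsin t); exact: H.
have cs t : cos (th t) ^+ 2 + sin (th t) ^+ 2 = 1 := cos2Dsin2 _.
have pE : p = 1 \/ p = -1 by rewrite /p /sg; case: (T); [left|right].
have gneq t i : g t != pole i.
  apply/eqP => /eqP; rewrite eq_complex /= => /andP[/eqP hr /eqP hi].
  have : sin (th t) = 0 by rewrite -[sin _]mul1r -a2 -mulrA hi mulr0.
  have := cs t; have := cos_le1 (th t); have := cos_geN1 (th t).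
  move=> c1 c2 c3 s0; rewrite s0 expr0n addr0 in c3.
  have i1 : sg R i = 1 \/ sg R i = -1 by rewrite /sg; case: (i); [left|right].
  by case: pE i1 => pE [] iE; rewrite pE iE in hr; nra.
have gS t : 0 <= t <= 1 -> sheet e (g t).
  move=> t01; apply: closed_half_sheet => //.
  rewrite /= -/a mulrA a2 mul1r; apply: sin_ge0_pi.
  case/andP: t01 => t0 t1; rewrite /th mulr_ge0 ?pi_ge0 //=.
  by rewrite ler_piMr ?pi_ge0.
(* The claim for the part of the half circle up to time t. *)
pose K t := word_integral e [:: T] (g t) - t%:C%C * (0 +i* (a * p * pi))%C.
have dK t : 0 <= t <= 1 -> curve_derive K t 0.
  move=> t01.
  have D1 := curve_derive_chain ((word_integral_cons e T [::]).1 _ (gS t t01)) (dg t).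
  have D2 := curve_deriveM (curve_derive_real t) (curve_derive_cst (0 +i* (a * p * pi))%C t).
  have := curve_deriveB D1 D2; congr curve_derive.
  rewrite mul1r mulr0 addr0 mulr1.
  have gp : g t - pole T != 0 by rewrite subr_eq0.
  apply: (mulfI gp); rewrite mulr0 mulrBr mulrA mulrN divff // mulN1r.
  rewrite /g /g' /pole -/p; apply/eqP; rewrite eq_complex /=; apply/andP; split; apply/eqP.
    have -> : p * (pi * sin (th t)) = (a * a) * p * pi * sin (th t) by rewrite a2; ring.
    ring.
  have -> : a * (pi * cos (th t)) = (p * p) * a * pi * cos (th t) by rewrite p2; ring.
  ring.
have /= := @curve_bound R K (fun=> 0) 0 dK (fun t _ => eq_ind_r (fun x => x <= 0)
  (lexx 0) (cabs0 R)).
rewrite mulr0 => h; have : cabs (K 1 - K 0) == 0 by rewrite eq_le h cabs_ge0.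
rewrite cabs_eq0 subr_eq0 => /eqP.
have g1 : g 1 = 2 * pole T.
  rewrite pole2 /g /th mulr1 cospi sinpi mulr0 -/p.
  by apply/eqP; rewrite eq_complex /= eqxx andbT; apply/eqP; ring.
have g0 : g 0 = 0.
  by rewrite /g /th mulr0 cos0 sin0 mulr0 mulr1 subrr.
rewrite /K g1 g0 (word_integral_cons e T [::]).2 rmorph1 rmorph0 mul1r mul0r subrr => /eqP.
by rewrite subr_eq0 => /eqP.
Qed.

End WordIntegrals.

(** * Solutions of the system with strictly triangular residues *)

Section LinearSystem.
Variable R : realType.
Local Notation C := R[i].
Variables (n : nat) (d : 'I_n -> nat).
Local Notation M := ('M[C]_n).
Local Notation deg_ge := (@deg_ge C n d).
Implicit Types (e T i : bool) (z u : C).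
Local Notation pole := (@pole R).
Local Notation sheet := (@sheet R).

Lemma is_derive_mulmx p q r (A : 'M[C]_(p, q)) (f : C -> 'M[C]_(q, r)) u df :
  is_derive u (1 : C) f df -> is_derive u (1 : C) (fun v => A *m f v) (A *m df).
Proof.
move=> hf; apply: is_derive_mx => i j; rewrite mxE.
under [X in is_derive _ _ X]eq_fun do rewrite mxE.
apply: is_derive_bigsum => k.
have H := is_derive_scale (is_derive_cst (A i k) u (1 : C)) (is_derive_mx_entry k j hf).
by rewrite scale0r add0r in H; exact: H.
Qed.

Lemma is_derive_mulmxr p q r (f : C -> 'M[C]_(p, q)) (A : 'M[C]_(q, r)) u df :
  is_derive u (1 : C) f df -> is_derive u (1 : C) (fun v => f v *m A) (df *m A).
Proof.
move=> hf; apply: is_derive_mx => i j; rewrite mxE.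
under [X in is_derive _ _ X]eq_fun do rewrite mxE.
apply: is_derive_bigsum => k.
have H := is_derive_scale (is_derive_mx_entry i k hf) (is_derive_cst (A k j) u (1 : C)).
by rewrite scaler0 addr0 in H; exact: H.
Qed.

(** The geometric series in - A, cut where the weights are exhausted. *)
Lemma unipotent_inverse (A : M) : deg_ge 1 A ->
  exists2 A' : M, deg_ge 1 A' & (1%:M + A) *m (1%:M + A') = 1%:M.
Proof.
move=> dA; pose K := (\max_i d i)%N.
have dNA : deg_ge 1 (- A) by rewrite -scaleN1r; exact: deg_geZ.
have dK k : deg_ge k ((- A) ^+ k).
  elim: k => [|k IHk]; first by rewrite expr0; exact: deg_ge1.
  by rewrite exprS -add1n; apply: deg_geM IHk.
have AK : (- A) ^+ K.+1 = 0.
  apply: (@deg_ge_eq0 _ _ d K.+1 _ _ (dK K.+1)) => i.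
  by rewrite ltnS; exact: (leq_bigmax (F := d)).
exists (\sum_(k < K) (- A) ^+ k.+1).
  apply: deg_ge_sum => k _; apply: deg_ge_le (dK k.+1).
  by [].
have := subrXX_comm K.+1 (commr_sym (commr1 (- A))).
rewrite AK expr1n subr0 opprK => E.
rewrite mulmxE -[RHS]/(1 : M) [RHS]E; congr (_ * _).
rewrite big_ord_recl expr1n expr0 mul1r; congr (_ + _).
by apply: eq_bigr => k _; rewrite expr1n mul1r.
Qed.

Lemma unipotent_unit (A : M) : deg_ge 1 A -> 1%:M + A \in unitmx.
Proof. by move=> /unipotent_inverse[A' _ /mulmx1_unit[]]. Qed.

(** The derivative of row i of Z only involves rows of larger weight.  Starting
    from the largest weights, the rows have derivative 0, hence are constant on
    the star-shaped set and vanish with their value at p. *)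
Lemma ode_unique (S : set C) p (Z W : C -> M) : star p S ->
  (forall u, S u -> deg_ge 1 (W u)) ->
  (forall u, S u -> is_derive u (1 : C) Z (W u *m Z u)) -> Z p = 0 ->
  forall u, S u -> Z u = 0.
Proof.
move=> sS dW hZ Zp.
suff H k : forall i : 'I_n, (\max_i d i < k + d i)%N -> forall j u, S u -> Z u i j = 0.
  move=> u Su; apply/matrixP => i j; rewrite mxE.
  by apply: (H (\max_i d i).+1) => //; rewrite addSn ltnS leq_addr.
elim: k => [|k IHk] i.
  by rewrite add0n ltnNge (leq_bigmax (F := d)).
move=> ik j u Su; rewrite -[RHS](_ : Z p i j = 0); last by rewrite Zp mxE.
apply: (star_constant (F := fun u => Z u i j) sS _ Su) => v Sv.
have H := is_derive_mx_entry i j (hZ v Sv).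
suff E : (W v *m Z v) i j = 0 by rewrite E in H.
rewrite mxE big1 // => h _.
have [hi|ih] := ltnP (d h) (d i + 1); first by rewrite (dW v Sv) // mul0r.
by rewrite (IHk h) ?mulr0 //; lia.
Qed.

Lemma word_level_derive l (h dh : seq bool -> C -> C) u (B : bool -> M) :
  (forall w, is_derive u (1 : C) (h w) (dh w u)) ->
  is_derive u (1 : C) (fun v => word_level l (fun w => h w v) B)
    (word_level l (fun w => dh w u) B).
Proof.
elim: l h dh => [|l IHl] h dh hh /=.
  have H := is_derive_scale (hh [::]) (is_derive_cst (1%:M : M) u (1 : C)).
  by rewrite scaler0 addr0 in H; exact: H.
apply: is_derive_bigsum => i; apply: is_derive_mulmx.
exact: (IHl (fun w => h (i :: w)) (fun w => dh (i :: w))).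
Qed.

Lemma word_levelZ l (c : C) (f : seq bool -> C) (B : bool -> M) :
  word_level l (fun w => c * f w) B = c *: word_level l f B.
Proof.
elim: l f => [|l IHl] f /=; first by rewrite scalerA.
by rewrite scaler_sumr; apply: eq_bigr => i _; rewrite IHl scalemxAr.
Qed.

Lemma word_level0 l (f : seq bool -> C) (B : bool -> M) :
  (forall w, size w = l -> f w = 0) -> word_level l f B = 0.
Proof.
elim: l f => [|l IHl] f f0 /=; first by rewrite f0 // scale0r.
by rewrite big1 // => i _; rewrite IHl ?mulmx0 // => w wl; rewrite f0 //= wl.
Qed.

Definition dlog_form (B : bool -> M) u : M := \sum_(i : bool) (u - pole i)^-1 *: B i.

Lemma dlog_form_deg B u : (forall i, deg_ge 1 (B i)) -> deg_ge 1 (dlog_form B u).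
Proof. by move=> dB; apply: deg_ge_sum => i _; exact: deg_geZ. Qed.

(** The matrices Y e are the generating series of the iterated integrals.  They
    satisfy the same equation on both sheets, so [ode_unique] propagates their
    relation from one point of each component of the overlap: from 0 on the
    middle region, and from [2 * pole T] on [side T], where it holds by the choice of
    B. *)
Theorem sheet_solutions (N : bool -> M) : (forall T, deg_ge 1 (N T)) ->
  exists (B : bool -> M) (Y : bool -> C -> M),
  [/\ forall e u, sheet e u ->
        is_derive u (1 : C) (Y e) (- (dlog_form B u *m Y e u)),
      forall e u, Y e u \in unitmx,
      forall u, middle u -> Y true u = Y false u &
      forall T u, side T u -> Y true u = Y false u *m (1%:M + N T)].
Proof.
move=> dN; pose K := (\max_i d i)%N.
have dK (i : 'I_n) : (d i < K.+2)%N by rewrite ltnS ltnW // ltnS (leq_bigmax (F := d)).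
pose c T : C := (0 +i* (2 * sg R T * pi))%C.
have [||||B dB hB] := @solve_word_sums C n d K
  (fun T w => word_integral true w (2 * pole T)) (fun T w => word_integral false w (2
    * pole T)) N c dK dN.
- by [].
- by [].
- move=> T; rewrite eq_complex /= eqxx /=; apply/eqP => h.
  have : sg R T * (2 * pi * sg R T) = 0 by rewrite -[2 * pi * _]mulrAC h mulr0.
  by rewrite mulrCA sg2; have := pi_gt0 R; lra.
- move=> T i; case: eqP => [->|/eqP iT]; last by rewrite (word_integral_off_diagonal
  R iT) subrr.
  rewrite !word_integral_diagonal /c; apply/eqP; rewrite eq_complex /= subr0 eqxx /=.
  by apply/eqP; rewrite /sg; ring.
pose Y e u := word_sum K.+2 (fun w => word_integral e w u) B.
have dY e u : sheet e u -> is_derive u (1 : C) (Y e) (- (dlog_form B u *m Y e u)).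
  move=> Su; rewrite /Y /word_sum.
  have -> : - (dlog_form B u *m \sum_(l < K.+2) word_level l (word_integral e ^~ u) B) =
     \sum_(l < K.+2) if nat_of_ord l is l'.+1 then
        - (dlog_form B u *m word_level l' (word_integral e ^~ u) B) else 0.
    (* The equation raises the length of words by one; the longest words have
       no successor, but there the degree exceeds all weights. *)
    have top0 : dlog_form B u *m word_level (@ord_max K.+1) (word_integral e ^~ u) B = 0.
      apply: (@deg_ge_eq0 _ _ d (1 + K.+1)) => //.
      by apply: deg_geM; [exact: dlog_form_deg|exact: word_level_deg].
    rewrite [X in _ *m X]big_ord_recr mulmxDr top0 addr0 [RHS]big_ord_recl add0r.
    rewrite mulmx_sumr -sumrN; apply: eq_bigr => l _.
    by [].
  apply: is_derive_bigsum => -[[|l] lK] /=.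
    have H := is_derive_cst (1%:M : M) u (1 : C).
    under [X in is_derive _ _ X]eq_fun do rewrite scale1r.
    exact: H.
  rewrite /dlog_form mulmx_suml -sumrN; apply: is_derive_bigsum => i.
  rewrite -scalemxAl scalemxAr -mulmxN -scaleNr -word_levelZ.
  apply: is_derive_mulmx.
  apply: (@word_level_derive l (fun w => word_integral e (i :: w))
    (fun w u => - (u - pole i)^-1 * word_integral e w u)) => w.
  exact: ((@word_integral_cons R e i w).1 u Su).
have YE e u : exists2 A, deg_ge 1 A & Y e u = 1%:M + A.
  exists (\sum_(l < K.+1) word_level l.+1 (fun w => word_integral e w u) B).
    apply: deg_ge_sum => l _; apply: (@deg_ge_le _ _ _ l.+1) => //.
    exact: word_level_deg.
  by rewrite /Y /word_sum big_ord_recl /= scale1r.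
have Y0 e : Y e 0 = 1%:M.
  rewrite /Y /word_sum big_ord_recl big1 => [|l _]; first by rewrite /= scale1r addr0.
  apply: (@word_level0 (bump 0 l)) => -[//|i w] _.
  exact: (@word_integral_cons R e i w).2.
exists B, Y; split=> //.
- by move=> e u; have [A dA ->] := YE e u; exact: unipotent_unit.
- move=> u Mu; apply/eqP; rewrite -subr_eq0; apply/eqP.
  pose Z v := Y true v - Y false v.
  have UZ := @ode_unique (@middle R) 0 Z (fun v => - dlog_form B v) (@middle_star R).
  apply: (UZ _ _ _ u Mu).
  + move=> v _; rewrite -scaleN1r; apply: deg_geZ; exact: dlog_form_deg.
  + move=> v Mv; rewrite mulNmx mulmxBr opprB addrC.
    have H := is_deriveB (dY true v (middle_sub Mv)) (dY false v (middle_sub Mv)).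
    by rewrite opprK in H; exact: H.
  + by rewrite /Z !Y0 subrr.
- move=> T u Tu; apply/eqP; rewrite -subr_eq0; apply/eqP.
  pose Z v := Y true v - Y false v *m (1%:M + N T).
  have UZ := @ode_unique (side T) (2 * pole T) Z (fun v => - dlog_form B v)
    (side_convex (side_pole2 R T)).
  apply: (UZ _ _ _ u Tu).
  + move=> v _; rewrite -scaleN1r; apply: deg_geZ; exact: dlog_form_deg.
  + move=> v Mv; rewrite mulNmx mulmxBr opprB addrC.
    have H := is_deriveB (dY true v (side_sub Mv))
      (is_derive_mulmxr (1%:M + N T) (dY false v (side_sub Mv))).
    by rewrite mulNmx opprK -mulmxA in H; exact: H.
  + by rewrite /Z /Y hB subrr.
Qed.

End LinearSystem.

(** * Charts and homogeneous coordinates on the sphere *)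

Section SphereCharts.
Variable R : realType.
Local Notation C := R[i].
Local Notation sphere := (sphere R).
Implicit Types (z w x y : C) (p q : sphere).

Lemma compact_square (m : R) :
  compact [set z : C | `|Re z| <= m /\ `|Im z| <= m] /\
  closed [set z : C | `|Re z| <= m /\ `|Im z| <= m].
Proof.
have cK : compact [set z : C | `|Re z| <= m /\ `|Im z| <= m].
  rewrite (_ : [set z : C | _] = (fun x : R * R => (x.1 +i* x.2)%C) @`
      (`[- m, m]%classic `*` `[- m, m]%classic)).
    apply: continuous_compact; last by apply: compact_setX; exact: segment_compact.
    apply: continuous_subspaceT => x.
    by apply: cvg_complex; [exact: cvg_fst|exact: cvg_snd].
  apply/seteqP; split=> [[u v] /= [hu hv]|_ [[u v] [/= hu hv] <-]].
    by exists (u, v) => //=; rewrite !in_itv /= -!ler_norml.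
  by move: hu hv; rewrite !in_itv /= -!ler_norml.
split=> //; apply: compact_closed cK; exact: norm_hausdorff.
Qed.

Lemma nbhs_chart0 z (A : set sphere) : nbhs (chart0 z) A <-> nbhs z (@chart0 R @^-1` A).
Proof. by []. Qed.

Lemma chartoo_neq0 w : w != 0 -> chartoo w = chart0 w^-1.
Proof. by rewrite /chartoo => /negPf ->. Qed.

Lemma chartoo0 : chartoo (0 : C) = None.
Proof. by rewrite /chartoo eqxx. Qed.

Lemma inv_continuous w : w != 0 -> {for w, continuous (fun z : C => z^-1)}.
Proof.
by move=> w0; apply: (derive_continuous (is_derive_inv w0 (is_derive_id w (1 : C)))).
Qed.

Lemma near_neq0 w : w != 0 -> \forall z \near w, z != 0.
Proof.
move=> w0; apply/nbhs_cabs; exists (cabs w); first by rewrite cabs_gt0.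
by move=> z; apply: contraTneq => ->; rewrite sub0r cabsN ltxx.
Qed.

(** The neighbourhoods of infinity are given by complements of compact sets; a
    compact set is bounded, and a square is compact, so these are the images of
    the neighbourhoods of 0 under inversion. *)
Lemma nbhs_chartoo w (A : set sphere) :
  nbhs (chartoo w) A <-> nbhs w (@chartoo R @^-1` A).
Proof.
have [->{w}|w0] := eqVneq w 0.
  rewrite chartoo0; split.
    move=> [K [cK _] KA].
    have [m m0 hm] : exists2 m : R, 0 < m & forall z, K z -> cabs z <= m.
      have [m1 m10 h1] := ex_strict_bound_gt0 (compact_bounded
        (continuous_compact (continuous_subspaceT (@Re_continuous R)) cK)).
      have [m2 m20 h2] := ex_strict_bound_gt0 (compact_bounded
        (continuous_compact (continuous_subspaceT (@Im_continuous R)) cK)).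
      exists (m1 + m2) => [|z Kz]; first exact: addr_gt0.
      apply: le_trans (cabs_le_ReIm _) _.
      have := h1 _ (imageP _ Kz); have := h2 _ (imageP _ Kz); rewrite /=; lra.
    apply/nbhs_cabs; exists m^-1; first by rewrite invr_gt0.
    move=> w; rewrite subr0 => wm; apply: KA; rewrite /chartoo.
    case: eqP => [_|/eqP w0]; [by right|left; exists w^-1 => //].
    move=> /hm; rewrite cabsV leNgt => /negP; apply.
    by rewrite -ltf_pV2 ?posrE ?invrK ?invr_gt0 ?cabs_gt0.
  move=> /nbhs_cabs[e e0 eA].
  have [cK cl] := compact_square e^-1.
  exists [set z : C | `|Re z| <= e^-1 /\ `|Im z| <= e^-1] => // p [[z nz <-]|->].
    have z0 : e^-1 < cabs z.
      rewrite ltNge; apply/negP => h; apply: nz.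
      by split; apply: le_trans h; [exact: Re_le_cabs|exact: Im_le_cabs].
    have zn0 : z != 0 by rewrite -cabs_gt0; apply: lt_trans z0; rewrite invr_gt0.
    have := eA z^-1; rewrite subr0 cabsV /= chartoo_neq0 ?invr_eq0 // invrK; apply.
    by rewrite -ltf_pV2 ?posrE ?invrK // invr_gt0 cabs_gt0.
  by have := eA 0; rewrite subr0 cabs0 /= chartoo0; apply.
rewrite chartoo_neq0 //; split=> hA.
  have : \forall z \near w, A (chart0 z^-1) by exact: (inv_continuous w0 (t :=
    @chart0 R @^-1` A) hA).
  by apply: filterS2 (near_neq0 w0) => z z0 Az; rewrite /= chartoo_neq0.
have w0' : w^-1 != 0 by rewrite invr_eq0.
apply/nbhs_chart0; have hA' : nbhs (w^-1)^-1 (@chartoo R @^-1` A) by rewrite invrK.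
have : \forall z \near w^-1, A (chartoo z^-1) by exact: (inv_continuous w0' (t :=
  @chartoo R @^-1` A) hA').
by apply: filterS2 (near_neq0 w0') => z z0 /=; rewrite chartoo_neq0 ?invr_eq0 // invrK.
Qed.

Lemma chart0_continuous : continuous (@chart0 R).
Proof. by move=> z A. Qed.

Lemma chartoo_continuous : continuous (@chartoo R).
Proof. by move=> w A /nbhs_chartoo. Qed.

Lemma chart_cases p : (exists z, p = chart0 z) \/ p = chartoo 0.
Proof. by case: p => [z|]; [left; exists z|right; rewrite chartoo0]. Qed.

(** Homogeneous coordinates [z : 1] and [1 : 0].  They allow the three punctures
    to be treated alike, whether or not one of them is infinity.  The bracket of
    two points is the determinant of their coordinates. *)
Definition hom_x p : C := if p is Some z then z else 1.
Definition hom_y p : C := if p is Some _ then 1 else 0.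
Definition bracket p q : C := hom_x p * hom_y q - hom_y p * hom_x q.

Lemma bracket_eq0 p q : (bracket p q == 0) = (p == q).
Proof.
rewrite /bracket; case: p q => [z|] [w|] /=; rewrite ?(mulr1, mul1r, mulr0, mul0r)
  ?subr0 ?sub0r ?subrr.
- by rewrite subr_eq0.
- by rewrite oppr_eq0 oner_eq0.
- by rewrite oner_eq0.
- by rewrite !eqxx.
Qed.

Definition of_hom x y : sphere := if y == 0 then None else Some (x / y).

Lemma of_hom_chart0 x y : y != 0 -> of_hom x y = chart0 (x / y).
Proof. by rewrite /of_hom => /negPf ->. Qed.

Lemma of_hom_chartoo x y : x != 0 -> of_hom x y = chartoo (y / x).
Proof.
move=> x0; rewrite /of_hom /chartoo mulf_eq0 invr_eq0 (negPf x0) orbF.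
by case: eqP => // _; rewrite invf_div.
Qed.

Lemma of_hom_continuous T (F : set_system T) (FF : Filter F) (f g : T -> C) x y :
  f @ F --> x -> g @ F --> y -> (x != 0) || (y != 0) ->
  (fun t => of_hom (f t) (g t)) @ F --> of_hom x y.
Proof.
move=> fx gy; have near0 (h : T -> C) z : h @ F --> z -> z != 0 ->
    \forall t \near F, h t != 0.
  by move=> hz z0; exact: (hz _ (near_neq0 z0)).
have quot (h k : T -> C) z w : h @ F --> z -> k @ F --> w -> w != 0 ->
    (fun t => h t / k t) @ F --> z / w.
  move=> hz kw w0.
  exact: (@cvgM C T F FF h (fun t => (k t)^-1) _ _ hz (cvg_comp _ _ kw (inv_continuous w0))).
have [y0|/negPn/eqP y0] := boolP (y != 0) => [_|]; last rewrite y0 orbF => x0.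
  rewrite of_hom_chart0 //; apply: cvg_trans; last first.
    exact: (cvg_comp _ _ (quot _ _ _ _ fx gy y0) (@chart0_continuous _)).
  apply: near_eq_cvg; apply: filterS (near0 _ _ gy y0) => t t0.
  by rewrite /= of_hom_chart0.
rewrite y0 in gy; rewrite of_hom_chartoo //; apply: cvg_trans; last first.
  exact: (cvg_comp _ _ (quot _ _ _ _ gy fx x0) (@chartoo_continuous _)).
apply: near_eq_cvg; apply: filterS (near0 _ _ fx x0) => t t0.
by rewrite /= of_hom_chartoo.
Qed.

End SphereCharts.

(** * The Moebius coordinate of the three punctures *)

(** Rational identities for the cross-ratio, stated for abstract variables in
   place of brackets and affine forms. *)
Section FieldIdentities.
Variable F : fieldType.
Implicit Types (A B P Q U V c u x : F).

Lemma cross_ratio_value c u P U V : c != 0 -> (2 : F) != 0 ->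
  P != 0 -> U != 0 -> V != 0 ->
  2 * (c * ((u + 1) * P * V)) * U / (c * (2 * P * U) * V) - 1 = u.
Proof. by move=> *; field; do ?[apply/andP; split]. Qed.

Lemma cross_ratio_scale c A P U V : c != 0 -> P != 0 -> V != 0 ->
  2 * (c * A) * U / (c * P * V) - 1 = 2 * A * U / (P * V) - 1.
Proof. by move=> *; field; do ?[apply/andP; split]. Qed.

Lemma cross_ratio_eq A B P Q U V : (2 : F) != 0 -> U != 0 -> V != 0 ->
  P != 0 -> Q != 0 ->
  2 * A * U / (P * V) = 2 * B * U / (Q * V) -> A * Q = B * P.
Proof.
move=> t2 u0 v0 p0 q0 E; have h : 2 * U / V != 0 by rewrite !mulf_neq0 // invr_eq0.
apply: (mulfI h); have := congr1 (fun x => x * (P * Q)) E.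
have -> : 2 * A * U / (P * V) * (P * Q) = 2 * U / V * (A * Q).
  by field; do ?[apply/andP; split].
by have -> : 2 * B * U / (Q * V) * (P * Q) = 2 * U / V * (B * P);
   first by field; do ?[apply/andP; split].
Qed.

Lemma cross_ratio_unit U V : U != 0 -> V != 0 -> 2 * V * U / (U * V) - 1 = 1.
Proof. by move=> *; field; do ?[apply/andP; split]. Qed.

Lemma cross_ratio_derive A B P Q U V : P != 0 -> V != 0 ->
  2 * U / V * (B * P^-1 + A * (- Q / P ^+ 2)) =
  2 * U * (B * P - A * Q) / (P ^+ 2 * V).
Proof. by move=> *; field; do ?[apply/andP; split]. Qed.

Lemma cross_ratio_assoc A P U V : P != 0 -> V != 0 ->
  2 * U / V * (A * P^-1) - 1 = 2 * A * U / (P * V) - 1.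
Proof. by move=> *; field; do ?[apply/andP; split]. Qed.

(** Here L_i is an affine form in the chart variable, A_i its slope, and the
    Wronskian A_i L_j - L_i A_j is the constant s w_ij.  The left-hand side is the
    derivative of the coordinate, divided by its distance to a finite puncture; the
    right-hand side is the logarithmic derivative of L_i / L_2. *)
Lemma cross_ratio_dlog0 s A0 A2 L0 L2 U W V : (2 : F) != 0 -> s != 0 ->
  U != 0 -> V != 0 -> L0 != 0 -> L2 != 0 -> A0 * L2 - L0 * A2 = s * W ->
  2 * U * (A0 * L2 - L0 * A2) / (L2 ^+ 2 * V) / (2 * L0 * U / (L2 * V) - 1 + 1) =
  A0 / L0 - A2 / L2.
Proof. by move=> *; rewrite subrK; field; do ?[apply/andP; split]. Qed.

Lemma cross_ratio_dlog1 s A0 A1 A2 L0 L1 L2 w02 w12 w10 : (2 : F) != 0 -> s != 0 ->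
  w02 != 0 -> w12 != 0 -> w10 != 0 -> L0 != 0 -> L1 != 0 -> L2 != 0 ->
  A0 * L2 - L0 * A2 = s * w02 -> A1 * L2 - L1 * A2 = s * w12 ->
  L0 * w12 - L1 * w02 = L2 * w10 ->
  2 * w12 * (A0 * L2 - L0 * A2) / (L2 ^+ 2 * w10) / (2 * L0 * w12 / (L2 * w10) - 1 - 1) =
  A1 / L1 - A2 / L2.
Proof.
move=> t2 s0 h02 h12 h10 l0 l1 l2 E0 E1 E2.
have -> : 2 * L0 * w12 / (L2 * w10) - 1 - 1 = 2 * L1 * w02 / (L2 * w10).
  have -> : 2 * L0 * w12 / (L2 * w10) - 1 - 1 = 2 * (L0 * w12 - L2 * w10) / (L2 * w10).
    by field; do ?[apply/andP; split].
  by rewrite -E2 opprB subrKC mulrA.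
have -> : A1 / L1 - A2 / L2 = (A1 * L2 - L1 * A2) / (L1 * L2).
  by field; do ?[apply/andP; split].
by rewrite E0 E1; field; do ?[apply/andP; split].
Qed.

Lemma cross_ratio_shift A P U V : P != 0 -> V != 0 ->
  (2 * A * U + 2 * P * V) / (P * V) - 1 = 1 + 2 * U / V * (A / P).
Proof. by move=> *; field; do ?[apply/andP; split]. Qed.

Lemma cross_ratio_assoc0 A P U V : P != 0 -> V != 0 ->
  2 * A * U / (P * V) = 2 * U / V * (A / P).
Proof. by move=> *; field; do ?[apply/andP; split]. Qed.

End FieldIdentities.

Section Mobius.
Variable R : realType.
Local Notation C := R[i].
Local Notation sphere := (sphere R).
Local Notation pole := (@pole R).
Implicit Types (z w u x y : C) (p q : sphere) (T k : bool).
Variable a : 'I_3 -> sphere.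
Hypothesis a_inj : injective a.

Definition a0 : sphere := a (inord 0).
Definition a1 : sphere := a (inord 1).
Definition a2 : sphere := a (inord 2).
(** The puncture with coordinate [pole T]. *)
Definition aT T := if T then a1 else a0.

Lemma a_cases p : range a p <-> [\/ p = a0, p = a1 | p = a2].
Proof.
split=> [[[[|[|[|]]] // H] _ <-]|[->|->|->]]; try by eexists.
- by constructor 1; congr a; apply/val_inj; rewrite /= inordK.
- by constructor 2; congr a; apply/val_inj; rewrite /= inordK.
- by constructor 3; congr a; apply/val_inj; rewrite /= inordK.
Qed.

Lemma bracket_a i j : (i < 3)%N -> (j < 3)%N -> i != j ->
  bracket (a (inord i)) (a (inord j)) != 0.
Proof.
move=> i3 j3 ij; rewrite bracket_eq0 (inj_eq a_inj) -(inj_eq val_inj) /=.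
by rewrite !inordK.
Qed.

Lemma b10 : bracket a1 a0 != 0. Proof. exact: bracket_a. Qed.
Lemma b02 : bracket a0 a2 != 0. Proof. exact: bracket_a. Qed.
Lemma b12 : bracket a1 a2 != 0. Proof. exact: bracket_a. Qed.

(** The cross-ratio that takes the values -1, 1 and infinity at a0, a1 and a2.
    Its value at a2 itself is meaningless. *)
Definition zeta p : C := 2 * bracket p a0 * bracket a1 a2 / (bracket p a2 * bracket a1 a0) - 1.

Definition zeta_inv_x u := (u + 1) * bracket a0 a2 * hom_x a1 - (u - 1) * bracket a1
  a2 * hom_x a0.
Definition zeta_inv_y u := (u + 1) * bracket a0 a2 * hom_y a1 - (u - 1) * bracket a1
  a2 * hom_y a0.
Definition zeta_inv u : sphere := of_hom (zeta_inv_x u) (zeta_inv_y u).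

Lemma two_neq0 : (2 : C) != 0. Proof. by rewrite pnatr_eq0. Qed.

Lemma zeta_inv_bracket u p : zeta_inv_x u * hom_y p - zeta_inv_y u * hom_x p =
  (u + 1) * bracket a0 a2 * bracket a1 p - (u - 1) * bracket a1 a2 * bracket a0 p.
Proof. rewrite /zeta_inv_x /zeta_inv_y /bracket; ring. Qed.

Lemma zeta_inv_neq0 u : (zeta_inv_x u != 0) || (zeta_inv_y u != 0).
Proof.
rewrite -negb_and; apply/negP => /andP[/eqP hX /eqP hY].
have := zeta_inv_bracket u a2; rewrite hX hY !mul0r subrr => /esym/eqP.
have -> : (u + 1) * bracket a0 a2 * bracket a1 a2 - (u - 1) * bracket a1 a2 * bracket a0 a2
  = 2 * bracket a0 a2 * bracket a1 a2 by ring.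
by rewrite !mulf_eq0 (negPf two_neq0) (negPf b02) (negPf b12).
Qed.

Lemma bracket_of_hom x y : (x != 0) || (y != 0) -> exists2 c, c != 0 &
  forall p, bracket (of_hom x y) p = c * (x * hom_y p - y * hom_x p).
Proof.
rewrite /of_hom /bracket; have [->|y0] := eqVneq y 0.
  rewrite orbF => x0; exists x^-1; first by rewrite invr_eq0.
  by move=> p /=; rewrite !mul0r !subr0 mulrA mulVf // mul1r mulrC.
move=> _; exists y^-1; first by rewrite invr_eq0.
by move=> p /=; rewrite mul1r mulrBr !mulrA mulVf // mul1r [x / y]mulrC.
Qed.

Lemma zeta_invK u : zeta (zeta_inv u) = u.
Proof.
have [c c0 cE] := bracket_of_hom (zeta_inv_neq0 u).
rewrite /zeta /zeta_inv !cE !zeta_inv_bracket.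
have -> : bracket a0 a0 = 0 by rewrite /bracket; ring.
rewrite (_ : (u + 1) * bracket a0 a2 * bracket a1 a2 - (u - 1) * bracket a1 a2 * bracket a0 a2
  = 2 * bracket a0 a2 * bracket a1 a2); last by ring.
rewrite mulr0 subr0; exact: cross_ratio_value c0 two_neq0 b02 b12 b10.
Qed.

Lemma zeta_inv_neq2 u : zeta_inv u != a2.
Proof.
have [c c0 cE] := bracket_of_hom (zeta_inv_neq0 u).
rewrite -bracket_eq0 cE zeta_inv_bracket.
rewrite (_ : (u + 1) * bracket a0 a2 * bracket a1 a2 - (u - 1) * bracket a1 a2 * bracket a0 a2
  = 2 * bracket a0 a2 * bracket a1 a2); last by ring.
by rewrite !mulf_neq0 ?two_neq0 ?b02 ?b12.
Qed.

(** Equality of the cross-ratios gives [p a0][q a2] = [q a0][p a2], and by the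
    Pluecker relation the difference of the two sides is [p q][a0 a2]. *)
Lemma zeta_inj p q : p != a2 -> q != a2 -> zeta p = zeta q -> p = q.
Proof.
rewrite -!bracket_eq0 => p2 q2 /(congr1 (fun x => x + 1)); rewrite !subrK => E.
apply/eqP; rewrite -bracket_eq0.
have E2 : bracket p a0 * bracket q a2 = bracket q a0 * bracket p a2.
  exact: cross_ratio_eq two_neq0 b12 b10 p2 q2 E.
have : bracket p q * bracket a0 a2 = 0.
  have -> : bracket p q * bracket a0 a2 = bracket p a0 * bracket q a2 - bracket q a0
    * bracket p a2 by rewrite /bracket; ring.
  by rewrite E2 subrr.
by move=> /eqP; rewrite mulf_eq0 (negPf b02) orbF.
Qed.

Lemma zetaK p : p != a2 -> zeta_inv (zeta p) = p.
Proof. by move=> p2; apply: zeta_inj => //; [exact: zeta_inv_neq2|rewrite zeta_invK]. Qed.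

Lemma zeta_aT T : zeta (aT T) = pole T.
Proof.
rewrite /zeta; case: T; rewrite /aT /pole /sg.
  by rewrite rmorph1 (cross_ratio_unit b12 b10).
have -> : bracket a0 a0 = 0 by rewrite /bracket; ring.
by rewrite mulr0 !mul0r sub0r rmorphN1.
Qed.

Lemma aT_neq2 T : aT T != a2.
Proof. by rewrite -bracket_eq0; case: T; [exact: b12|exact: b02]. Qed.

Lemma not_puncture p : ~ range a p <-> p != a2 /\ forall T, zeta p != pole T.
Proof.
split=> [nD|[p2 pT] /a_cases[E|E|E]].
- split; first by apply/eqP => E; apply: nD; apply/a_cases; constructor 3.
  move=> T; apply/eqP; rewrite -zeta_aT => E; apply: (nD); apply/a_cases.
  suff -> : p = aT T by case: T {E}; [constructor 2|constructor 1].
  apply: zeta_inj => //; last exact: aT_neq2.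
  by apply/eqP => E2; apply: nD; apply/a_cases; constructor 3.
- by have := pT false; rewrite E -(zeta_aT false) eqxx.
- by have := pT true; rewrite E -(zeta_aT true) eqxx.
- by rewrite E eqxx in p2.
Qed.

Lemma lin2_continuous (P Q S U : C) : continuous (fun u : C => (u + 1) * P * Q - (u -
  1) * S * U).
Proof.
have -> : (fun u : C => (u + 1) * P * Q - (u - 1) * S * U) =
    (fun u => (P * Q - S * U) * u + (P * Q + S * U)) by apply/funext => u; ring.
move=> u.
have H := is_deriveD (is_deriveZ (P * Q - S * U) (is_derive_id u (1 : C)))
  (is_derive_cst (P * Q + S * U) u (1 : C)).
exact: (derive_continuous H).
Qed.

Lemma zeta_inv_continuous : continuous zeta_inv.
Proof.
move=> u.
exact: (@of_hom_continuous R C (nbhs u) (nbhs_filter u) zeta_inv_x zeta_inv_y _ _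
  (@lin2_continuous (bracket a0 a2) (hom_x a1) (bracket a1 a2) (hom_x a0) u)
  (@lin2_continuous (bracket a0 a2) (hom_y a1) (bracket a1 a2) (hom_y a0) u)
    (zeta_inv_neq0 u)).
Qed.

(** Both charts at once.  In the chart variable x, the bracket with a point p is,
    up to a nonzero factor, the affine form [lin k p x], which vanishes exactly
    at p. *)
Definition chart k x : sphere := if k then chart0 x else chartoo x.
Definition slope k p : C := if k then hom_y p else - hom_x p.
Definition intercept k p : C := if k then - hom_x p else hom_y p.
Definition lin k p x : C := slope k p * x + intercept k p.

Lemma bracket_chart k x : exists2 c, c != 0 & forall p, bracket (chart k x) p = c * lin k p x.
Proof.
rewrite /lin /slope /intercept; case: k; first by exists 1; rewrite ?oner_neq0 // =>
  p; rewrite /bracket /=; ring.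
rewrite /chart /chartoo; have [->|x0] := eqVneq x 0.
  by exists 1; rewrite ?oner_neq0 // => p; rewrite /bracket /=; ring.
exists x^-1; rewrite ?invr_eq0 // => p; rewrite /bracket /=.
by rewrite mulrDr mulNr mulrN mulrCA mulVf // mulr1 mul1r addrC.
Qed.

Lemma lin_eq0 k p x : (lin k p x == 0) = (chart k x == p).
Proof. by have [c c0 cE] := bracket_chart k x; rewrite -bracket_eq0 cE mulf_eq0
  (negPf c0). Qed.

Lemma zeta_chart k x : lin k a2 x != 0 ->
  zeta (chart k x) = 2 * lin k a0 x * bracket a1 a2 / (lin k a2 x * bracket a1 a0) - 1.
Proof.
have [c c0 cE] := bracket_chart k x => l2; rewrite /zeta !cE.
exact: cross_ratio_scale c0 l2 b10.
Qed.

Lemma lin_derive k p x : is_derive x (1 : C) (lin k p) (slope k p).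
Proof.
have H := is_deriveD (is_deriveZ (slope k p) (is_derive_id x (1 : C))) (is_derive_cst
  (intercept k p) x (1 : C)).
by rewrite [_ *: 1]mulr1 addr0 in H; exact: H.
Qed.

Lemma lin_near k p x : lin k p x != 0 -> \forall y \near x, lin k p y != 0.
Proof.
move=> l0; have := derive_continuous (lin_derive k p x).
by move=> H; exact: (H _ (near_neq0 l0)).
Qed.

(** The pullback of du/(u - pole T) to the chart k: it is the logarithmic
    differential of the quotient of the forms vanishing at [aT T] and at a2, and
    in this form it makes sense also at infinity. *)
Definition dlog k T x : C := slope k (aT T) / lin k (aT T) x - slope k a2 / lin k a2 x.

Definition dzeta k x : C :=
  2 * bracket a1 a2 * (slope k a0 * lin k a2 x - lin k a0 x * slope k a2) /
  (lin k a2 x ^+ 2 * bracket a1 a0).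

Lemma zeta_derive k x : lin k a2 x != 0 ->
  is_derive x (1 : C) (fun y => zeta (chart k y)) (dzeta k x).
Proof.
move=> l2.
have D0 := lin_derive k a0 x.
have D2 := is_derive_inv l2 (lin_derive k a2 x).
pose c : C := 2 * bracket a1 a2 / bracket a1 a0.
pose h y : C := lin k a0 y * (lin k a2 y)^-1.
pose dh : C := slope k a0 * (lin k a2 x)^-1 + lin k a0 x * (- slope k a2 / lin k a2 x ^+ 2).
have Dh : is_derive x (1 : C) h dh := is_derive_scale D0 D2.
have Dg : is_derive x (1 : C) (fun y : C => c * h y - 1) (c * dh).
  have H : is_derive x (1 : C) (fun y : C => c * h y) (0 * h x + c * dh) :=
    is_derive_scale (is_derive_cst c x (1 : C)) Dh.
  rewrite mul0r add0r in H.
  have H2 := is_deriveB H (is_derive_cst (1 : C) x (1 : C)).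
  by rewrite subr0 in H2; exact: H2.
have -> : dzeta k x = c * dh.
  apply/esym; exact: cross_ratio_derive l2 b10.
have E : \forall y \near x, c * h y - 1 = zeta (chart k y).
  apply: filterS (lin_near l2) => y y2; rewrite (zeta_chart y2).
  exact: cross_ratio_assoc y2 b10.
by move: Dg; apply: near_eq_is_derive.
Qed.

Lemma dzeta_dlog k T x :
  lin k a0 x != 0 -> lin k a1 x != 0 -> lin k a2 x != 0 ->
  dzeta k x / (zeta (chart k x) - pole T) = dlog k T x.
Proof.
move=> l0 l1 l2; rewrite (zeta_chart l2) /dzeta /dlog.
have v0 := b10; have v1 := b12; have v2 := b02; have t2 := two_neq0.
pose sgC (k : bool) : C := if k then 1 else -1.
have s0 : sgC k != 0 by rewrite /sgC; case: (k); rewrite ?oppr_eq0 oner_neq0.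
have w02 : slope k a0 * lin k a2 x - lin k a0 x * slope k a2 = sgC k * bracket a0 a2.
  by rewrite /lin /slope /intercept /bracket /sgC; case: (k); ring.
have w12 : slope k a1 * lin k a2 x - lin k a1 x * slope k a2 = sgC k * bracket a1 a2.
  by rewrite /lin /slope /intercept /bracket /sgC; case: (k); ring.
have pl : lin k a0 x * bracket a1 a2 - lin k a1 x * bracket a0 a2 = lin k a2 x * bracket a1 a0.
  by rewrite /lin /slope /intercept /bracket; case: (k); ring.
rewrite /pole /sg; case: T.
  by rewrite rmorph1; apply: (cross_ratio_dlog1 t2 s0 v2 v1 v0 l0 l1 l2 w02 w12 pl).
rewrite rmorphN1 opprK.
exact: (cross_ratio_dlog0 t2 s0 v1 v0 l0 l2 w02).
Qed.

End Mobius.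

Lemma dlog_glue_id (F : fieldType) (w X0 Y0 X2 Y2 : F) : w != 0 ->
  - X0 * w + Y0 != 0 -> - X2 * w + Y2 != 0 ->
  - X0 / (- X0 * w + Y0) - - X2 / (- X2 * w + Y2) =
  - w ^- 2 * (Y0 / (Y0 * w^-1 + - X0) - Y2 / (Y2 * w^-1 + - X2)).
Proof.
move=> w0 h0 h2.
have e0 : Y0 * w^-1 + - X0 = w^-1 * (- X0 * w + Y0) by field.
have e2 : Y2 * w^-1 + - X2 = w^-1 * (- X2 * w + Y2) by field.
rewrite e0 e2; move: h0 h2; set L0 := - X0 * w + Y0; set L2 := - X2 * w + Y2.
move=> h0 h2.
have -> : Y0 = L0 + X0 * w by rewrite /L0; ring.
have -> : Y2 = L2 + X2 * w by rewrite /L2; ring.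
by move: L0 L2 h0 h2 {e0 e2} => L0 L2 h0 h2; field; do ?[apply/andP; split].
Qed.

(** * The Fuchsian system on the sphere *)

Section FuchsianSystem.
Variable R : realType.
Local Notation C := R[i].
Local Notation sphere := (sphere R).
Local Notation pole := (@pole R).
Local Notation sheet := (@sheet R).
Implicit Types (z w u x y : C) (p q : sphere) (T k e : bool).
Variable a : 'I_3 -> sphere.
Hypothesis a_inj : injective a.
Local Notation zeta := (zeta a).
Local Notation a0 := (a0 a).
Local Notation a1 := (a1 a).
Local Notation a2 := (a2 a).
Local Notation aT := (aT a).
Local Notation dlog := (dlog a).
Variables (n : nat) (B : bool -> 'M[C]_n).

Definition cform k x : 'M[C]_n := \sum_(T : bool) dlog k T x *: B T.

Lemma not_puncture_lin k x : ~ range a (chart k x) <->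
  [/\ lin k a0 x != 0, lin k a1 x != 0 & lin k a2 x != 0].
Proof.
rewrite !lin_eq0; split=> [nD|[h0 h1 h2] /a_cases[]]; try exact/eqP.
by split; apply/eqP => E; apply: nD; apply/a_cases; [constructor 1|constructor
  2|constructor 3].
Qed.

Lemma not_puncture_near k x : ~ range a (chart k x) ->
  \forall y \near x, ~ range a (chart k y).
Proof.
move=> /not_puncture_lin[h0 h1 h2].
by apply: filterS3 (lin_near h0) (lin_near h1) (lin_near h2) => y *; apply/not_puncture_lin.
Qed.

Lemma cform_glue w : w != 0 -> ~ range a (chartoo w) ->
  cform false w = - w ^- 2 *: cform true w^-1.
Proof.
move=> w0 /(@not_puncture_lin false)[h0 h1 h2].
rewrite /cform scaler_sumr; apply: eq_bigr => T _; rewrite scalerA; congr (_ *: _).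
have hT : lin false (aT T) w != 0 by case: T.
exact: dlog_glue_id w0 hT h2.
Qed.

Lemma lin_quot_derive k p x : lin k p x != 0 ->
  exists d : C, is_derive x (1 : C) (fun y => slope k p / lin k p y) d.
Proof.
move=> l0; have H : is_derive x (1 : C) (fun y => slope k p / lin k p y) _ :=
  is_derive_scale (is_derive_cst (slope k p) x (1 : C)) (is_derive_inv l0 (lin_derive k p x)).
by eexists; exact: H.
Qed.

Lemma holomorphic_sum (f : bool -> C -> C) z :
  (forall T, \forall x \near z, exists d : C, is_derive x (1 : C) (f T) d) ->
  holomorphic_at (fun x => \sum_(T : bool) f T x *: B T) z.
Proof.
move=> hf; rewrite /holomorphic_at.
apply: filterS2 (hf true) (hf false) => x [d1 h1] [d0 h0].
have H : is_derive x (1 : C) (fun x => \sum_(T : bool) f T x *: B T)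
   (\sum_(T : bool) (if T then d1 else d0) *: B T).
  apply: is_derive_bigsum => T.
  have hT : is_derive x (1 : C) (f T) (if T then d1 else d0) by case: T.
  have H := is_derive_scale hT (is_derive_cst (B T) x (1 : C)).
  by rewrite scaler0 addr0 in H; exact: H.
exact: ex_derive.
Qed.

Lemma cform_holomorphic k x : ~ range a (chart k x) -> holomorphic_at (cform k) x.
Proof.
move=> nD; apply: holomorphic_sum => T; apply: filterS (not_puncture_near nD) => y
  /not_puncture_lin[h0 h1 h2].
have hT : lin k (aT T) y != 0 by case: T.
have [d1 D1] := lin_quot_derive hT; have [d2 D2] := lin_quot_derive h2.
by exists (d1 - d2); exact: is_deriveB.
Qed.

(** If the form vanishes at z, the quotient is exactly 1/(x - z); otherwise it is
    holomorphic at z. *)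
Lemma lin_quot_pole k p z : exists2 psi : C -> C,
  \forall x \near z, exists d : C, is_derive x (1 : C) psi d &
  \forall x \near z, x != z -> slope k p / lin k p x = (x - z)^-1 * psi x.
Proof.
have [l0|l0] := eqVneq (lin k p z) 0.
  have linE x : lin k p x = slope k p * (x - z).
    by rewrite mulrBr -[LHS]subr0 -l0 /lin; ring.
  have al0 : slope k p != 0.
    apply/eqP => h; have := l0; rewrite /lin h mul0r add0r; move: h.
    rewrite /slope /intercept; case: k {l0 linE}; case: p => [q|] /= /eqP h /eqP;
      move: h; rewrite ?oppr_eq0 ?oner_eq0 //.
  exists (fun=> 1); first by apply: (@filterE _ (nbhs z) (nbhs_filter z)) => x;
    exists 0; exact: is_derive_cst.
  apply: (@filterE _ (nbhs z) (nbhs_filter z)) => x xz; rewrite linE mulr1 invfM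
    mulrA mulfV ?mul1r //.
exists (fun x => (x - z) * (slope k p / lin k p x)).
  apply: filterS (lin_near l0) => x /lin_quot_derive[d D].
  have H := is_deriveB (is_derive_id x (1 : C)) (is_derive_cst z x (1 : C)).
  have H2 : is_derive x (1 : C) (fun x => (x - z) * (slope k p / lin k p x)) _ :=
    is_derive_scale H D.
  by eexists; exact: H2.
by apply: (@filterE _ (nbhs z) (nbhs_filter z)) => x xz; rewrite mulKf // subr_eq0.
Qed.

Lemma cform_log k z : log_pole_at (cform k) z.
Proof.
have [p0 h0 E0] := lin_quot_pole k a0 z.
have [p1 h1 E1] := lin_quot_pole k a1 z.
have [p2 h2 E2] := lin_quot_pole k a2 z.
exists (fun x => \sum_(T : bool) ((if T then p1 else p0) x - p2 x) *: B T).
  apply: holomorphic_sum => T.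
  have hT : \forall x \near z, exists d : C, is_derive x (1 : C) (if T then p1 else p0) d.
    by case: T.
  apply: filterS2 hT h2 => x [d1 D1] [d2 D2].
  by exists (d1 - d2); exact: is_deriveB.
apply: filterS3 E0 E1 E2 => x e0 e1 e2 xz.
rewrite /cform scaler_sumr; apply: eq_bigr => T _; rewrite scalerA; congr (_ *: _).
by rewrite mulrBr /dlog -(e2 xz); case: T; rewrite ?(e0 xz) ?(e1 xz).
Qed.

Definition fuchsian_system : log_connection (range a) n :=
  @LogConnection R (range a) n (cform true) (cform false) cform_glue
    (@cform_holomorphic true) (@cform_holomorphic false)
    (fun z _ => cform_log true z) (fun z _ => cform_log false z).

Definition sheet_points e : set sphere := [set p | ~ range a p /\ sheet e (zeta p)].

Lemma zeta_chart_continuous k x : ~ range a (chart k x) ->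
  {for x, continuous (fun y => zeta (chart k y))}.
Proof.
by move=> /not_puncture_lin[_ _ h2]; exact: derive_continuous (zeta_derive a_inj h2).
Qed.

Lemma sphere_nbhs p (A : set sphere) :
  (forall k x, p = chart k x -> nbhs x (chart k @^-1` A)) -> nbhs p A.
Proof.
move=> h; have [[z pz]|poo] := chart_cases p.
  by rewrite pz; apply/nbhs_chart0; exact: (h true).
by rewrite poo; apply/nbhs_chartoo; exact: (h false).
Qed.

Lemma sheet_points_open e : open (sheet_points e).
Proof.
rewrite openE => p [nD Se]; apply: sphere_nbhs => k x pE; subst p.
have H : \forall y \near x, sheet e (zeta (chart k y)).
  apply: (zeta_chart_continuous nD (t := sheet e)).
  by apply: open_nbhs_nbhs; split=> //; exact: sheet_open.
by apply: filterS2 (not_puncture_near nD) H => y.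
Qed.

Variable Y : bool -> C -> 'M[C]_n.
Hypothesis dY : forall e u, sheet e u ->
  is_derive u (1 : C) (Y e) (- (dlog_form B u *m Y e u)).

Lemma chart_section_derive k e x (c : 'cV[C]_n) : sheet_points e (chart k x) ->
  is_derive x (1 : C) (fun y => Y e (zeta (chart k y)) *m c)
    (- (cform k x *m (Y e (zeta (chart k x)) *m c))).
Proof.
move=> [/not_puncture_lin[h0 h1 h2] Se].
have D := is_derive_chain (zeta_derive a_inj h2) (dY Se).
have H := is_derive_mulmxr c D.
suff E : - (cform k x *m (Y e (zeta (chart k x)) *m c)) =
    dzeta a k x *: - (dlog_form B (zeta (chart k x)) *m Y e (zeta (chart k x))) *m c.
  by rewrite E; exact: H.
rewrite scalerN mulNmx mulmxA; congr (- _); rewrite scalemxAl; congr (_ *m _ *m _).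
rewrite /cform /dlog_form scaler_sumr; apply: eq_bigr => T _.
by rewrite scalerA dzeta_dlog.
Qed.

(** By the chain rule, since the pullback of the form du/(u - pole T) is
    [dlog]. *)
Lemma sheet_horizontal e (c : 'cV[C]_n) :
  horizontal fuchsian_system (sheet_points e) (fun p => Y e (zeta p) *m c).
Proof.
split; first by move=> p [].
- move=> z Uz; exact: (@chart_section_derive true e z c Uz).
- move=> w Uw; exact: (@chart_section_derive false e w c Uw).
Qed.

End FuchsianSystem.

(** * The plane coordinate near a puncture *)

Section LocalCoordinates.
Variable R : realType.
Local Notation C := R[i].
Local Notation sphere := (sphere R).
Local Notation pole := (@pole R).
Local Notation sheet := (@sheet R).
Implicit Types (z w u x y : C) (p q : sphere) (T k e : bool) (j : option bool).
Variable a : 'I_3 -> sphere.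
Hypothesis a_inj : injective a.
Local Notation zeta := (zeta a).
Local Notation zeta_inv := (zeta_inv a).
Local Notation a0 := (a0 a).
Local Notation a1 := (a1 a).
Local Notation a2 := (a2 a).
Local Notation aT := (aT a).

(** The punctures are indexed by [option bool], with [None] for the third one. *)
Definition puncture j : sphere := if j is Some T then aT T else a2.

(** The point of the plane at local parameter y near the puncture j.  The third
    puncture is approached by the points -1 + 1/y; it is zeta + 1 that is a plain
    quotient of two affine forms. *)
Definition plane_coord j y : C := if j is Some T then pole T + y else pole false + y^-1.

(** The value of the local parameter at which the reference circle around a
    puncture starts.  Around a finite puncture this circle has radius 1 and starts
    at 0; around the third one it has radius 4 about -1 in the plane, enough to
    surround both finite punctures, and starts at 3. *)
Definition circle_scale j : C := if j is Some T then - pole T else 4^-1.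

(** A uniform description of the coordinate centred at p: a translate of one of
    the charts, in which the affine forms are still affine. *)
Lemma coord_chart p : exists k (c0 : C), [/\ slope k p != 0,
  forall w, Defs.coord p w = chart k (c0 + w),
  forall w q, lin k q (c0 + w) = lin k q c0 + slope k q * w &
  forall q, (lin k q c0 == 0) = (p == q)].
Proof.
case: p => [z|].
  exists true, z; split=> //; first by rewrite /= oner_eq0.
    by move=> w q; rewrite /lin; ring.
  by move=> q; rewrite lin_eq0.
exists false, 0; split=> //; first by rewrite /= oppr_eq0 oner_eq0.
- by move=> w; rewrite add0r.
- by move=> w q; rewrite /lin; ring.
- by move=> q; rewrite lin_eq0 /= chartoo0.
Qed.

Definition zscale T : C := 2 * bracket (if T then a0 else a1) a2 / bracket a1 a0.

Lemma zscale_neq0 T : zscale T != 0.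
Proof.
by rewrite /zscale !mulf_neq0 ?invr_eq0 ?two_neq0 ?b10 //; case: T; rewrite ?b02 ?b12.
Qed.

Lemma zeta_pole_chart k T x : lin k a2 x != 0 ->
  zeta (chart k x) = pole T + zscale T * (lin k (aT T) x / lin k a2 x).
Proof.
move=> l2; rewrite zeta_chart // /zscale /pole /sg; case: T => /=.
  rewrite rmorph1.
  have pl : lin k a0 x * bracket a1 a2 = lin k a1 x * bracket a0 a2 + lin k a2 x *
    bracket a1 a0.
    by rewrite /lin /slope /intercept /bracket; case: (k); ring.
  have -> : 2 * lin k a0 x * bracket a1 a2 = 2 * lin k a1 x * bracket a0 a2 + 2 * lin
    k a2 x * bracket a1 a0.
    by rewrite -!mulrA -mulrDr pl.
  by apply: cross_ratio_shift l2 (b10 a_inj).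
rewrite rmorphN1 addrC; congr (_ + _); exact: cross_ratio_assoc0 l2 (b10 a_inj).
Qed.

Lemma one_sub_neq0 (x : C) : cabs x < 1 -> 1 - x != 0.
Proof. by move=> h; rewrite subr_eq0; apply: contraTneq h => <-; rewrite cabs1 ltxx. Qed.

(** Both the chart coordinate w and the local parameter y vanish at the puncture,
    and they are related by a Moebius map, hence y = lam w / (1 - c w). *)
Lemma local_coord j : exists lam c : C, lam != 0 /\
  forall w, w != 0 -> cabs (c * w) < 1 ->
    Defs.coord (puncture j) w != a2 /\ zeta (Defs.coord (puncture j) w) = plane_coord
      j (lam * w / (1 - c * w)).
Proof.
have [k [c0 [al0 cE linE lin0]]] := coord_chart (puncture j).
have linP w : lin k (puncture j) (c0 + w) = slope k (puncture j) * w.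
  have /eqP L0 : lin k (puncture j) c0 == 0 by rewrite lin0.
  by rewrite linE L0 add0r.
case: j al0 cE linP lin0 => [T|] /= al0 cE linP lin0.
  have L2 : lin k a2 c0 != 0 by rewrite lin0 aT_neq2.
  exists (zscale T * slope k (aT T) / lin k a2 c0), (- slope k a2 / lin k a2 c0).
  split; first by rewrite mulf_neq0 ?invr_eq0 // mulf_neq0 // zscale_neq0.
  move=> w w0 /one_sub_neq0 h.
  have l2E : lin k a2 (c0 + w) = lin k a2 c0 * (1 - - slope k a2 / lin k a2 c0 * w).
    by rewrite linE mulrBr mulr1 mulrA mulrCA mulfV // mulr1 mulNr opprK.
  have l2 : lin k a2 (c0 + w) != 0 by rewrite l2E mulf_neq0.
  split; first by rewrite cE -lin_eq0.
  rewrite cE (zeta_pole_chart T l2) linP; congr (_ + _).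
  rewrite l2E; set Q := 1 - _; rewrite (invfM _ Q); ring.
have L0 : lin k a0 c0 != 0 by rewrite lin0 eq_sym (aT_neq2 a_inj false).
exists (slope k a2 / (zscale false * lin k a0 c0)), (- slope k a0 / lin k a0 c0).
split; first by rewrite mulf_neq0 // invr_eq0 mulf_neq0 // zscale_neq0.
move=> w w0 /one_sub_neq0 h.
have l2 : lin k a2 (c0 + w) != 0 by rewrite linP mulf_neq0.
have l0E : lin k a0 (c0 + w) = lin k a0 c0 * (1 - - slope k a0 / lin k a0 c0 * w).
  by rewrite linE mulrBr mulr1 mulrA mulrCA mulfV // mulr1 mulNr opprK.
split; first by rewrite cE -lin_eq0.
rewrite cE (zeta_pole_chart false l2) linP; congr (_ + _).
rewrite l0E; set Q := 1 - _.
by rewrite invf_div (invfM (slope k a2)) (invfM (_ / _) w) invf_div; ring.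
Qed.

Lemma pole_gap T y : pole T + y != pole T -> cabs y < 2 -> pole T + y != pole (~~ T).
Proof.
move=> _; apply: contraTneq => E.
have -> : y = pole (~~ T) - pole T by rewrite -E addrAC subrr add0r.
by rewrite -rmorphB cabs_real; case: T {E}; rewrite /sg /= -leNgt;
   [rewrite ler0_norm|rewrite ger0_norm]; lra.
Qed.

Lemma cabs_circle_scale j : cabs (circle_scale j) = if j is Some _ then 1 else 4^-1.
Proof.
case: j => [T|] /=; first by rewrite cabsN cabs_real; case: T; rewrite /sg ?normrN normr1.
by rewrite cabsV -[4]/(4%:R) -(rmorph_nat (real_complex R)) cabs_real normr_nat.
Qed.

Lemma plane_coord_neq j y T : y != 0 -> cabs y <= cabs (circle_scale j) ->
  plane_coord j y != pole T.
Proof.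
move=> y0; rewrite cabs_circle_scale; case: j => [S|] /= yk.
  have h : pole S + y != pole S by rewrite -subr_eq0 addrAC subrr add0r.
  have [->//|TS] := eqVneq T S.
  have -> : T = ~~ S by case: T S TS {h} => -[].
  by apply: pole_gap => //; lra.
have [->|TS] := eqVneq T false.
  by rewrite -subr_eq0 addrAC subrr add0r invr_eq0.
have -> : T = true by case: T TS.
rewrite -subr_eq0; apply/eqP => /eqP.
rewrite addrAC addrC addr_eq0 opprB -rmorphB => /eqP E.
have := congr1 (@cabs R) E; rewrite cabsV cabs_real /sg.
have yp : 0 < cabs y by rewrite cabs_gt0.
rewrite ger0_norm => [E2|]; last lra.
have : cabs y * (cabs y)^-1 = 1 by rewrite mulfV // gt_eqF.
rewrite E2; lra.
Qed.

Lemma zeta_for_continuous p : ~ range a p -> zeta q @[q --> p] --> zeta p.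
Proof.
move=> nD A hA; suff: nbhs p (zeta @^-1` A) by [].
apply: (@sphere_nbhs R p (zeta @^-1` A)) => k x pE; subst p.
exact: (zeta_chart_continuous a_inj nD hA).
Qed.

End LocalCoordinates.

(** * The punctured sphere as the punctured plane *)

Section PuncturedPlane.
Variable R : realType.
Local Notation C := R[i].
Local Notation sphere := (sphere R).
Local Notation pole := (@pole R).
Local Notation sheet := (@sheet R).
Variable a : 'I_3 -> sphere.
Hypothesis a_inj : injective a.
Local Notation X := (punctured (range a)).
Variable b : X.

(** The inverse of the coordinate, with values in the subtype of the punctured
    sphere; the base point b is the junk value at the punctures. *)
Definition of_plane (u : C) : X :=
  match pselect (~ range a (zeta_inv a u)) with
  | left H => @exist _ (fun x => x \in ~` range a) (zeta_inv a u) (mem_set H)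
  | right _ => b
  end.

Definition to_plane (x : X) : C := zeta a (set_val x).

Lemma valX (x : X) : ~ range a (set_val x).
Proof. by have := set_valP x. Qed.

Lemma to_plane_neq x T : to_plane x != pole T.
Proof. by have [_] := (not_puncture a_inj _).1 (@valX x). Qed.

Lemma of_plane_val u : (forall T, u != pole T) -> set_val (of_plane u) = zeta_inv a u.
Proof.
move=> hu; rewrite /of_plane; case: pselect => [H|[]]; first by rewrite set_valE.
by apply/not_puncture => //; rewrite zeta_inv_neq2 // zeta_invK.
Qed.

Lemma to_plane_of_plane u : (forall T, u != pole T) -> to_plane (of_plane u) = u.
Proof. by move=> hu; rewrite /to_plane of_plane_val // zeta_invK. Qed.

Lemma of_plane_to_plane x : of_plane (to_plane x) = x.
Proof.
apply: val_inj; have := of_plane_val (to_plane_neq x); rewrite set_valE /= => ->.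
by rewrite zetaK //; have [] := (not_puncture a_inj _).1 (@valX x).
Qed.

Lemma to_plane_continuous : continuous to_plane.
Proof.
move=> x; have c : set_val y @[y --> x] --> set_val x by exact: initial_continuous.
exact: (cvg_comp _ _ c (zeta_for_continuous a_inj (@valX x))).
Qed.

Lemma of_plane_continuous (T : topologicalType) (g : T -> C) : continuous g ->
  (forall t S, g t != pole S) -> continuous (fun t => of_plane (g t)).
Proof.
move=> cg hg; apply: continuous_comp_initial => t.
rewrite (_ : _ \o _ = (fun t => zeta_inv a (g t))); last first.
  by apply/funext => s; rewrite /= of_plane_val.
exact: (cvg_comp _ _ (cg t) (zeta_inv_continuous a_inj (x := g t))).
Qed.

End PuncturedPlane.

(** * Homotopies of paths *)

(* Declared for rewriting with homotopies inside concatenations. *)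
#[export] Instance homotopic_equivalence (R : realType) (X : topologicalType) (x y : X) :
  RelationClasses.Equivalence (@homotopic R X x y).
Proof.
split; [exact: homotopic_refl|exact: homotopic_sym|].
by move=> p q r; exact: homotopic_trans.
Qed.

#[export] Instance concat_morphism (R : realType) (X : topologicalType) (x y z : X) :
  Morphisms.Proper (Morphisms.respectful (@homotopic R X x y)
    (Morphisms.respectful (@homotopic R X y z) (@homotopic R X x z)))
    (@concat R X x y z).
Proof. by move=> p p' hp q q' hq; exact: concat_homotopic. Qed.

#[export] Instance reverse_morphism (R : realType) (X : topologicalType) (x y : X) :
  Morphisms.Proper (Morphisms.respectful (@homotopic R X x y) (@homotopic R X y x))
    (@reverse R X x y).
Proof. by move=> p p' hp; exact: reverse_homotopic. Qed.

#[export] Hint Resolve homotopic_refl : core.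

Section GroupoidLaws.
Variables (R : realType) (X : topologicalType).
Local Notation I := (unit_itv R).
Local Notation "p ~~> q" := (homotopic p q) (at level 70).
Local Infix "@@" := (@concat R X _ _ _) (at level 50, left associativity).

Lemma homotopic_eq (x y : X) (p q : {path I from x to y in X}) :
  (forall t, p t = q t) -> homotopic p q.
Proof.
move=> pq; apply: (@homotopic_reparam R X x y x y q p q id id) => //.
- exact: id_continuous.
- exact: id_continuous.
- by move=> t; rewrite itv_valK.
- by move=> t; rewrite itv_valK.
Qed.

Lemma concatA (w x y z : X) (p : {path I from w to x in X})
    (q : {path I from x to y in X}) (r : {path I from y to z in X}) :
  homotopic ((p @@ q) @@ r) (p @@ (q @@ r)).
Proof. by symmetry; exact: concat_assoc. Qed.

Lemma concatKr (x y z : X) (p : {path I from x to y in X}) (q : {path I from x to z in X}) :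
  homotopic (p @@ (reverse p @@ q)) q.
Proof.
by rewrite -concatA concat_reverse_r concat_const_l.
Qed.

Lemma concatKVr (x y z : X) (p : {path I from y to x in X}) (q : {path I from x to z in X}) :
  homotopic (reverse p @@ (p @@ q)) q.
Proof. by rewrite -concatA concat_reverse_l concat_const_l. Qed.

End GroupoidLaws.

Lemma continuous_ext (T U : topologicalType) (f g : T -> U) :
  continuous f -> f =1 g -> continuous g.
Proof. by move=> cf /funext <-. Qed.

(** * Paths in star-shaped regions *)

Section StarPaths.
Variable R : realType.
Local Notation C := R[i].
Local Notation sphere := (sphere R).
Local Notation pole := (@pole R).
Local Notation sheet := (@sheet R).
Local Notation I := (unit_itv R).
Local Infix "@@" := (@concat R _ _ _ _) (at level 50, left associativity).
Variable a : 'I_3 -> sphere.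
Hypothesis a_inj : injective a.
Local Notation X := (punctured (range a)).
Variable b : X.
Local Notation of_plane := (of_plane (a := a) b).
Local Notation to_plane := (to_plane (a := a)).
Implicit Types (x y z : X).

Definition within (S : set C) x y (p : {path I from x to y in X}) :=
  forall t, S (to_plane (p t)).

Variables (S : set C) (c : C).
Hypotheses (starS : star c S) (avoidS : forall u T, S u -> u != pole T).

(** The factor by which the contraction scales towards the centre c.  It is 1 at
    the ends t = 0 and t = 1, which therefore stay in place, and at s = 1 it is 0
    for t in the middle third. *)
Definition contraction_factor (s t : R) : R := Num.max (1 - s) (Num.max (1 - 3 * t)
  (3 * t - 2)).

Lemma contraction_factor01 s t : 0 <= s <= 1 -> 0 <= t <= 1 -> 0 <=
  contraction_factor s t <= 1.
Proof.
move=> /andP[s0 s1] /andP[t0 t1]; rewrite /contraction_factor; apply/andP; split.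
  by rewrite le_max subr_ge0 s1.
by rewrite !ge_max; apply/and3P; split; lra.
Qed.

Lemma clamp_ge1 t : 1 <= t -> clamp t = one :> I.
Proof.
move=> t1; apply: itv_val_inj; rewrite itv_val1 /itv_val /clamp set_valE /=.
by rewrite min_l ?max_r ?ler01.
Qed.

Lemma clamp_le0 t : t <= 0 -> clamp t = zero :> I.
Proof.
move=> t0; apply: itv_val_inj; rewrite itv_val0 /itv_val /clamp set_valE /=.
by rewrite max_l // ge_min t0 orbT.
Qed.

Lemma contraction_factor_start s : 0 <= s -> contraction_factor s 0 = 1.
Proof.
move=> s0; apply/eqP; rewrite eq_le /contraction_factor !ge_max !le_max mulr0 subr0
  sub0r lexx orbT andbT /=.
by apply/andP; split; lra.
Qed.

Lemma contraction_factor_end s : 0 <= s -> contraction_factor s 1 = 1.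
Proof.
move=> s0; apply/eqP; rewrite eq_le /contraction_factor !ge_max !le_max; apply/andP; split.
  by apply/and3P; split; lra.
by do 2 (apply/orP; right); lra.
Qed.

Lemma itv01 (t : I) : 0 <= itv_val t <= 1.
Proof. by rewrite itv_val_ge0 itv_val_le1. Qed.

Lemma contraction_factor_continuous (T : topologicalType) (f g : T -> R) :
  continuous f -> continuous g -> continuous (fun t => contraction_factor (f t) (g t)).
Proof.
move=> cf cg; apply: max_fun_continuous.
  apply: (continuous_ext (@affine_continuous R T f (-1) 1 cf)) => t.
  by rewrite mulN1r addrC.
apply: max_fun_continuous; last exact: affine_continuous.
by apply: (continuous_ext (@affine_continuous R T g (-3) 1 cg)) => t; rewrite mulNr addrC.
Qed.

(** While s grows, p is run through in a shrinking part of the parameter interval,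
    at s = 1 in the middle third, where the factor is 0.  The final path goes from
    x straight to c, rests there, and goes straight to y: it no longer depends on
    p. *)
Definition contract x y (p : {path I from x to y in X}) (z : I * I) : X :=
  let s := itv_val z.1 in let t := itv_val z.2 in
  of_plane (c + (contraction_factor s t)%:C%C * (to_plane (p (clamp ((1 + 2 * s) * t
    - s))) - c)).

Section Contract.
Variables (x y : X) (p : {path I from x to y in X}).
Hypothesis Sp : within S p.

Lemma contract_in (z : I * I) :
  S (c + (contraction_factor (itv_val z.1) (itv_val z.2))%:C%C *
     (to_plane (p (clamp ((1 + 2 * itv_val z.1) * itv_val z.2 - itv_val z.1))) - c)).
Proof. by apply: starS; [exact: Sp|exact: contraction_factor01 (itv01 _) (itv01 _)]. Qed.

Lemma contract_continuous : continuous (contract p).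
Proof.
apply: of_plane_continuous => [//||z T]; last exact/avoidS/contract_in.
have c1 : continuous (fun z : I * I => itv_val z.1).
  exact: comp_continuous (@fst_continuous _ _) (@itv_val_continuous R).
have c2 : continuous (fun z : I * I => itv_val z.2).
  exact: comp_continuous (@snd_continuous _ _) (@itv_val_continuous R).
have cmu := contraction_factor_continuous c1 c2.
have ctau : continuous (fun z : I * I => (1 + 2 * itv_val z.1) * itv_val z.2 - itv_val z.1).
  move=> z; apply: cvgB; last exact: c1.
  apply: cvgM; last exact: c2.
  by apply: cvgD; [exact: cvg_cst|apply: cvgM; [exact: cvg_cst|exact: c1]].
have cz : continuous (fun z : I * I =>
    to_plane (p (clamp ((1 + 2 * itv_val z.1) * itv_val z.2 - itv_val z.1)))).
  have c3 := comp_continuous ctau (@ext_continuous R X x y p).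
  exact: (comp_continuous c3 (to_plane_continuous a_inj)).
have cr := comp_continuous cmu (@real_complex_continuous R).
move=> z; apply: (@cvgD _ C _ (nbhs z) (nbhs_filter z) (fun=> c)); first exact: cvg_cst.
apply: (@cvgM _ _ (nbhs z) (nbhs_filter z) _ _ _ _ (cr z)).
apply: (@cvgB _ C _ (nbhs z) (nbhs_filter z) _ (fun=> c)); first exact: cz.
exact: cvg_cst.
Qed.

Lemma contract_start t : contract p (zero, t) = p t.
Proof.
have /andP[t0 t1] := itv01 t.
rewrite /contract /= itv_val0 mulr0 addr0 mul1r subr0 itv_valK /contraction_factor subr0.
rewrite max_l ?rmorph1 ?mul1r ?subrKC ?of_plane_to_plane //.
by rewrite ge_max; apply/andP; split; lra.
Qed.

Lemma contract_ends s : contract p (s, zero) = x /\ contract p (s, one) = y.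
Proof.
have /andP[s0 s1] := itv01 s.
rewrite /contract /= !itv_val0 !itv_val1; split.
  rewrite mulr0 sub0r (@contraction_factor_start (itv_val s)) // rmorph1 mul1r subrKC.
  by rewrite clamp_le0 ?oppr_le0 // path_zero of_plane_to_plane.
rewrite mulr1 (@contraction_factor_end (itv_val s)) // rmorph1 mul1r subrKC.
by rewrite clamp_ge1 ?path_one ?of_plane_to_plane //; lra.
Qed.

End Contract.

Lemma contract_end x y (p q : {path I from x to y in X}) t :
  contract p (one, t) = contract q (one, t).
Proof.
rewrite /contract /= itv_val1; have /andP[t0 t1] := itv01 t.
set u := itv_val t in t0 t1 *.
have [h1|h1] := lerP u 3^-1.
  by rewrite clamp_le0 ?path_zero //; lra.
have [h2|h2] := lerP (2 / 3) u.
  by rewrite clamp_ge1 ?path_one //; lra.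
have -> : contraction_factor 1 u = 0.
  by rewrite /contraction_factor subrr max_l // ge_max; apply/andP; split; lra.
by rewrite !mul0r.
Qed.

(** Both paths contract to the same broken line through the centre. *)
Lemma star_homotopic x y (p q : {path I from x to y in X}) :
  within S p -> within S q -> homotopic p q.
Proof.
move=> Sp Sq.
have cr : continuous (fun t : I => contract p (one, t)).
  apply: comp_continuous (contract_continuous Sp).
  by apply: pair_continuous; [exact: cst_continuous|exact: id_continuous].
pose r : {path I from x to y in X} :=
  mk_path cr (contract_ends p one).1 (contract_ends p one).2.
transitivity r.
  exists (contract p); split=> //.
  - exact: contract_continuous.
  - exact: contract_start.
  - exact: contract_ends.
symmetry; exists (contract q); split=> //.
- exact: contract_continuous.
- exact: contract_start.
- by move=> t; exact: contract_end.
- exact: contract_ends.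
Qed.

Lemma edge_exists x y : S (to_plane x) -> S (to_plane y) ->
  exists p : {path I from x to y in X}, within S p.
Proof.
move=> Sx Sy.
pose g (t : R) : C := if t <= 2^-1 then c + (1 - 2 * t)%:C%C * (to_plane x - c)
                      else c + (2 * t - 1)%:C%C * (to_plane y - c).
have gS t : 0 <= t <= 1 -> S (g t).
  move=> /andP[t0 t1]; rewrite /g; case: ifPn => h; apply: starS => //.
    by apply/andP; split; lra.
  by rewrite -ltNge in h; apply/andP; split; lra.
have cg : continuous g.
  have ch (A B : R) (w : C) : continuous (fun t : R => c + (A * t + B)%:C%C * w).
    have ca := @affine_continuous R _ id A B (@id_continuous R).
    have cr := comp_continuous ca (@real_complex_continuous R).
    move=> t; apply: (@cvgD _ C _ (nbhs t) (nbhs_filter t) (fun=> c)); first exact: cvg_cst.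
    exact: (@cvgM _ _ (nbhs t) (nbhs_filter t) _ (fun=> w) _ _ (cr t) (cvg_cst _)).
  apply: paste_continuous (@id_continuous _) _ _ _.
  - apply: (continuous_ext (ch (-2) 1 (to_plane x - c))) => t /=.
    by rewrite mulNr addrC [in RHS]addrC; congr (_%:C%C * _ + _); rewrite addrC.
  - exact: (ch 2 (-1) (to_plane y - c)).
  - by move=> t ->; rewrite mulfV ?pnatr_eq0 // subrr !rmorph0 !mul0r.
have ci := comp_continuous (@itv_val_continuous R) cg.
have cp : continuous (fun t : I => of_plane (g (itv_val t))).
  by apply: of_plane_continuous ci _ => // t T; exact/avoidS/gS/itv01.
have p0 : of_plane (g (itv_val (zero : I))) = x.
  rewrite itv_val0 /g invr_ge0 ler0n mulr0 subr0 rmorph1 mul1r subrKC.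
  exact: of_plane_to_plane.
have p1 : of_plane (g (itv_val (one : I))) = y.
  rewrite itv_val1 /g ifF; last by apply/negbTE; rewrite -ltNge; lra.
  have -> : 2 * 1 - 1 = 1 :> R by lra.
  by rewrite rmorph1 mul1r subrKC; exact: of_plane_to_plane.
exists (mk_path cp p0 p1) => t /=.
rewrite to_plane_of_plane //; first exact/gS/itv01.
by move=> T; exact/avoidS/gS/itv01.
Qed.

End StarPaths.

Lemma within_concat (R : realType) (a : 'I_3 -> sphere R) (S : set R[i])
    (x y z : punctured (range a))
    (p : {path (unit_itv R) from x to y in punctured (range a)})
    (q : {path (unit_itv R) from y to z in punctured (range a)}) :
  within S p -> within S q -> within S (concat p q).
Proof. by move=> Sp Sq t; rewrite concatE /concat_fun; case: ifP. Qed.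

Lemma within_reverse (R : realType) (a : 'I_3 -> sphere R) (S : set R[i])
    (x y : punctured (range a))
    (p : {path (unit_itv R) from x to y in punctured (range a)}) :
  within S p -> within S (reverse p).
Proof. by move=> Sp t; rewrite reverseE. Qed.

Lemma within_sub (R : realType) (a : 'I_3 -> sphere R) (S S' : set R[i])
    (x y : punctured (range a))
    (p : {path (unit_itv R) from x to y in punctured (range a)}) :
  S `<=` S' -> within S p -> within S' p.
Proof. by move=> SS Sp t; exact: SS. Qed.

(** * Free homotopies of loops *)

Section FreeHomotopy.
Variables (R : realType) (X : topologicalType).
Local Notation I := (unit_itv R).
Local Infix "@@" := (@concat R _ _ _ _) (at level 50, left associativity).

Definition free_homotopic (f g : I -> X) :=
  exists H : I * I -> X,
    [/\ continuous H, forall t, H (zero, t) = f t, forall t, H (one, t) = g t &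
        forall s, H (s, zero) = H (s, one)].

Lemma free_homotopic_trans g f h :
  free_homotopic f g -> free_homotopic g h -> free_homotopic f h.
Proof.
move=> [K [cK K0 K1 Ke]] [L [cL L0 L1 Le]].
have c1 : continuous (fun z : I * I => itv_val z.1).
  exact: comp_continuous (@fst_continuous _ _) (@itv_val_continuous R).
have cc (c d : R) : continuous (fun z : I * I => (clamp (c * itv_val z.1 + d) : I, z.2)).
  apply: pair_continuous; last exact: snd_continuous.
  exact: comp_continuous (@affine_continuous R _ _ c d c1) (@clamp_continuous R).
exists (fun z => if itv_val z.1 <= 2^-1 then K (clamp (2 * itv_val z.1 + 0), z.2)
                 else L (clamp (2 * itv_val z.1 + -1), z.2)); split.
- apply: paste_continuous c1 _ _ _.
  + exact: comp_continuous (cc 2 0) cK.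
  + exact: comp_continuous (cc 2 (-1)) cL.
  + move=> [s t] /= ->; rewrite mulfV ?pnatr_eq0 // addr0 subrr clamp0 clamp1.
    by rewrite K1 L0.
- by move=> t /=; rewrite itv_val0 invr_ge0 ler0n mulr0 addr0 clamp0 K0.
- move=> t /=; rewrite itv_val1 ifF; last by apply/negbTE; rewrite -ltNge; lra.
  by rewrite (_ : 2 * 1 + -1 = 1 :> R) ?clamp1 ?L1 //; lra.
- by move=> s /=; case: ifP => _; [exact: Ke|exact: Le].
Qed.

(** Lay eta, kappa and the reverse of eta end to end as a path W on [0, 3]; kappa
    occupies [1, 2].  The parameter moves linearly from phi, which runs through
    all of [0, 3], to the map onto [1, 2].  At each stage the ends lie symmetrically
    about 3/2, where W takes equal values. *)
Lemma conjugate_free_homotopic (x y : X) (eta : {path I from x to y in X})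
    (kappa : {path I from y to y in X}) :
  free_homotopic (eta @@ kappa @@ reverse eta) kappa.
Proof.
pose W (r : R) : X := if r <= 1 then eta (clamp (1 * r + 0)) else
  if r <= 2 then kappa (clamp (1 * r + -1)) else eta (clamp (-1 * r + 3)).
have cW : continuous W.
  have aff (c d : R) : continuous (fun r : R => c * r + d).
    exact: @affine_continuous R _ id c d (@id_continuous R).
  apply: paste_continuous (@id_continuous _) _ _ _.
  - exact: comp_continuous (aff 1 0) (@ext_continuous R X x y eta).
  - apply: paste_continuous (@id_continuous _) _ _ _.
    + exact: comp_continuous (aff 1 (-1)) (@ext_continuous R X y y kappa).
    + exact: comp_continuous (aff (-1) 3) (@ext_continuous R X x y eta).
    + move=> r ->; rewrite (_ : 1 * 2 + -1 = 1 :> R); last by lra.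
      rewrite (_ : -1 * 2 + 3 = 1 :> R); last by lra.
      by rewrite !clamp1 !path_one.
  - move=> r ->; rewrite ifT; last by lra.
    rewrite mulr1 addr0 subrr clamp0 clamp1.
    by rewrite path_zero path_one.
pose phi (t : R) : R := Num.min (4 * t + 0) (2 * t + 1).
have cphi : continuous phi.
  by apply: min_fun_continuous; exact: (@affine_continuous R _ id _ _ (@id_continuous R)).
exists (fun z => W ((1 - itv_val z.1) * phi (itv_val z.2) + itv_val z.1 * (1 + itv_val z.2))).
have c1 : continuous (fun z : I * I => itv_val z.1).
  exact: comp_continuous (@fst_continuous _ _) (@itv_val_continuous R).
have c2 : continuous (fun z : I * I => itv_val z.2).
  exact: comp_continuous (@snd_continuous _ _) (@itv_val_continuous R).
split=> /=.
- apply: comp_continuous cW => z; apply: cvgD; apply: cvgM.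
  + by apply: cvgB; [exact: cvg_cst|exact: c1].
  + exact: (comp_continuous c2 cphi).
  + exact: c1.
  + by apply: cvgD; [exact: cvg_cst|exact: c2].
- move=> t; have /andP[t0 t1] := itv01 t.
  rewrite itv_val0 subr0 mul1r mul0r addr0 concatE /concat_fun.
  set u := itv_val t in t0 t1 *; rewrite /phi.
  have [h|h] := lerP u 2^-1.
    rewrite min_l; last by lra.
    rewrite concatE clampK; last by lra.
    rewrite /W /concat_fun; have [h'|h'] := lerP (4 * u + 0) 1.
      rewrite ifT; last by lra.
      by congr (eta (clamp _)); lra.
    rewrite ifT; last by lra.
    rewrite ifF; last by apply/negbTE; rewrite -ltNge; lra.
    by congr (kappa (clamp _)); lra.
  rewrite min_r; last by lra.
  rewrite reverseE clampK; last by lra.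
  rewrite /W ifF; last by apply/negbTE; rewrite -ltNge; lra.
  rewrite ifF; last by apply/negbTE; rewrite -ltNge; lra.
  by congr (eta (clamp _)); lra.
- move=> t; have /andP[t0 t1] := itv01 t.
  rewrite itv_val1 subrr mul0r add0r mul1r /W.
  have [h|h] := lerP (1 + itv_val t) 1.
    have -> : t = zero by apply: itv_val_inj; rewrite itv_val0; lra.
    rewrite itv_val0 clamp_ge1 ?path_one ?path_zero //; lra.
  rewrite ifT; last by lra.
  by rewrite (_ : 1 * (1 + itv_val t) + -1 = itv_val t) ?itv_valK //; lra.
- move=> s; have /andP[s0 s1] := itv01 s.
  rewrite itv_val0 itv_val1 /phi min_l; last by lra.
  rewrite min_r; last by lra.
  set u := itv_val s in s0 s1 *.
  rewrite /W ifT; last by lra.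
  have [h|h] := lerP ((1 - u) * (2 * 1 + 1) + u * (1 + 1)) 1; first by exfalso; lra.
  have [h2|h2] := lerP ((1 - u) * (2 * 1 + 1) + u * (1 + 1)) 2.
    rewrite clamp_ge1 ?path_one; last by lra.
    by rewrite clamp_ge1 ?path_one //; lra.
  by congr (eta (clamp _)); lra.
Qed.

End FreeHomotopy.

(** * Loops around the punctures *)

(** Evaluates the homotopy of [circle_coordinate] at time 1. *)
Lemma rotation_scale (F : fieldType) (l r k ka lam e : F) :
  l != 0 -> k != 0 -> ka != 0 ->
  l * r * k^-1 * ka * (lam * k / (l * ka)) * e = lam * (r * e).
Proof. by move=> *; field; do ?[apply/andP; split]. Qed.

Section ComplexContinuity.
Variables (R : realType) (T : topologicalType).
Local Notation C := R[i].
Implicit Types f g : T -> C.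

Lemma mulC_continuous f g : continuous f -> continuous g ->
  continuous (fun t => f t * g t).
Proof. by move=> cf cg t; exact: (@cvgM C T (nbhs t) (nbhs_filter t) _ _ _ _ (cf t)
  (cg t)). Qed.

Lemma addC_continuous f g : continuous f -> continuous g ->
  continuous (fun t => f t + g t).
Proof. by move=> cf cg t; exact: (@cvgD C C T (nbhs t) (nbhs_filter t) _ _ _ _ (cf t)
  (cg t)). Qed.

Lemma subC_continuous f g : continuous f -> continuous g ->
  continuous (fun t => f t - g t).
Proof. by move=> cf cg t; exact: (@cvgB C C T (nbhs t) (nbhs_filter t) _ _ _ _ (cf t)
  (cg t)). Qed.

Lemma invC_continuous f : continuous f -> (forall t, f t != 0) ->
  continuous (fun t => (f t)^-1).
Proof. by move=> cf f0 t; exact: (cvg_comp _ _ (cf t) (inv_continuous (f0 t))). Qed.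

Lemma realC_continuous (f : T -> R) : continuous f -> continuous (fun t => (f t)%:C%C).
Proof. by move=> cf; exact: comp_continuous cf (@real_complex_continuous R). Qed.

Lemma circle_continuous (f : T -> R) (r : R) : continuous f ->
  continuous (fun t => circle r (f t)).
Proof.
move=> cf t; apply: (cvg_complex (nbhs_filter t)).
  apply: (@cvgM R T (nbhs t) (nbhs_filter t) (fun=> r)); first exact: cvg_cst.
  have c2 : 2 * pi * f s @[s --> t] --> 2 * pi * f t.
    by apply: (@cvgM R T (nbhs t) (nbhs_filter t) (fun=> 2 * pi)); [exact: cvg_cst|exact: cf].
  exact: (cvg_comp _ _ c2 (@continuous_cos R _)).
apply: (@cvgM R T (nbhs t) (nbhs_filter t) (fun=> r)); first exact: cvg_cst.
have c2 : 2 * pi * f s @[s --> t] --> 2 * pi * f t.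
  by apply: (@cvgM R T (nbhs t) (nbhs_filter t) (fun=> 2 * pi)); [exact: cvg_cst|exact: cf].
exact: (cvg_comp _ _ c2 (@continuous_sin R _)).
Qed.

Lemma plane_coord_continuous j f : continuous f -> (forall t, f t != 0) ->
  continuous (fun t => plane_coord j (f t)).
Proof.
move=> cf f0; case: j => [S|]; apply: addC_continuous.
- exact: cst_continuous.
- exact: cf.
- exact: cst_continuous.
- exact: invC_continuous.
Qed.

End ComplexContinuity.

Section Circles.
Variable R : realType.
Local Notation C := R[i].
Local Notation I := (unit_itv R).
Local Notation pole := (@pole R).

Lemma circleE (r t : R) : circle r t = r%:C%C * circle 1 t.
Proof. by apply/eqP; rewrite eq_complex /circle /=; apply/andP; split; apply/eqP; ring. Qed.

Lemma cabs_circle t : cabs (circle 1 t : C) = 1.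
Proof.
by rewrite /cabs normc_def /circle /= !mul1r cos2Dsin2 sqrtr1.
Qed.

Lemma circle_neq0 t : circle (1 : R) t != 0.
Proof. by rewrite -cabs_gt0 cabs_circle. Qed.

Lemma circle_period : circle (1 : R) 1 = circle 1 0.
Proof.
by rewrite /circle !mulr1 !mulr0 cos0 sin0 -[2 * pi]add0r mulr_natl
   cosD2pi sinD2pi cos0 sin0.
Qed.

Lemma sqrt_right (x : C) : exists2 m : C, m ^+ 2 = x & 0 <= Re m.
Proof.
have [h|h] := lerP 0 (Re (sqrtC x)).
  by exists (sqrtC x) => //; rewrite sqrtCK.
exists (- sqrtC x); first by rewrite sqrrN sqrtCK.
by rewrite raddfN oppr_ge0 ltW.
Qed.

Lemma cabs_sqr1 (m : C) : cabs (m ^+ 2) = 1 -> cabs m = 1.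
Proof.
rewrite expr2 cabsM => h; have := cabs_ge0 m; set x := cabs m in h *.
move=> x0; have xx : (x - 1) * (x + 1) = x * x - 1 by ring.
have : (x - 1) * (x + 1) = 0 by rewrite xx h subrr.
by move=> /eqP; rewrite mulf_eq0 => /orP[/eqP|/eqP]; lra.
Qed.

Variable a : 'I_3 -> sphere R.
Hypothesis a_inj : injective a.
Local Notation X := (punctured (range a)).
Variable b : X.
Local Notation of_plane := (of_plane (a := a) b).

Definition puncture_circle j (t : R) : C := plane_coord j (circle_scale R j * circle 1 t).

Lemma circle_scale_neq0 j : circle_scale R j != 0.
Proof. by rewrite -cabs_gt0 cabs_circle_scale; case: j => [_|]; rewrite ?invr_gt0. Qed.

Lemma puncture_circle_neq j t T : puncture_circle j t != pole T.
Proof.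
apply: plane_coord_neq; first by rewrite mulf_neq0 ?circle_scale_neq0 ?circle_neq0.
by rewrite cabsM cabs_circle mulr1.
Qed.

Lemma puncture_circle_continuous j (T : topologicalType) (f : T -> R) : continuous f ->
  continuous (fun t => puncture_circle j (f t)).
Proof.
move=> cf; apply: plane_coord_continuous => [|t].
  by apply: mulC_continuous; [exact: cst_continuous|exact: circle_continuous].
by rewrite mulf_neq0 ?circle_scale_neq0 ?circle_neq0.
Qed.

(** The reference circle around the puncture in the plane has to be deformed to
    the small circle in the chart coordinate w that the notion of a loop around a
    puncture is based on.  In the local parameter y these are
    ka e(t) and lam r e(t) / (1 - c r e(t)).  The homotopy shrinks the radius,
    switches on c, and turns the direction of ka into that of lam.  For the last
    one the unit number chi = lam |ka| / (|lam| ka) is written as m^2 with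
    Re m >= 0: the segment from 1 to m then avoids 0, and squaring it connects 1
    to chi.  All the curves stay in the disc |y| <= |ka|, where y = 0 is the only
    puncture. *)
Lemma circle_coordinate j : exists r : R, [/\ 0 < r,
  forall w : C, w != 0 -> `|w| <= r%:C%C -> ~ range a (Defs.coord (puncture a j) w) &
  exists2 g : I -> X, free_homotopic (fun t => of_plane (puncture_circle j (itv_val t))) g &
    forall t, set_val (g t) = Defs.coord (puncture a j) (circle r (itv_val t))].
Proof.
have [lam [c [lam0 hlam]]] := local_coord a_inj j.
set ka := circle_scale R j; have ka0 : ka != 0 := circle_scale_neq0 j.
pose K := cabs ka; have K0 : 0 < K by rewrite cabs_gt0.
have L0 : 0 < cabs lam by rewrite cabs_gt0.
have c0 := cabs_ge0 c.
(* The first bound keeps 1 - c w away from 0, the second one the curves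
   inside the disc. *)
have [r [r0 cr lr]] : exists r : R, [/\ 0 < r, cabs c * r <= 2^-1 & cabs lam * r <= K / 2].
  pose r1 := (2 * (cabs c + 1))^-1; pose r2 := K / (2 * cabs lam).
  have r10 : 0 < r1 by rewrite invr_gt0; lra.
  have r20 : 0 < r2 by rewrite divr_gt0 // mulr_gt0.
  exists (Num.min r1 r2); split; first by rewrite lt_min r10.
    have h : Num.min r1 r2 <= r1 by rewrite ge_min lexx.
    apply: le_trans (_ : cabs c * r1 <= _); first by rewrite ler_wpM2l.
    by rewrite /r1 ler_pdivrMr; lra.
  have h : Num.min r1 r2 <= r2 by rewrite ge_min lexx orbT.
  apply: le_trans (_ : cabs lam * r2 <= _); first by rewrite ler_wpM2l // cabs_ge0.
  by rewrite /r2 mulrA ler_pdivrMr ?mulr_gt0 //; lra.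
have small w : cabs w <= r -> cabs (c * w) <= 2^-1.
  by move=> wr; rewrite cabsM; apply: le_trans cr; rewrite ler_wpM2l.
have coordN w : w != 0 -> cabs w <= r -> ~ range a (Defs.coord (puncture a j) w).
  move=> w0 wr; have cw := small w wr.
  have [|h2 hz] := hlam w w0; first by lra.
  apply/(not_puncture a_inj); split=> // T; rewrite hz.
  have d0 : 1 - c * w != 0 by apply: one_sub_neq0; lra.
  apply: plane_coord_neq; first by rewrite !mulf_neq0 ?invr_eq0.
  rewrite -/K cabsM cabsV ler_pdivrMr ?cabs_gt0 // cabsM.
  have h1 : cabs lam * cabs w <= K / 2 by apply: le_trans lr; rewrite ler_wpM2l // ltW.
  have h3 : 1 <= cabs (1 - c * w) + cabs (c * w).
    by rewrite -{1}(cabs1 R) -{1}(subrK (c * w) 1); exact: cabsD.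
  nra.
exists r; split=> // [w w0 wr|].
  by apply: coordN => //; rewrite -lecR -cabsE.
pose chi := lam * K%:C%C / ((cabs lam)%:C%C * ka).
have Kc : K%:C%C != 0 :> C by rewrite -cabs_gt0 cabs_real gtr0_norm.
have Lc : (cabs lam)%:C%C != 0 :> C by rewrite -cabs_gt0 cabs_real gtr0_norm.
have chi1 : cabs chi = 1.
  rewrite /chi !cabsM cabsV cabsM !cabs_real !gtr0_norm // -/K mulfV //.
  by rewrite gt_eqF // mulr_gt0.
have [m mE m0] := sqrt_right chi.
have m1 : cabs m = 1 by apply: cabs_sqr1; rewrite mE.
pose ms (s : R) : C := (1 - s)%:C%C + s%:C%C * m.
have ms0 s : 0 <= s <= 1 -> ms s != 0.
  move=> /andP[s0 s1]; have [->|sn1] := eqVneq s 1.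
    by rewrite /ms subrr rmorph0 rmorph1 mul1r add0r -cabs_gt0 m1.
  have : 0 < Re (ms s).
    have h : s < 1 by rewrite lt_neqAle sn1.
    have -> : Re (ms s) = (1 - s) + s * Re m.
      by rewrite /ms; case: (m) => x y /=; rewrite mul0r subr0.
    have : 0 <= s * Re m by rewrite mulr_ge0.
    lra.
  by apply: contraTneq => ->; rewrite ltxx.
have ms1 s : 0 <= s <= 1 -> cabs (ms s) <= 1.
  move=> /andP[s0 s1]; apply: le_trans (cabsD _ _) _.
  by rewrite cabsM !cabs_real m1 mulr1 !ger0_norm ?subr_ge0 //; lra.
pose eps := cabs lam * r / K.
have eps0 : 0 < eps by rewrite divr_gt0 // mulr_gt0.
have eps1 : eps <= 2^-1 by rewrite ler_pdivrMr //; lra.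
pose y (s t : R) : C := ((1 - s) + s * eps)%:C%C * ka * ms s ^+ 2 * circle 1 t /
  (1 - s%:C%C * (c * circle r t)).
have cwr t : cabs (c * circle r t) <= 2^-1.
  by apply: small; rewrite circleE cabsM cabs_circle mulr1 cabs_real gtr0_norm.
have den0 s t : 0 <= s <= 1 -> 1 - s%:C%C * (c * circle r t) != 0.
  move=> /andP[s0 s1]; apply: one_sub_neq0; rewrite cabsM cabs_real ger0_norm //.
  have := cwr t; have := cabs_ge0 (c * circle r t); nra.
have y0 s t : 0 <= s <= 1 -> y s t != 0.
  move=> s01; rewrite /y mulf_neq0 ?invr_eq0 ?den0 // mulf_neq0 ?circle_neq0 //.
  rewrite mulf_neq0 ?expf_neq0 ?ms0 // mulf_neq0 //.
  have /andP[s0' s1'] := s01.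
  rewrite -cabs_gt0 cabs_real normr_gt0 gt_eqF //.
  have [->|sn] := eqVneq s 0; first by rewrite subr0 mul0r addr0.
  have : 0 < s * eps by rewrite mulr_gt0 // lt_neqAle eq_sym sn.
  lra.
have yK s t : 0 <= s <= 1 -> cabs (y s t) <= K.
  move=> s01; have /andP[s0' s1'] := s01.
  rewrite /y cabsM cabsV ler_pdivrMr ?cabs_gt0 ?den0 //.
  rewrite !cabsM cabs_circle mulr1 cabs_real -/K.
  have e1 : 0 <= 1 - s + s * eps.
    have : 0 <= s * eps by rewrite mulr_ge0 // ltW.
    lra.
  rewrite ger0_norm //.
  have h3 : 1 <= cabs (1 - s%:C%C * (c * circle r t)) + cabs (s%:C%C * (c * circle r t)).
    by rewrite -{1}(cabs1 R) -{1}(subrK (s%:C%C * (c * circle r t)) 1); exact: cabsD.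
  have h4 : cabs (s%:C%C * (c * circle r t)) <= s * 2^-1.
    by rewrite cabsM cabs_real ger0_norm // ler_wpM2l.
  have h5 : cabs (ms s) * cabs (ms s) <= 1.
    have := ms1 s s01; have := cabs_ge0 (ms s); nra.
  have h6 : s * eps <= s * 2^-1 by rewrite ler_wpM2l.
  have h7 : 1 - s + s * eps <= cabs (1 - s%:C%C * (c * circle r t)) by lra.
  rewrite mulrAC; apply: le_trans (_ : (1 - s + s * eps) * 1 * K <= _).
    by rewrite ler_wpM2r ?(ltW K0) // ler_wpM2l.
  by rewrite mulr1 mulrC ler_wpM2l // ltW.
pose Hf (z : I * I) := of_plane (plane_coord j (y (itv_val z.1) (itv_val z.2))).
have uyN s t T : 0 <= s <= 1 -> plane_coord j (y s t) != pole T.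
  by move=> s01; apply: plane_coord_neq; [exact: y0|exact: yK].
have cH : continuous Hf.
  have c1 : continuous (fun z : I * I => itv_val z.1).
    exact: comp_continuous (@fst_continuous _ _) (@itv_val_continuous R).
  have c2 : continuous (fun z : I * I => itv_val z.2).
    exact: comp_continuous (@snd_continuous _ _) (@itv_val_continuous R).
  have cst (d : C) : continuous (fun _ : I * I => d) by exact: cst_continuous.
  apply: (of_plane_continuous a_inj) => [|z T]; last by apply: uyN; exact: itv01.
  apply: plane_coord_continuous => [|z]; last by apply: y0; exact: itv01.
  have cms : continuous (fun z : I * I => ms (itv_val z.1)).
    apply: addC_continuous.
      apply: realC_continuous => z; apply: cvgB; [exact: cvg_cst|exact: c1].
    by apply: mulC_continuous; [exact: realC_continuous|exact: cst].
  rewrite /y; apply: mulC_continuous.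
    apply: mulC_continuous; last exact: circle_continuous.
    apply: mulC_continuous; last exact: mulC_continuous.
    apply: mulC_continuous; last exact: cst.
    apply: realC_continuous => z; apply: cvgD.
      by apply: cvgB; [exact: cvg_cst|exact: c1].
    by apply: cvgM; [exact: c1|exact: cvg_cst].
  apply: invC_continuous => [|z]; last by apply: den0; exact: itv01.
  apply: subC_continuous; first exact: cst.
  apply: mulC_continuous; first exact: realC_continuous.
  by apply: mulC_continuous; [exact: cst|exact: circle_continuous].
exists (fun t => Hf (one, t)).
  exists Hf; split; first exact: cH.
  - move=> t; rewrite /Hf /= itv_val0 /y /ms /puncture_circle.
    by rewrite subr0 mul0r addr0 !rmorph0 !rmorph1 !mul0r addr0 subr0 divr1 expr1n mulr1 mul1r.
  - by [].
  - move=> s; rewrite /Hf /= itv_val0 itv_val1 /y.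
    by rewrite !(circleE r) circle_period.
move=> t; rewrite /Hf /= itv_val1.
set u := itv_val t.
have yE : y 1 u = lam * circle r u / (1 - c * circle r u).
  rewrite /y /ms subrr add0r !rmorph0 !rmorph1 add0r !mul1r mE; congr (_ / _).
  rewrite (circleE r) /eps /chi !rmorphM fmorphV /=.
  exact: rotation_scale Lc Kc ka0.
have w0 : circle r u != 0.
  by rewrite circleE mulf_neq0 ?circle_neq0 // -cabs_gt0 cabs_real normr_gt0 gt_eqF.
have [|h2 hz] := hlam (circle r u) w0; first by have := cwr u; lra.
rewrite of_plane_val // => [|T]; last by apply: uyN; rewrite lexx ler01.
by rewrite yE -hz zetaK.
Qed.

Lemma loop_around_circle j (x : X) (eta : {path I from b to x in X})
    (kappa : {path I from x to x in X}) :
  (forall t, kappa t = of_plane (puncture_circle j (itv_val t))) ->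
  loop_around (puncture a j) (concat (concat eta kappa) (reverse eta)).
Proof.
move=> kE; have [r [r0 hD [g hg gE]]] := circle_coordinate j.
exists r; split=> //.
have kf : (fun t => of_plane (puncture_circle j (itv_val t))) = kappa :> (I -> X).
  by apply/funext => t; rewrite kE.
rewrite kf in hg.
have [H [cH H0 H1 He]] := free_homotopic_trans (conjugate_free_homotopic eta kappa) hg.
exists H; split; [exact: cH|exact: H0|by move=> t; rewrite H1 gE|exact: He].
Qed.

End Circles.

Section Loops.
Variable R : realType.
Local Notation C := R[i].
Local Notation I := (unit_itv R).
Local Notation pole := (@pole R).
Local Notation sheet := (@sheet R).
Local Infix "@@" := (@concat R _ _ _ _) (at level 50, left associativity).
Variable a : 'I_3 -> sphere R.
Hypothesis a_inj : injective a.
Local Notation X := (punctured (range a)).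
Variable b : X.
Local Notation of_plane := (of_plane (a := a) b).
Local Notation to_plane := (to_plane (a := a)).
Local Notation puncture_circle := (@puncture_circle R).

Lemma sheet_avoid e (u : C) T : sheet e u -> u != pole T.
Proof. by move=> Su; apply/eqP => E; apply: (@sheet_pole R e T); rewrite -E. Qed.

Lemma sheet_homotopic e (x y : X) (p q : {path I from x to y in X}) :
  within (sheet e) p -> within (sheet e) q -> homotopic p q.
Proof. exact: (star_homotopic a_inj b (@sheet_star R e) (@sheet_avoid e)). Qed.

Lemma sheet_edge e (x y : X) : sheet e (to_plane x) -> sheet e (to_plane y) ->
  exists p : {path I from x to y in X}, within (sheet e) p.
Proof. exact: (edge_exists a_inj b (@sheet_star R e) (@sheet_avoid e)). Qed.

Lemma side_edge T (x y : X) : side T (to_plane x) -> side T (to_plane y) ->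
  exists p : {path I from x to y in X}, within (side T) p.
Proof.
move=> Sx Sy; apply: (edge_exists a_inj b (side_convex Sx) _ Sx Sy).
by move=> u S /(side_sub (e := true)) /sheet_avoid.
Qed.

Lemma middle_edge (x y : X) : middle (to_plane x) -> middle (to_plane y) ->
  exists p : {path I from x to y in X}, within (@middle R) p.
Proof.
move=> Sx Sy; apply: (edge_exists a_inj b (@middle_star R) _ Sx Sy).
by move=> u S /(middle_sub (e := true)) /sheet_avoid.
Qed.

Lemma circle_inv t : (circle (1 : R) t)^-1 = (cos (2 * pi * t) +i* - sin (2 * pi * t))%C.
Proof.
apply: (mulfI (circle_neq0 t)); rewrite mulfV ?circle_neq0 // /circle !mul1r.
have := cos2Dsin2 (2 * pi * t); set x := cos _; set y := sin _ => h.
apply/eqP; rewrite eq_complex /=; apply/andP; split; apply/eqP; last by ring.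
by rewrite -h; ring.
Qed.

(** The sheet that contains the first half of the reference circle. *)
Definition first_sheet j : bool := if j is Some T then ~~ T else false.

Lemma puncture_circle_Im j : exists2 k : R, 0 < k &
  forall t, Im (puncture_circle j t) = sg R (first_sheet j) * (k * sin (2 * pi * t)).
Proof.
case: j => [T|]; [exists 1 => // t|exists 4 => // t].
  rewrite /puncture_circle /plane_coord /circle_scale /circle /pole !mul1r; case: T;
    rewrite /sg /=; ring.
rewrite /puncture_circle /plane_coord /circle_scale invfM invrK circle_inv /pole /sg
  /first_sheet.
have -> : (4 : C) = (4 : R)%:C%C by rewrite rmorph_nat.
rewrite /=; ring.
Qed.

Lemma puncture_circle_first j t : 0 <= sg R (first_sheet j) * Im (puncture_circle j
  t) -> sheet (first_sheet j) (puncture_circle j t).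
Proof. by move=> h; apply: closed_half_sheet h _ _; exact: puncture_circle_neq. Qed.

Lemma puncture_circle_second j t : sg R (first_sheet j) * Im (puncture_circle j t) <=
  0 -> sheet (~~ first_sheet j) (puncture_circle j t).
Proof.
move=> h; apply: closed_half_sheet; try exact: puncture_circle_neq.
by move: h; rewrite /sg; case: first_sheet => /=; rewrite ?mul1r ?mulN1r ?oppr_ge0 // oppr_le0.
Qed.

Lemma to_plane_puncture_circle j t : to_plane (of_plane (puncture_circle j t)) =
  puncture_circle j t.
Proof. by apply: (to_plane_of_plane a_inj) => T; exact: puncture_circle_neq. Qed.

(** The reference circles are symmetric about the real axis, so each half lies in
    one closed half plane, and hence in a sheet. *)
Lemma circle_halves j (x m : X) : of_plane (puncture_circle j 0) = x -> of_plane
  (puncture_circle j 2^-1) = m ->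
  exists (h1 : {path I from x to m in X}) (h2 : {path I from m to x in X}),
  [/\ within (sheet (first_sheet j)) h1, within (sheet (~~ first_sheet j)) h2 &
      forall t, (h1 @@ h2) t = of_plane (puncture_circle j (itv_val t))].
Proof.
move=> x0 m0; have [k k0 kE] := puncture_circle_Im j.
have cont (c d : R) : continuous (fun t : I => of_plane (puncture_circle j (c *
  itv_val t + d))).
  apply: (of_plane_continuous a_inj) => [|t T]; last exact: puncture_circle_neq.
  apply: puncture_circle_continuous; apply: affine_continuous; exact: itv_val_continuous.
have e10 : of_plane (puncture_circle j (2^-1 * itv_val (zero : I) + 0)) = x by
  rewrite itv_val0 mulr0 addr0.
have e11 : of_plane (puncture_circle j (2^-1 * itv_val (one : I) + 0)) = m by rewrite
  itv_val1 mulr1 addr0.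
have e20 : of_plane (puncture_circle j (2^-1 * itv_val (zero : I) + 2^-1)) = m by
  rewrite itv_val0 mulr0 add0r.
have e21 : of_plane (puncture_circle j (2^-1 * itv_val (one : I) + 2^-1)) = x.
  rewrite itv_val1 mulr1 -x0; congr (of_plane (plane_coord j (_ * _))).
  by rewrite -circle_period; congr circle; lra.
pose h1 : {path I from x to m in X} := mk_path (cont _ _) e10 e11.
pose h2 : {path I from m to x in X} := mk_path (cont _ _) e20 e21.
have h1E s : h1 s = of_plane (puncture_circle j (2^-1 * itv_val s + 0)) by [].
have h2E s : h2 s = of_plane (puncture_circle j (2^-1 * itv_val s + 2^-1)) by [].
exists h1, h2; split.
- move=> t; have /andP[t0 t1] := itv01 t; rewrite h1E to_plane_puncture_circle;
  apply: puncture_circle_first.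
  rewrite kE mulrA sg2 mul1r mulr_ge0 ?(ltW k0) //; apply: sin_ge0_pi.
  have := pi_ge0 R; set u := itv_val t in t0 t1 *; nra.
- move=> t; have /andP[t0 t1] := itv01 t; rewrite h2E to_plane_puncture_circle;
  apply: puncture_circle_second.
  rewrite kE mulrA sg2 mul1r.
  have -> : 2 * pi * (2^-1 * itv_val t + 2^-1) = pi * itv_val t + pi by field.
  rewrite sinDpi mulrN oppr_le0 mulr_ge0 ?(ltW k0) //; apply: sin_ge0_pi.
  have := pi_ge0 R; set u := itv_val t in t0 t1 *; nra.
- move=> t; have /andP[t0 t1] := itv01 t; rewrite concatE /concat_fun.
  case: ifPn => h; rewrite ?h1E ?h2E clampK.
  + by congr (of_plane (puncture_circle j _)); field.
  + by apply/andP; split; lra.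
  + by congr (of_plane (puncture_circle j _)); field.
  + by rewrite -ltNge in h; apply/andP; split; lra.
Qed.

Definition base : X := of_plane 0.
Definition far T : X := of_plane (2 * pole T).
Definition out3 : X := of_plane 3.
Definition out5 : X := of_plane (- 5).

Lemma puncture_circle_start j t : circle (1 : R) t = (1 : C) -> puncture_circle j t =
  if j is Some T then 0 else 3.
Proof.
rewrite /puncture_circle => ->; case: j => [T|] /=; first by rewrite mulr1 subrr.
by rewrite mulr1 invrK /pole /sg rmorphN1; ring.
Qed.

Lemma puncture_circle_far j t : circle (1 : R) t = - (1 : C) -> puncture_circle j t =
  if j is Some T then 2 * pole T else - 5.
Proof.
rewrite /puncture_circle => ->; case: j => [T|] /=; first by rewrite mulrN1 opprK; ring.
by rewrite mulrN1 invrN invrK /pole /sg rmorphN1; ring.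
Qed.

Lemma circle_0 : circle (1 : R) 0 = 1.
Proof. by rewrite /circle !mul1r mulr0 cos0 sin0. Qed.

Lemma circle_half : circle (1 : R) 2^-1 = - 1.
Proof.
have -> : circle (1 : R) 2^-1 = (cos pi +i* sin pi)%C.
  by rewrite /circle !mul1r; congr (cos _ +i* sin _)%C; field.
by rewrite cospi sinpi; apply/eqP; rewrite eq_complex /= oppr0 !eqxx.
Qed.

Lemma to_plane_base : to_plane base = 0.
Proof. by rewrite (to_plane_of_plane a_inj) // => T; rewrite (sheet_avoid (e :=
  true)) //; exact: sheet0. Qed.

Lemma to_plane_far T : to_plane (far T) = 2 * pole T.
Proof.
rewrite (to_plane_of_plane a_inj) // => S; rewrite (sheet_avoid (e := true)) //.
exact: side_sub (@side_pole2 R T).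
Qed.

Lemma side3 : side true (3 : C).
Proof.
have -> : (3 : C) = (3 : R)%:C%C by rewrite rmorph_nat.
by rewrite /side /= normr0 /sg; lra.
Qed.

Lemma side5 : side false (- 5 : C).
Proof.
have -> : (- 5 : C) = (- 5 : R)%:C%C by rewrite rmorphN rmorph_nat.
by rewrite /side /= normr0 /sg; lra.
Qed.

Lemma to_plane_out3 : to_plane out3 = 3.
Proof.
rewrite (to_plane_of_plane a_inj) // => S; rewrite (sheet_avoid (e := true)) //.
exact: side_sub side3.
Qed.

Lemma to_plane_out5 : to_plane out5 = - 5.
Proof.
rewrite (to_plane_of_plane a_inj) // => S; rewrite (sheet_avoid (e := true)) //.
exact: side_sub side5.
Qed.

Lemma reverse_concat (x y z : X) (p : {path I from x to y in X})
    (q : {path I from y to z in X}) :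
  homotopic (reverse (p @@ q)) (reverse q @@ reverse p).
Proof.
have h : homotopic ((p @@ q) @@ (reverse q @@ reverse p)) (const_path R x).
  by rewrite concatA concatKr concat_reverse_r.
have := concatKVr (p @@ q) (reverse q @@ reverse p); rewrite h concat_const_r.
by move=> ->.
Qed.

Lemma reverse_reverse (x y : X) (p : {path I from x to y in X}) :
  homotopic (reverse (reverse p)) p.
Proof. by have := concatKVr (reverse p) p; rewrite concat_reverse_l concat_const_r. Qed.

Variables (beta : {path I from b to base in X}).
Variables (P Q : forall T, {path I from base to far T in X}).
Hypotheses (hP : forall T, within (sheet true) (P T))
           (hQ : forall T, within (sheet false) (Q T)).

(** From 0 to [2 * pole T] through the lower sheet and back through the upper one: this
    loop encircles only [pole T], counterclockwise for T = true and clockwise for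
    T = false. *)
Definition crossing T : loop R b := beta @@ (Q T @@ reverse (P T)) @@ reverse beta.

(** The circle around [pole T] goes from 0 to [2 * pole T] and back; its halves can be
    replaced by any paths in the same sheets. *)
Lemma loop_finite T : exists2 g : loop R b, loop_around (puncture a (Some T)) g &
  homotopic g (if T then crossing T else reverse (crossing T)).
Proof.
have E0 : of_plane (puncture_circle (Some T) 0) = base by rewrite
  (puncture_circle_start _ circle_0).
have E1 : of_plane (puncture_circle (Some T) 2^-1) = far T by rewrite
  (puncture_circle_far _ circle_half).
have [h1 [h2 [w1 w2 hE]]] := circle_halves E0 E1.
exists (beta @@ (h1 @@ h2) @@ reverse beta); first exact: (loop_around_circle a_inj).
case: T h1 h2 w1 w2 hE {E0 E1} => h1 h2 /= w1 w2 _.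
  by rewrite (sheet_homotopic w1 (@hQ true)) (sheet_homotopic w2 (within_reverse (@hP true))).
rewrite /crossing !reverse_concat.
rewrite (sheet_homotopic w1 (@hP false)) (sheet_homotopic w2 (within_reverse (@hQ false))).
by rewrite !reverse_reverse concatA.
Qed.

(** The large circle is seen from the third puncture as a positive loop, so in the
    plane it runs clockwise, from 3 below to -5 and back above.  Its lower half is
    homotopic in the lower sheet to a path through 2, 0 and -2, its upper half in
    the upper sheet to the way back, and the crossings cancel one by one. *)
Lemma loop_infinite : exists2 g : loop R b, loop_around (puncture a None) g &
  homotopic ((reverse (crossing false) @@ crossing true) @@ g) (const_path R b).
Proof.
have E0 : of_plane (puncture_circle None 0) = out3 by rewrite (puncture_circle_start
  _ circle_0).
have E1 : of_plane (puncture_circle None 2^-1) = out5 by rewrite (puncture_circle_far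
  _ circle_half).
have [h1 [h2 [w1 w2 hE]]] := circle_halves E0 E1.
have St : sheet true (to_plane base) by rewrite to_plane_base; exact: sheet0.
have S3 e : sheet e (to_plane out3) by rewrite to_plane_out3; exact: side_sub side3.
have [W hW] := sheet_edge St (S3 true).
exists ((beta @@ W) @@ (h1 @@ h2) @@ reverse (beta @@ W)).
  exact: (loop_around_circle a_inj).
have f3 : side true (to_plane out3) by rewrite to_plane_out3; exact: side3.
have fT T : side T (to_plane (far T)) by rewrite to_plane_far; exact: side_pole2.
have f5 : side false (to_plane out5) by rewrite to_plane_out5; exact: side5.
have [k hk] := side_edge (fT true) f3.
have [l hl] := side_edge (fT false) f5.
have sW : homotopic W (P true @@ k).
  apply: (sheet_homotopic hW); apply: within_concat; first exact: hP.
  exact: within_sub (@side_sub R true true) hk.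
have s1 : homotopic h1 (reverse k @@ (reverse (Q true) @@ (Q false @@ l))).
  apply: (sheet_homotopic w1); apply: within_concat.
    exact: within_reverse (within_sub (@side_sub R false true) hk).
  apply: within_concat; first exact: within_reverse (@hQ true).
  apply: within_concat; first exact: hQ.
  exact: within_sub (@side_sub R false false) hl.
have s2 : homotopic h2 (reverse l @@ (reverse (P false) @@ W)).
  apply: (sheet_homotopic w2); apply: within_concat.
    exact: within_reverse (within_sub (@side_sub R true false) hl).
  apply: within_concat; last exact: hW.
  by apply: within_reverse; exact: (@hP false).
rewrite s1 s2 sW /crossing !reverse_concat !reverse_reverse !concatA.
by rewrite !concatKVr !concatKr !concatKVr concatKr concat_reverse_r.
Qed.

End Loops.

(** * The monodromy of the system *)

Section ConjugateRepresentation.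
Variables (F : fieldType) (G : groupType) (n : nat).
Variables (rho : representation F G n) (P : 'M[F]_n).
Hypothesis Pu : P \in unitmx.

Fact rep_conj1 : conjm P (rho 1%g) = 1%:M.
Proof. by rewrite rep1 conjm1. Qed.

Fact rep_conjM g h : conjm P (rho (g * h)%g) = conjm P (rho g) *m conjm P (rho h).
Proof. by rewrite repM conjmM. Qed.

Definition rep_conj : representation F G n := Representation rep_conj1 rep_conjM.

Lemma rep_conj_iso : rep_iso rep_conj rho.
Proof.
exists (invmx P); first by rewrite unitmx_inv.
by move=> g; rewrite /= /conjm invmxK !mulmxA mulVmx // mul1mx mulmxKV.
Qed.

End ConjugateRepresentation.

Lemma rep_iso_trans (F : fieldType) (G : groupType) n (r s t : representation F G n) :
  rep_iso r s -> rep_iso s t -> rep_iso r t.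
Proof.
move=> [P Pu sE] [Q Qu tE]; exists (Q *m P); first by rewrite unitmx_mul Qu.
by move=> g; rewrite tE sE; exact: conjm_comp.
Qed.

Section Monodromy.
Variable R : realType.
Local Notation C := R[i].
Local Notation I := (unit_itv R).
Local Notation sheet := (@sheet R).
Local Infix "@@" := (@concat R _ _ _ _) (at level 50, left associativity).
Variable a : 'I_3 -> sphere R.
Hypothesis a_inj : injective a.
Local Notation X := (punctured (range a)).
Variable b : X.
Local Notation base := (base b).
Local Notation to_plane := (to_plane (a := a)).
Variables (n : nat) (rho : representation C (pi1 R b) n).
Variables (B : bool -> 'M[C]_n) (Y : bool -> C -> 'M[C]_n).
Hypothesis dY : forall e u, sheet e u ->
  is_derive u (1 : C) (Y e) (- (dlog_form B u *m Y e u)).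
Hypothesis Y_unit : forall e u, Y e u \in unitmx.
Hypothesis Y_middle : forall u, middle u -> Y true u = Y false u.
Variables (e0 : bool) (beta : {path I from b to base in X}).
Hypothesis beta_sheet : within (sheet e0) beta.
Variables (P Q : forall T, {path I from base to far b T in X}).
Hypotheses (hP : forall T, within (sheet true) (P T))
           (hQ : forall T, within (sheet false) (Q T)).
Hypothesis Y_side : forall T u, side T u ->
  Y true u *m rho (pi1_class (crossing beta P Q T)) = Y false u.

Lemma pi1_homotopic (p q : loop R b) : homotopic p q -> pi1_class p = pi1_class q.
Proof. by move=> pq; apply/pi1_classP. Qed.

(** The continuation along p, evaluated at x: the path p is closed up to a loop by
    a tail u, meant to lie in the sheet e, and by beta; rho of this loop is the
    factor by which the solution Y e has to be corrected. *)
Definition transport e (x : X) (p : {path I from b to x in X})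
    (u : {path I from x to base in X}) : 'M[C]_n :=
  Y e (to_plane x) *m rho (pi1_class (p @@ u @@ reverse beta)).

Lemma transport_homotopic e x (p p' : {path I from b to x in X})
    (u u' : {path I from x to base in X}) :
  homotopic p p' -> homotopic u u' -> transport e p u = transport e p' u'.
Proof.
move=> hp hu; congr (_ *m rho _); apply: pi1_homotopic.
by rewrite hp hu.
Qed.

(** Changing the sheet changes Y and the closing tail.  If x is in the middle
    region, neither matters, as the two tails together are contractible.  If x is
    on the side T, the two tails together form the crossing loop of T, whose
    image under rho is the factor between the two solutions. *)
Lemma transport_sheets x (p : {path I from b to x in X})
    (u u' : {path I from x to base in X}) :
  within (sheet true) u -> within (sheet false) u' ->
  transport true p u = transport false p u'.
Proof.
move=> hu hu'.
pose G : loop R b := beta @@ (reverse u' @@ u) @@ reverse beta.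
have E : pi1_class (p @@ u @@ reverse beta) =
    (pi1_class G * pi1_class (p @@ u' @@ reverse beta))%g.
  rewrite [RHS]pi1_mulE; apply: pi1_homotopic.
  by rewrite /G !concatA concatKVr concatKr.
rewrite /transport E repM mulmxA; congr (_ *m _).
have St : sheet true (to_plane x) by rewrite -[x](@path_zero _ _ _ _ u); exact: hu.
have Sf : sheet false (to_plane x) by rewrite -[x](@path_zero _ _ _ _ u'); exact: hu'.
have [Mx|[T Tx]] := sheetI St Sf.
  have M0 : middle (to_plane base) by rewrite to_plane_base //; exact: middle0.
  have [m hm] := middle_edge a_inj b M0 Mx.
  have r1 : homotopic (reverse u') m.
    apply: (sheet_homotopic a_inj b (within_reverse hu')).
    exact: within_sub (@middle_sub R false) hm.
  have r2 : homotopic u (reverse m).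
    apply: (sheet_homotopic a_inj b hu).
    exact: within_reverse (within_sub (@middle_sub R true) hm).
  have -> : pi1_class G = 1%g.
    apply: pi1_homotopic; rewrite /G r1 r2.
    by rewrite !concatA concatKr concat_reverse_r.
  by rewrite rep1 mulmx1 Y_middle.
have TT : side T (to_plane (far b T)) by rewrite to_plane_far //; exact: side_pole2.
have [k hk] := side_edge a_inj b TT Tx.
have r1 : homotopic (reverse u') (Q T @@ k).
  apply: (sheet_homotopic a_inj b (within_reverse hu')).
  apply: within_concat; first exact: hQ.
  exact: within_sub (@side_sub R false T) hk.
have r2 : homotopic u (reverse k @@ reverse (P T)).
  apply: (sheet_homotopic a_inj b hu); apply: within_concat.
    exact: within_reverse (within_sub (@side_sub R true T) hk).
  exact: within_reverse (@hP T).
have -> : pi1_class G = pi1_class (crossing beta P Q T).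
  apply: pi1_homotopic; rewrite /G /crossing r1 r2.
  by rewrite !concatA concatKr.
exact: Y_side.
Qed.

Lemma transport_indep e f x (p : {path I from b to x in X})
    (u u' : {path I from x to base in X}) :
  within (sheet e) u -> within (sheet f) u' ->
  transport e p u = transport f p u'.
Proof.
case: e f => -[] hu hu'; try exact: transport_sheets.
- exact/transport_homotopic/(sheet_homotopic a_inj b hu hu').
- exact/esym/transport_sheets.
- exact/transport_homotopic/(sheet_homotopic a_inj b hu hu').
Qed.

(** At the base point, beta itself serves as the tail.  The point x and the
    equality b = x are separate because the last point of a loop is equal to b
    only propositionally. *)
Lemma transport_loop e x (p : {path I from b to x in X}) (q : loop R b)
    (u : {path I from x to base in X}) :
  b = x -> (forall t, p t = q t) -> within (sheet e) u ->
  transport e p u = Y e0 (to_plane b) *m rho (pi1_class q).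
Proof.
move=> E; case: _ / E p u => p u pq hu.
rewrite (transport_indep p hu beta_sheet); congr (_ *m rho _); apply: pi1_homotopic.
by rewrite concatA concat_reverse_r concat_const_r; exact: homotopic_eq.
Qed.

Section Along.
Variable gamma : loop R b.

Fact initial_continuous_path (t : I) :
  continuous (fun s : I => gamma (clamp (itv_val t * itv_val s + 0))).
Proof.
have c := @affine_continuous R _ _ (itv_val t) 0 (@itv_val_continuous R).
exact: comp_continuous c (@ext_continuous R X b b gamma).
Qed.

Fact initial_path0 (t : I) : gamma (clamp (itv_val t * itv_val (zero : I) + 0)) = b.
Proof. by rewrite itv_val0 mulr0 addr0 clamp0 path_zero. Qed.

Fact initial_path1 (t : I) : gamma (clamp (itv_val t * itv_val (one : I) + 0)) = gamma t.
Proof. by rewrite itv_val1 mulr1 addr0 itv_valK. Qed.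

Definition initial_path (t : I) : {path I from b to gamma t in X} :=
  mk_path (@initial_continuous_path t) (initial_path0 t) (initial_path1 t).

Lemma initial_pathE t s :
  initial_path t s = gamma (clamp (itv_val t * itv_val s + 0)).
Proof. by []. Qed.

Fact between_continuous (t t' : I) : continuous (fun s : I =>
  gamma (clamp ((itv_val t' - itv_val t) * itv_val s + itv_val t))).
Proof.
have c := @affine_continuous R _ _ (itv_val t' - itv_val t) (itv_val t)
  (@itv_val_continuous R).
exact: comp_continuous c (@ext_continuous R X b b gamma).
Qed.

Fact between0 (t t' : I) :
  gamma (clamp ((itv_val t' - itv_val t) * itv_val (zero : I) + itv_val t)) = gamma t.
Proof. by rewrite itv_val0 mulr0 add0r itv_valK. Qed.

Fact between1 (t t' : I) :
  gamma (clamp ((itv_val t' - itv_val t) * itv_val (one : I) + itv_val t)) = gamma t'.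
Proof. by rewrite itv_val1 mulr1 subrK itv_valK. Qed.

Definition between (t t' : I) : {path I from gamma t to gamma t' in X} :=
  mk_path (@between_continuous t t') (between0 t t') (between1 t t').

Lemma betweenE t t' s : between t t' s =
  gamma (clamp ((itv_val t' - itv_val t) * itv_val s + itv_val t)).
Proof. by []. Qed.

Lemma initial_between (t t' : I) :
  homotopic (initial_path t') (initial_path t @@ between t t').
Proof.
symmetry; pose tv := itv_val t; pose tv' := itv_val t'.
pose phi (s : R) := if s <= 2^-1 then 2 * tv * s + 0
                    else 2 * (tv' - tv) * s + (2 * tv - tv').
have cphi : continuous phi.
  apply: paste_continuous (@id_continuous _) _ _ _.
  - exact: (@affine_continuous R _ id _ _ (@id_continuous R)).
  - exact: (@affine_continuous R _ id _ _ (@id_continuous R)).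
  - by move=> s ->; field.
have cpsi : continuous (fun s : R => tv' * s + 0).
  exact: (@affine_continuous R _ id _ _ (@id_continuous R)).
apply: (@homotopic_reparam R X b b b (gamma t') gamma _ _ phi _ cphi cpsi).
- by rewrite /phi invr_ge0 ler0n !mulr0.
- rewrite /phi ifF; last by apply/negbTE; rewrite -ltNge; lra.
  by ring.
- move=> s; have /andP[s0 s1] := itv01 s; rewrite concatE /concat_fun /phi.
  case: ifPn => h.
    rewrite initial_pathE clampK; last by apply/andP; split; lra.
    by congr (gamma (clamp _)); rewrite -/tv; ring.
  rewrite -ltNge in h.
  rewrite betweenE clampK; last by apply/andP; split; lra.
  by congr (gamma (clamp _)); rewrite -/tv -/tv'; ring.
- by [].
Qed.

Lemma some_sheet x : exists e, sheet e (to_plane x).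
Proof.
have h T := to_plane_neq a_inj x T.
have [y0|y0] := lerP 0 (Im (to_plane x)).
  by exists true; apply: closed_half_sheet => //; rewrite mul1r.
by exists false; apply: closed_half_sheet => //; rewrite mulN1r oppr_ge0 ltW.
Qed.

Lemma some_tail x : exists eu : bool * {path I from x to base in X},
  within (sheet eu.1) eu.2.
Proof.
have [e Se] := some_sheet x.
have Sb : sheet e (to_plane base) by rewrite to_plane_base //; exact: sheet0.
by have [u hu] := sheet_edge a_inj b Se Sb; exists (e, u).
Qed.

Definition tail x := sval (cid (some_tail x)).

Lemma tailP x : within (sheet (tail x).1) (tail x).2.
Proof. exact: svalP (cid (some_tail x)). Qed.

(** The continuation assigns to t the transport along the initial part of gamma,
    with any tail.  Near a given t the sheet e of gamma t still contains gamma t',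
    and a tail at gamma t' through e, preceded by the piece of gamma in between, is
    homotopic to the tail at gamma t.  The factor of Y e is therefore locally
    constant. *)
Lemma continuation_exists (v0 : 'cV[C]_n) :
  exists v, [/\ continuation (fuchsian_system a B) gamma v,
    v zero = Y e0 (to_plane b) *m v0 &
    v one = Y e0 (to_plane b) *m rho (pi1_class gamma) *m v0].
Proof.
pose val t := transport (tail (gamma t)).1 (initial_path t) (tail (gamma t)).2.
exists (fun t => val t *m v0); split; last first.
- rewrite /val (@transport_loop _ _ _ gamma) //; first by rewrite path_one.
    by move=> t; rewrite initial_pathE itv_val1 mul1r addr0 itv_valK.
  exact: tailP.
- rewrite /val (@transport_loop _ _ _ (const_path R b)); first 1 last.
  + by rewrite path_zero.
  + by move=> t; rewrite initial_pathE itv_val0 mul0r addr0 clamp0 path_zero.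
  + exact: tailP.
  have -> : pi1_class (const_path R b) = 1%g by [].
  by rewrite rep1 mulmx1.
move=> t; pose e := (tail (gamma t)).1; pose u := (tail (gamma t)).2.
pose c : 'cV[C]_n := rho (pi1_class (initial_path t @@ u @@ reverse beta)) *m v0.
exists (sheet_points a e), (fun p => Y e (zeta a p) *m c).
have Se : sheet e (to_plane (gamma t)).
  by rewrite -[X in to_plane X](@path_zero _ _ _ _ u); exact: tailP.
split.
- exact: sheet_points_open.
- by split; [exact: valX|exact: Se].
- exact: sheet_horizontal.
have cg : continuous (fun s : R => to_plane (gamma (clamp s))).
  exact: comp_continuous (@ext_continuous R X b b gamma) (to_plane_continuous a_inj).
have : \forall s \near itv_val t, sheet e (to_plane (gamma (clamp s))).
  have Se' : sheet e (to_plane (gamma (clamp (itv_val t)))) by rewrite itv_valK.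
  apply: (cg (itv_val t) (sheet e)).
  by apply: open_nbhs_nbhs; split; [exact: sheet_open|exact: Se'].
move=> /nbhs_ballP[r /= r0 hr].
have near_t : \forall t' \near t, `|itv_val t - itv_val t'| < r.
  apply: (@itv_val_continuous R t [set s | `|itv_val t - s| < r]).
  by apply/nbhs_ballP; exists r.
apply: filterS near_t => t' tt'.
have hb : within (sheet e) (between t t').
  move=> s; rewrite betweenE; apply: hr; rewrite /ball /=.
  have /andP[s0 s1] := itv01 s.
  have -> : itv_val t - ((itv_val t' - itv_val t) * itv_val s + itv_val t) =
    (itv_val t - itv_val t') * itv_val s by ring.
  rewrite normrM (ger0_norm s0); apply: le_lt_trans tt'.
  by rewrite ler_piMr.
have Se' : sheet e (to_plane (gamma t')).
  by rewrite -[X in to_plane X](@path_one _ _ _ _ (between t t')); exact: hb.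
have Sb : sheet e (to_plane base) by rewrite to_plane_base //; exact: sheet0.
have [u' hu'] := sheet_edge a_inj b Se' Sb.
have E : homotopic (initial_path t' @@ u' @@ reverse beta)
    (initial_path t @@ u @@ reverse beta).
  have hbu : within (sheet e) (between t t' @@ u') by exact: within_concat.
  rewrite (initial_between t t') !concatA -[between t t' @@ _]concatA.
  by rewrite (sheet_homotopic a_inj b hbu (@tailP (gamma t))).
by rewrite /val (transport_indep _ (@tailP _) hu') /transport -mulmxA (pi1_homotopic E).
Qed.

End Along.

(** The conjugation by Y e0 at the base point accounts for expressing the
    monodromy in terms of the values of the solutions at b. *)
Lemma fuchsian_monodromy : is_monodromy (fuchsian_system a B) (rep_conj rho (Y_unit
  e0 (to_plane b))).
Proof.
move=> gamma v0.
have [v [cv vz vo]] := continuation_exists gamma (invmx (Y e0 (to_plane b)) *m v0).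
exists v; split; first exact: cv.
  by rewrite vz mulmxA mulmxV // mul1mx.
by rewrite vo /= /conjm !mulmxA.
Qed.

End Monodromy.

Theorem corollary2 (R : realType)
    (m : 'I_3 -> nat) (m_gt0 : forall i, (0 < m i)%N)
    (m_sum : 1 < \sum_(i < 3) (m i)%:R^-1 :> rat)
    (a : 'I_3 -> sphere R) (a_inj : injective a)
    (n : nat) (b : punctured (range a))
    (rho : representation R[i] (pi1 R b) n)
    (rho_unip : forall (i : 'I_3) (gamma : loop R b),
       loop_around (a i) gamma ->
       (rho (pi1_class gamma) - 1%:M) ^+ (m i) = 0) :
  exists (nabla : log_connection (range a) n)
         (mu : representation R[i] (pi1 R b) n),
    is_monodromy nabla mu /\ rep_iso mu rho.
Proof.
have [e0 Sb] := some_sheet a_inj b.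
have S0 e : sheet e (to_plane (base b)) by rewrite to_plane_base //; exact: sheet0.
have ST e T : sheet e (to_plane (far b T)).
  by rewrite to_plane_far //; exact: side_sub (@side_pole2 R T).
have [beta hbeta] := sheet_edge a_inj b Sb (S0 e0).
pose P T := sval (cid (sheet_edge a_inj b (S0 true) (ST true T))).
pose Q T := sval (cid (sheet_edge a_inj b (S0 false) (ST false T))).
have hP T : within (@sheet R true) (P T) := svalP (cid (sheet_edge a_inj b (S0 true)
  (ST true T))).
have hQ T : within (@sheet R false) (Q T) := svalP (cid (sheet_edge a_inj b (S0
  false) (ST false T))).
have [g0 a_g0 h_g0] := loop_finite a_inj beta hP hQ false.
have [g1 a_g1 h_g1] := loop_finite a_inj beta hP hQ true.
have [g2 a_g2 h_g2] := loop_infinite a_inj beta hP hQ.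
pose gam (i : 'I_3) := nth g2 [:: g0; g1] i.
have a_gam i : loop_around (a i) (gam i).
  case: i => -[|[|[|]]] // H; rewrite /gam /=.
  - by rewrite (_ : Ordinal H = inord 0) //; apply/val_inj; rewrite /= inordK.
  - by rewrite (_ : Ordinal H = inord 1) //; apply/val_inj; rewrite /= inordK.
  - by rewrite (_ : Ordinal H = inord 2) //; apply/val_inj; rewrite /= inordK.
pose N i := rho (pi1_class (gam i)) - 1%:M.
have NE i : 1%:M + N i = rho (pi1_class (gam i)) by rewrite /N subrKC.
have class0 : pi1_class g0 = (pi1_class (crossing beta P Q false))^-1%g.
  by rewrite [RHS]pi1_invE; exact: pi1_homotopic.
have class1 : pi1_class g1 = pi1_class (crossing beta P Q true) by exact: pi1_homotopic.
have class2 : (pi1_class g2 * pi1_class g1 * pi1_class g0)%g = 1%g.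
  rewrite -mulgA [(pi1_class g1 * _)%g]pi1_mulE [LHS]pi1_mulE.
  by apply: pi1_homotopic; rewrite h_g0 h_g1.
have [||Pm Pmu [d dN]] := @triple_triangular _ n m N m_gt0 m_sum.
- by move=> i; exact: rho_unip.
- by rewrite !NE -!repM class2 rep1.
pose rho' := rep_conj rho Pmu.
have rhoE i : rho' (pi1_class (gam i)) = 1%:M + conjm Pm (N i).
  by rewrite -{1}(conjm1 Pmu) -conjmD NE.
have rho0 : rho' (pi1_class g0) = 1%:M + conjm Pm (N 0) := rhoE 0.
have rho1 : rho' (pi1_class g1) = 1%:M + conjm Pm (N 1) := rhoE 1.
have [N1' dN1' N1E] := unipotent_inverse (dN 1).
pose NN (T : bool) := if T then N1' else conjm Pm (N 0).
have [|B [Y [dY Yu Ym Ys]]] := @sheet_solutions R n d NN.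
  by case; [exact: dN1'|exact: dN].
have Y_side T u : side T u ->
    Y true u *m rho' (pi1_class (crossing beta P Q T)) = Y false u.
  move=> /Ys ->; rewrite -mulmxA; case: T; rewrite /NN.
    by rewrite -class1 rho1 (mulmx1C N1E) mulmx1.
  by rewrite -rho0 -repM class0 mulVg rep1 mulmx1.
exists (fuchsian_system a B), (rep_conj rho' (Yu e0 (to_plane b))); split.
  exact: (fuchsian_monodromy a_inj dY Yu Ym hbeta hP hQ Y_side).
exact: rep_iso_trans (rep_conj_iso _ _) (rep_conj_iso _ _).
Qed.
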